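(* Let $p\in[1,\infty)$, let $X=(X,d,\mu)$ be a $p$-admissible metric measure space, let $\theta\in(0,p)$, and let $E\subset X$ be a (closed) Ahlfors--David codimension-$\theta$ regular set. Then $$B^{\theta/p}_{p,1}(X)\big|_E=L_p(E,\mathcal H_\theta\lfloor_E),$$ with equivalence of the quotient-space norm and the $L_p(E,\mathcal H_\theta\lfloor_E)$-norm.
   Context: A metric measure space $(X,d,\mu)$ consists of a complete separable metric space $(X,d)$ and a Borel regular (outer) measure $\mu$ with $0<\mu(B_r(x))<\infty$ for all $x\in X$, $r>0$, where $B_r(x)$ is the open ball. For a Lipschitz function $f:X\to\mathbb R$, $\operatorname{lip}f(x)=\limsup_{y\to x}\frac{|f(y)-f(x)|}{d(y,x)}$ if $x$ is an accumulation point and $\operatorname{lip}f(x)=0$ if $x$ is isolated. For $q\in[1,\infty)$, the space is $q$-admissible if: (1) $\mu$ is uniformly locally doubling: for every $R>0$ there is $C_\mu(R)>0$ with $\mu(B_{2r}(x))\le C_\mu(R)\mu(B_r(x))$ for all $x\in X$, $r\in(0,R]$; (2) it supports a local weak $(1,q)$-Poincaré inequality: for every $R>0$ there are $C=C(R)>0$, $\lambda=\lambda(R)\ge1$ such that for every Lipschitz $f:X\to\mathbb R$, all $x\in X$ and $r\in(0,R]$, $$\frac1{\mu(B_r(x))}\int_{B_r(x)}\Big|f-\frac1{\mu(B_r(x))}\int_{B_r(x)}f\,d\mu\Big|\,d\mu\le Cr\Big(\frac1{\mu(B_{\lambda r}(x))}\int_{B_{\lambda r}(x)}(\operatorname{lip}f)^q\,d\mu\Big)^{1/q}.$$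 Codimension-$\theta$ Hausdorff measure: for $F\subset X$, $\delta>0$, $\mathcal H_{\theta,\delta}(F)=\inf\{\sum_i\mu(B_{r_i}(x_i))r_i^{-\theta}\}$ over at most countable coverings $F\subset\bigcup_iB_{r_i}(x_i)$ with $0<r_i<\delta$, and $\mathcal H_\theta(F)=\lim_{\delta\to0}\mathcal H_{\theta,\delta}(F)$. $\mathcal H_\theta\lfloor_E(G)=\mathcal H_\theta(G\cap E)$. A closed set $E\subset X$ is Ahlfors--David codimension-$\theta$ regular if there are $c_1,c_2>0$ with $c_1\frac{\mu(B_r(x))}{r^\theta}\le\mathcal H_\theta(B_r(x)\cap E)\le c_2\frac{\mu(B_r(x))}{r^\theta}$ for all $x\in E$, $r\in(0,1]$. For $f\in L_1^{\mathrm{loc}}(X)$ (integrable on balls) and $t>0$, put $$\overline\Delta_tf(x)=\frac1{\mu(B_t(x))}\int_{B_t(x)}\Big|f(y)-\frac1{\mu(B_t(x))}\int_{B_t(x)}f\,d\mu\Big|\,d\mu(y).$$ For $s\in(0,1)$, $B^s_{p,1}(X)$ consists of all $f\in L_p(X)=L_p(X,\mu)$ with $\|f\|_{b^s_{p,1}(X)}:=\int_0^1 t^{-s}\|\overline\Delta_tf\|_{L_p(X)}\frac{dt}{t}<\infty$, with norm $\|f\|_{B^s_{p,1}(X)}=\|f\|_{L_p(X)}+\|f\|_{b^s_{p,1}(X)}$. With $\nu=\mathcal H_\theta\lfloor_E$: a $\nu$-measurable $\phi:E\to\mathbb R$ is a trace of $f\in L_1^{\mathrm{loc}}(X)$ to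 $E$ if $\lim_{r\to0}\frac1{\mu(B_r(x))}\int_{B_r(x)}|f(y)-\phi(x)|\,d\mu(y)=0$ for $\nu$-a.e. $x\in E$; its class modulo $\nu$-negligible sets is $\operatorname{Tr}f$. If every $f$ in a normed function space $F(X)\subset L_1^{\mathrm{loc}}(X)$ has a trace to $E$, the trace-space is $F(X)|_E=\{\operatorname{Tr}f:f\in F(X)\}$ with the quotient-space norm $\|\phi\|_{F(X)|_E}=\inf\{\|f\|_{F(X)}:f\in F(X),\ \operatorname{Tr}f=\phi\}$. (The assertion includes that the trace operator is well defined on $B^{\theta/p}_{p,1}(X)$.) *)

(* Defs.v *)
From HB Require Import structures.
From mathcomp Require Import all_boot all_order all_algebra.
From mathcomp Require Import all_classical all_reals all_analysis.

Set Implicit Arguments.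
Unset Strict Implicit.
Unset Printing Implicit Defensive.

Import Order.TTheory GRing.Theory Num.Def Num.Theory.
Import numFieldNormedType.Exports.

Local Open Scope classical_set_scope.
Local Open Scope ring_scope.
Local Open Scope ereal_scope.

(* [Complete] carries a base point, so such a space is nonempty. *)
#[short(type="completeMetricType")]
HB.structure Definition CompleteMetric (R : numDomainType) :=
  {T of Metric R T & Complete T}.

Definition separable (T : topologicalType) : Prop :=
  exists2 D : set T, countable D & dense D.

(* The measure obtained from an outer measure [mu] on the sigma-algebra of its
   Caratheodory-measurable sets; "mu-measurable", integrals and almost
   everywhere statements always refer to this (complete) measure. *)
Definition cara (R : realType) (T : pointedType)
    (mu : {outer_measure set T -> \bar R}) :
    {measure set (caratheodory_type mu) -> \bar R} :=
  (mu : set (caratheodory_type mu) -> \bar R).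

Definition borel_regular (R : realType) (T : topologicalType)
    (mu : {outer_measure set T -> \bar R}) : Prop :=
  (<<s @open T >> `<=` mu.-caratheodory) /\
  (forall A : set T, exists B, [/\ <<s @open T >> B, A `<=` B & mu B = mu A]).

Definition metric_measure_space (R : realType) (X : completeMetricType R)
    (mu : {outer_measure set X -> \bar R}) : Prop :=
  [/\ separable X,
      borel_regular mu &
      forall (x : X) (r : R), (0 < r)%R -> 0 < mu (ball x r) < +oo].

Section averages.
Context (R : realType) (X : completeMetricType R).
Variable mu : {outer_measure set X -> \bar R}.

Definition ball_avg (g : X -> \bar R) (x : X) (r : R) : \bar R :=
  (mu (ball x r))^-1 * \int[cara mu]_(y in ball x r) g y.

Definition loc_integrable (f : X -> R) : Prop :=
  forall (x : X) (r : R), (0 < r)%R ->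
    (cara mu).-integrable (ball x r) (EFin \o f).

(* [fine] is harmless: the inner average is finite for locally integrable f. *)
Definition mean_osc (f : X -> R) (t : R) (x : X) : \bar R :=
  ball_avg (fun y => `| f y - fine (ball_avg (EFin \o f) x t) |%:E) x t.

End averages.

Section admissible.
Context (R : realType) (X : completeMetricType R).
Variable mu : {outer_measure set X -> \bar R}.

Definition lipschitz_fun (f : X -> R) : Prop :=
  exists L : R, forall x y : X, (`| f x - f y | <= L * mdist x y)%R.

Definition lip (f : X -> R) (x : X) : \bar R :=
  if `[< limit_point [set: X] x >] then
    limf_esup (fun y => (`| f y - f x | / mdist y x)%:E) x^'
  else 0.

Definition uniformly_locally_doubling : Prop :=
  forall Rad : R, (0 < Rad)%R -> exists2 C : R, (0 < C)%R &
    forall (x : X) (r : R), (0 < r <= Rad)%R ->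
      mu (ball x (2 * r)%R) <= C%:E * mu (ball x r).

Definition local_weak_poincare (q : R) : Prop :=
  forall Rad : R, (0 < Rad)%R ->
    exists C lambda : R, [/\ (0 < C)%R, (1 <= lambda)%R &
      forall f : X -> R, lipschitz_fun f ->
      forall (x : X) (r : R), (0 < r <= Rad)%R ->
        mean_osc mu f r x <=
        (C * r)%:E *
          (ball_avg mu (fun y => lip f y `^ q) x (lambda * r)%R) `^ q^-1].

Definition admissible (q : R) : Prop :=
  uniformly_locally_doubling /\ local_weak_poincare q.

End admissible.

Section codimension_hausdorff.
Context (R : realType) (X : completeMetricType R).
Variable mu : {outer_measure set X -> \bar R}.
Variable theta : R.

(* At most countable coverings are indexed by an arbitrary D : set nat. *)
Definition codim_cover (delta : R) (F : set X)
    (c : set nat * (nat -> X) * (nat -> R)) : Prop :=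
  let: (D, x, r) := c in
  (forall i, D i -> (0 < r i < delta)%R) /\
  F `<=` \bigcup_(i in D) ball (x i) (r i).

Definition codim_weight (c : set nat * (nat -> X) * (nat -> R)) : \bar R :=
  let: (D, x, r) := c in
  \esum_(i in D) (mu (ball (x i) (r i)) * ((r i) `^ (- theta))%:E).

Definition codim_content (delta : R) (F : set X) : \bar R :=
  ereal_inf (codim_weight @` codim_cover delta F).

Definition codim_hausdorff (F : set X) : \bar R :=
  lim (codim_content delta F @[delta --> (0 : R)^'+]).

Definition codim_hausdorff_on (E G : set X) : \bar R :=
  codim_hausdorff (G `&` E).

Let term_ge0 (x : X) (r : R) : 0 <= mu (ball x r) * (r `^ (- theta))%:E.
Proof. by rewrite mule_ge0 ?outer_measure_ge0// lee_fin powR_ge0. Qed.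

Let weight_ge0 c : 0 <= codim_weight c.
Proof. by case: c => -[D x] r; apply: esum_ge0 => i _; exact: term_ge0. Qed.

Lemma codim_content_ge0 delta F : 0 <= codim_content delta F.
Proof. by apply: le_ereal_inf_tmp => _ [c _ <-]; exact: weight_ge0. Qed.

Lemma codim_content0 delta : codim_content delta set0 = 0.
Proof.
apply/eqP; rewrite eq_le codim_content_ge0 andbT.
apply: ereal_inf_lbound; exists (set0, fun=> point, fun=> 0%R) => /=.
  by split=> // i [].
by rewrite esum_set0.
Qed.

Lemma le_codim_content delta : {homo codim_content delta : A B / A `<=` B >-> A <= B}.
Proof.
move=> A B AB; apply: ereal_inf_le_tmp => _ [[[D x] r] [Dr BD] <-].
by exists (D, x, r) => //; split=> //; exact: subset_trans BD.
Qed.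

Lemma codim_content_sigma_subadditive delta : sigma_subadditive (codim_content delta).
Proof.
move=> A; set M := codim_content delta.
have M0 n : 0 <= M (A n) by exact: codim_content_ge0.
have [[i ioo]|] := pselect (exists i, M (A i) = +oo).
  by rewrite (eseries_pinfty _ _ ioo) ?leey// => n _; rewrite -ltNye (lt_le_trans _ (M0 _)).
rewrite -forallNE => Aoo; apply/lee_addgt0Pr => e e0.
apply: le_trans (epsilon_trick _ M0 (ltW e0)).
pose P n c := codim_cover delta (A n) c /\
  codim_weight c <= M (A n) + (e / (2 ^ n.+1)%:R)%:E.
have [G PG] : {G : nat -> _ & forall n, P n (G n)}.
  apply: (@choice _ _ P) => n.
  have fM : M (A n) \is a fin_num by rewrite ge0_fin_numE// ltey; apply/eqP/Aoo.
  have en : (0 < e / (2 ^ n.+1)%:R)%R by rewrite divr_gt0// ltr0n expn_gt0.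
  have [_ [c cA <-] cM] := lb_ereal_inf_adherent en fM.
  by exists c; split=> //; exact: ltW.
pose D n := (G n).1.1; pose x n := (G n).1.2; pose r n := (G n).2.
have GE n : G n = (D n, x n, r n) by rewrite /D /x /r; case: (G n) => -[].
pose a (k : nat * nat) :=
  mu (ball (x k.1 k.2) (r k.1 k.2)) * ((r k.1 k.2) `^ (- theta))%:E.
pose J n := [set (n, i) | i in D n].
have /card_esym/ppcard_eqP[f] := card_nat2.
pose K := f @^-1` (\bigcup_n J n).
have KE : \esum_(i in K) a (f i) = \esum_(k in \bigcup_n J n) a k.
  apply/esym/reindex_esum; split; first by move=> k.
    by move=> i j _ _; apply: inj; rewrite inE.
  by move=> k Jk; exists (f^-1%FUN k); rewrite /K/= invK ?inE.
apply: (@le_trans _ _ (\esum_(i in K) a (f i))).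
  apply: ereal_inf_lbound; exists (K, fun i => x (f i).1 (f i).2, fun i => r (f i).1 (f i).2) => //.
  split=> [i [n _ [j Dj fij]]|t [n _ At]].
    by have [] := PG n; rewrite GE -fij => -[+ _] _; exact.
  have [] := PG n; rewrite GE => -[_ /(_ _ At)[j Dj xj]] _.
  exists (f^-1%FUN (n, j)); rewrite /K/= invK ?inE//.
  by exists n => //; exists j.
rewrite KE esum_bigcupT; first last.
- by move=> k; exact: term_ge0.
- by move=> n m _ _ [_ [[i _ <-] [j _ [->]]]].
rewrite nneseries_esumT => [|n]; last first.
  by apply: adde_ge0; [exact: M0|rewrite lee_fin divr_ge0// ltW].
apply: le_esum => n _.
have [_] := PG n; apply: le_trans; rewrite GE /codim_weight.
by rewrite esum_image// => i j _ _ [].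
Qed.

Lemma codim_hausdorffE F :
  codim_hausdorff F = ereal_sup [set codim_content delta F | delta in `]0%R, +oo[%classic].
Proof.
apply/cvg_lim => //; apply: (@nonincreasing_at_right_cvge _ _ _ +oo%O) => //.
move=> d1 d2 _ _ d12; apply: ereal_inf_le_tmp => _ [[[D x] r] [Dr FI] <-].
exists (D, x, r) => //; split=> // i /Dr /andP[-> /= rd]; exact: lt_le_trans d12.
Qed.

Lemma codim_hausdorff0 : codim_hausdorff set0 = 0.
Proof.
rewrite codim_hausdorffE; apply/eqP; rewrite eq_le; apply/andP; split.
  by apply: ge_ereal_sup => _ [d _ <-]; rewrite codim_content0.
by apply: ereal_sup_ubound; exists 1%R; rewrite ?codim_content0//= in_itv/= ltr01.
Qed.

Lemma codim_hausdorff_ge0 F : 0 <= codim_hausdorff F.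
Proof.
rewrite codim_hausdorffE; apply: le_trans (codim_content_ge0 1%R F) _.
by apply: ereal_sup_ubound; exists 1%R => //=; rewrite in_itv/= ltr01.
Qed.

Lemma le_codim_hausdorff : {homo codim_hausdorff : A B / A `<=` B >-> A <= B}.
Proof.
move=> A B AB; rewrite !codim_hausdorffE; apply: ge_ereal_sup => _ [d d0 <-].
apply: le_trans (le_codim_content d AB) _.
by apply: ereal_sup_ubound; exists d.
Qed.

Lemma codim_hausdorff_sigma_subadditive : sigma_subadditive codim_hausdorff.
Proof.
move=> A; rewrite [leLHS]codim_hausdorffE; apply: ge_ereal_sup => _ [d d0 <-].
apply: le_trans (codim_content_sigma_subadditive d A) _.
apply: lee_nneseries => [n _ _|n _]; first exact: codim_content_ge0.
by rewrite codim_hausdorffE; apply: ereal_sup_ubound; exists d.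
Qed.

HB.instance Definition _ := isOuterMeasure.Build R X codim_hausdorff
  codim_hausdorff0 codim_hausdorff_ge0 le_codim_hausdorff
  codim_hausdorff_sigma_subadditive.

Section restriction.
Variable E : set X.

Let on0 : codim_hausdorff_on E set0 = 0.
Proof. by rewrite /codim_hausdorff_on set0I codim_hausdorff0. Qed.

Let on_ge0 G : 0 <= codim_hausdorff_on E G.
Proof. exact: codim_hausdorff_ge0. Qed.

Let le_on : {homo codim_hausdorff_on E : A B / A `<=` B >-> A <= B}.
Proof. by move=> A B AB; apply: le_codim_hausdorff; exact: setSI. Qed.

Let on_sigma_subadditive : sigma_subadditive (codim_hausdorff_on E).
Proof.
move=> A; rewrite /codim_hausdorff_on setI_bigcupl.
exact: codim_hausdorff_sigma_subadditive.
Qed.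

HB.instance Definition _ := isOuterMeasure.Build R X (codim_hausdorff_on E)
  on0 on_ge0 le_on on_sigma_subadditive.

End restriction.

Definition codim_regular (E : set X) : Prop :=
  closed E /\
  exists c1 c2 : R, [/\ (0 < c1)%R, (0 < c2)%R &
    forall (x : X) (r : R), E x -> (0 < r <= 1)%R ->
      c1%:E * (mu (ball x r) * (r `^ theta)^-1%:E)
        <= codim_hausdorff (ball x r `&` E)
        <= c2%:E * (mu (ball x r) * (r `^ theta)^-1%:E)].

End codimension_hausdorff.

Section besov.
Context (R : realType) (X : completeMetricType R).
Variable mu : {outer_measure set X -> \bar R}.
Variables (s p : R).

Definition besov_seminorm (f : X -> R) : \bar R :=
  \int[lebesgue_measure]_(t in `]0%R, 1%R[%classic)
    ((t `^ (- s))%:E * 'N[cara mu]_p%:E[mean_osc mu f t] * t^-1%:E).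

Definition besov : set (X -> R) :=
  [set f | (f : caratheodory_type mu -> R) \in Lfun (cara mu) p%:E
           /\ besov_seminorm f < +oo].

Definition besov_norm (f : X -> R) : \bar R :=
  'N[cara mu]_p%:E[EFin \o f] + besov_seminorm f.

End besov.

(* A function on E is represented by a function on X, of which only the values
   on E matter: every subset of ~` E is [codim_hausdorff_on mu theta E]-null
   (hence measurable).  A class modulo null sets is represented by its
   members. *)
Section traces.
Context (R : realType) (X : completeMetricType R).
Variable mu : {outer_measure set X -> \bar R}.
Variables (theta : R) (E : set X).
Local Notation nu := (cara (codim_hausdorff_on mu theta E)).

Definition is_trace (f phi : X -> R) : Prop :=
  [/\ loc_integrable mu f,
      measurable_fun setT
        (phi : caratheodory_type (codim_hausdorff_on mu theta E) -> R) &
      {ae nu, forall x, E x ->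
        ball_avg mu (fun y => `| f y - phi x |%:E) x r @[r --> (0 : R)^'+]
          --> 0}].

Definition trace_space (F : set (X -> R)) : set (X -> R) :=
  [set phi | exists2 f, F f & is_trace f phi].

Definition trace_norm (F : set (X -> R)) (normF : (X -> R) -> \bar R)
    (phi : X -> R) : \bar R :=
  ereal_inf [set normF f | f in [set f | F f /\ is_trace f phi]].

End traces.

(* Main.v *)
(** Only the doubling property is used, in the form of a transfer principle:
    for a [rho]-net of E, balls of comparable radius carry comparable amounts
    of [mu] and of [rho^theta nu], so a function h satisfying a local Harnack
    inequality has a measurable majorant whose integral for one measure is
    controlled by an integral for the other one ([net_transfer]).

    Traces: with dyadic radii, the increments of the averages of f are bounded
    by mean oscillations, and the transfer principle bounds the sum over k of
    their L_p(nu)-norms by the Besov seminorm.  Hence the averages converge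
    nu-almost everywhere, and the limit is bounded in L_p(nu).

    Extension: a Lipschitz G of bounded support extends as
    F = G * tent r E, whose oscillation at scale t is at most
    2 min(t/r, 1) times a majorant of norm r^s ||G||, up to an error which
    vanishes as r -> 0; since the integral of r^s min(t/r, 1) t^(-s-1) over
    ]0, 1[ is bounded independently of r, so is ||F||/||G||.  A general phi is
    a rapidly converging series of such G, and the trace estimate applied to the
    remainders identifies the trace of the sum of the extensions as phi. *)
Require Import Defs.
From mathcomp Require Import all_boot all_order all_algebra.
From mathcomp Require Import all_classical all_reals all_analysis measurable_realfun.
From mathcomp Require Import lra ring.
Set Implicit Arguments.
Unset Strict Implicit.
Unset Printing Implicit Defensive.
Import Order.TTheory GRing.Theory Num.Theory.
Import numFieldNormedType.Exports.
Local Open Scope classical_set_scope.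
Local Open Scope ring_scope.

(** * Integrals and L_p-norms *)

(** The oscillation [mean_osc] is not shown to be measurable in the point, nor its norm in the
    scale. The integral of a nonnegative function is a supremum over simple functions, so it is
    monotone for arbitrary functions, but subadditivity is only available for measurable ones. This
    shapes the proof: lower bounds of the Besov seminorm compare its integrand with a step function,
    and upper bounds carry along measurable majorants, to which Minkowski's inequality and the
    exchange of sum and integral apply. A second obstacle is that the measurable sets of mu and of
    nu differ: what passes from one side to the other must be Borel, hence lower semicontinuous
    averages and majorants that are countable sums over balls.

    The smoothness theta/p is the exponent left by the p-th root of the factor relating mu and nu at
    a given scale. In the extension, r depends on the Lipschitz constant and the support of G, so
    the construction is not linear; only its constant is uniform, and this is why phi is written as
    a series converging in norm. *)

Section lower_integral.
Context d (T : measurableType d) (R : realType).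
Variable m : {measure set T -> \bar R}.
Local Open Scope ereal_scope.

(** Both integrals are suprema over the simple functions below the integrand, so enlarging the
    integrand enlarges the family. This holds for arbitrary functions, such as [mean_osc]. *)
Lemma le_integral_lower (f g : T -> \bar R) :
  (forall x, 0 <= f x) -> (forall x, f x <= g x) ->
  \int[m]_x f x <= \int[m]_x g x.
Proof.
move=> f0 fg; have g0 x : 0 <= g x by exact: le_trans (f0 x) (fg x).
rewrite !ge0_integralTE//; apply: ereal_sup_le => _ [h /= hf <-].
by exists h => // x; exact: le_trans (hf x) (fg x).
Qed.

Lemma lee_poweR (x y : \bar R) (p : R) :
  (0 <= p)%R -> 0 <= x -> x <= y -> x `^ p <= y `^ p.
Proof.
move=> p0 x0 xy; apply: gt0_ler_poweR => //; rewrite in_itv/= leey andbT//.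
exact: le_trans xy.
Qed.

Lemma poweRVK (x : \bar R) (p : R) :
  (0 < p)%R -> 0 <= x -> (x `^ p^-1) `^ p = x.
Proof. by move=> p0 x0; rewrite -poweRrM mulVf ?gt_eqF// poweRe1. Qed.

Lemma poweRKV (x : \bar R) (p : R) :
  (0 < p)%R -> 0 <= x -> (x `^ p) `^ p^-1 = x.
Proof. by move=> p0 x0; rewrite -poweRrM mulfV ?gt_eqF// poweRe1. Qed.

Variable p : R.
Hypothesis p0 : (0 < p)%R.
Local Notation N f := ('N[m]_p%:E[f]).

Lemma Lnorm_ge0E (f : T -> \bar R) : (forall x, 0 <= f x) ->
  N f = (\int[m]_x (f x `^ p)) `^ p^-1.
Proof.
by move=> f0; rewrite unlock; congr (_ `^ _); apply: eq_integral => x _;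
  rewrite gee0_abs.
Qed.

Lemma le_Lnorm (f g : T -> \bar R) : (forall x, `|f x| <= `|g x|) ->
  N f <= N g.
Proof.
move=> fg; rewrite unlock; apply: lee_poweR; first by rewrite invr_ge0 ltW.
  by apply: integral_ge0 => x _; exact: poweR_ge0.
apply: le_integral_lower => x; first exact: poweR_ge0.
by apply: lee_poweR => //; exact: ltW.
Qed.

Lemma Lnorm_root (f : T -> \bar R) : (forall x, 0 <= f x) ->
  N (fun x => f x `^ p^-1) = (\int[m]_x f x) `^ p^-1.
Proof.
move=> f0; rewrite Lnorm_ge0E => [|x]; last exact: poweR_ge0.
by congr (_ `^ _); apply: eq_integral => x _; rewrite poweRVK.
Qed.

Lemma measurable_poweR_comp (f : T -> \bar R) (r : R) :
  measurable_fun setT f -> measurable_fun setT (fun x => f x `^ r).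
Proof.
move=> mf; apply: (@measurableT_comp _ _ _ _ _ _ (fun x => x `^ r)) => //.
exact: measurable_poweR.
Qed.

Lemma Lnorm_scale (k : R) (f : T -> \bar R) : measurable_fun setT f ->
  (forall x, 0 <= f x) -> (0 <= k)%R ->
  N (fun x => k%:E * f x) = k%:E * N f.
Proof.
move=> mf f0 k0; rewrite !Lnorm_ge0E// => [|x]; last by rewrite mule_ge0.
under eq_integral do rewrite poweRM//.
rewrite ge0_integralZl//; last 3 first.
- exact: measurable_poweR_comp.
- by move=> x _; exact: poweR_ge0.
- exact: poweR_ge0.
rewrite poweRM ?poweR_ge0//; last by apply: integral_ge0 => x _; exact: poweR_ge0.
by rewrite poweRKV.
Qed.

Lemma Lnorm_fin_ae (f : T -> \bar R) : measurable_fun setT f ->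
  (forall x, 0 <= f x) -> N f < +oo -> {ae m, forall x, f x < +oo}.
Proof.
move=> mf f0 Nf.
have : m.-integrable setT (fun x => f x `^ p).
  apply/integrableP; split; first exact: measurable_poweR_comp.
  under eq_integral do rewrite gee0_abs ?poweR_ge0//.
  move: Nf; rewrite Lnorm_ge0E//; apply: lty_poweRy.
  by rewrite gt_eqF// invr_gt0.
move=> /(integrable_ae measurableT); apply: filterS => x /(_ I) fx.
apply: (@lty_poweRy _ _ p); first by rewrite gt_eqF.
by rewrite -ge0_fin_numE ?poweR_ge0.
Qed.

Lemma eq_Lnorm_ae (f g : T -> \bar R) : measurable_fun setT f ->
  measurable_fun setT g -> {ae m, forall x, f x = g x} -> N f = N g.
Proof.
move=> mf mg fg; rewrite unlock; congr (_ `^ _).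
apply: ge0_ae_eq_integral => //.
- by apply: measurable_poweR_comp; exact: measurableT_comp.
- by apply: measurable_poweR_comp; exact: measurableT_comp.
- by move=> x _; exact: poweR_ge0.
- by move=> x _; exact: poweR_ge0.
by apply: filterS fg => x /= ->.
Qed.

Lemma le_Lnorm_ae (f g : T -> \bar R) : measurable_fun setT f ->
  measurable_fun setT g -> {ae m, forall x, `|f x| <= `|g x|} -> N f <= N g.
Proof.
move=> mf mg fg; rewrite unlock; apply: lee_poweR; first by rewrite invr_ge0 ltW.
  by apply: integral_ge0 => x _; exact: poweR_ge0.
apply: ae_ge0_le_integral => //.
- by move=> x _; exact: poweR_ge0.
- by apply: measurable_poweR_comp; exact: measurableT_comp.
- by move=> x _; exact: poweR_ge0.
- by apply: measurable_poweR_comp; exact: measurableT_comp.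
by apply: filterS fg => x fx _; apply: lee_poweR => //; exact: ltW.
Qed.

End lower_integral.

Section minkowski_series.
Context d (T : measurableType d) (R : realType).
Variable m : {measure set T -> \bar R}.
Local Open Scope ereal_scope.
Variable p : R.
Hypothesis p1 : (1 <= p)%R.
Local Notation N f := ('N[m]_p%:E[f]).

Let p0 : (0 < p)%R. Proof. exact: lt_le_trans p1. Qed.

(** If both norms are finite, the functions are finite almost everywhere and agree with their [fine]
    parts, which reduces the claim to real-valued functions. *)
Lemma ge0_minkowski (f g : T -> \bar R) : measurable_fun setT f ->
  measurable_fun setT g -> (forall x, 0 <= f x) -> (forall x, 0 <= g x) ->
  N (fun x => f x + g x) <= N f + N g.
Proof.
move=> mf mg f0 g0.
have [fy|fy] := eqVneq (N f) +oo.
  by rewrite fy addye ?leey// gt_eqF// (lt_le_trans _ (Lnorm_ge0 _ _ _)).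
have [gy|gy] := eqVneq (N g) +oo.
  by rewrite gy addey ?leey// gt_eqF// (lt_le_trans _ (Lnorm_ge0 _ _ _)).
have Ff : {ae m, forall x, f x < +oo} by apply: (Lnorm_fin_ae p0) => //; rewrite ltey.
have Fg : {ae m, forall x, g x < +oo} by apply: (Lnorm_fin_ae p0) => //; rewrite ltey.
have mF : measurable_fun setT (fine \o f) by exact: measurableT_comp.
have mG : measurable_fun setT (fine \o g) by exact: measurableT_comp.
rewrite (@eq_Lnorm_ae _ _ _ m p f (EFin \o (fine \o f)))//; last 2 first.
- exact/measurable_EFinP.
- by apply: filterS Ff => x fx /=; rewrite fineK// ge0_fin_numE.
rewrite (@eq_Lnorm_ae _ _ _ m p g (EFin \o (fine \o g)))//; last 2 first.
- exact/measurable_EFinP.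
- by apply: filterS Fg => x fx /=; rewrite fineK// ge0_fin_numE.
rewrite (@eq_Lnorm_ae _ _ _ m p (fun x => f x + g x)
  (EFin \o ((fine \o f) \+ (fine \o g))%R))//; first exact: minkowski_EFin.
- exact: emeasurable_funD.
- by apply/measurable_EFinP; exact: measurable_funD.
by apply: filterS2 Ff Fg => x fx gx /=; rewrite EFinD !fineK// ge0_fin_numE.
Qed.

Lemma Lnorm_sum (f : (T -> \bar R)^nat) n : (forall n, measurable_fun setT (f n)) ->
  (forall n x, 0 <= f n x) ->
  N (fun x => \sum_(0 <= i < n) f i x) <= \sum_(0 <= i < n) N (f i).
Proof.
move=> mf f0; elim: n => [|n ih].
  rewrite !big_nil (_ : (fun _ => _) = cst 0) ?Lnorm0//; last first.
    by apply/funext => x; rewrite big_nil.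
  by rewrite eqe gt_eqF.
rewrite [leRHS]big_nat_recr//=; under eq_Lnorm do rewrite big_nat_recr//=.
apply: le_trans (leeD ih (lexx _)).
apply: (@ge0_minkowski (fun x => \sum_(0 <= i < n) f i x) (f n)) => //.
  by apply: emeasurable_sum => i.
by move=> x; apply: sume_ge0.
Qed.

(** Monotone convergence for the p-th powers of the partial sums, whose integrals are bounded by the
    finite case. *)
Lemma Lnorm_nneseries (f : (T -> \bar R)^nat) : (forall n, measurable_fun setT (f n)) ->
  (forall n x, 0 <= f n x) ->
  N (fun x => \sum_(0 <= i <oo) f i x) <= \sum_(0 <= i <oo) N (f i).
Proof.
move=> mf f0; set B := leRHS; set S := fun n x => \sum_(0 <= i < n) f i x.
have B0 : 0 <= B by apply: nneseries_ge0 => n _ _; exact: Lnorm_ge0.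
have S0 n x : 0 <= S n x by exact: sume_ge0.
have mS n : measurable_fun setT (S n) by apply: emeasurable_sum => i.
have ndS x : {homo S ^~ x : n k / (n <= k)%N >-> n <= k}.
  by move=> n k nk; apply: lee_sum_nneg_natr => // i _ _; exact: f0.
have ndSp x : {homo (fun n => S n x `^ p) : n k / (n <= k)%N >-> n <= k}.
  by move=> n k nk; apply: lee_poweR; [exact: ltW|exact: S0|exact: ndS].
have SB n : \int[m]_x (S n x `^ p) <= B `^ p.
  rewrite -[leLHS](@poweRVK _ _ p)//; last by apply: integral_ge0 => x _; exact: poweR_ge0.
  rewrite -Lnorm_ge0E//; apply: lee_poweR; [exact: ltW|exact: Lnorm_ge0|].
  by apply: le_trans (Lnorm_sum _ mf f0) _; apply: nneseries_lim_ge => i _ _; exact: Lnorm_ge0.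
rewrite Lnorm_ge0E => [|x]; last by apply: nneseries_ge0 => n _ _; exact: f0.
rewrite -[leRHS](@poweRKV _ _ p)//; apply: lee_poweR.
- by rewrite invr_ge0 ltW.
- by apply: integral_ge0 => x _; exact: poweR_ge0.
(* One inequality between the p-th power of the sum and the limit [M] of the p-th powers suffices:
   every partial sum is at most the p-th root of [M]. *)
apply: (@le_trans _ _ (\int[m]_x limn (fun n => S n x `^ p))).
  apply: le_integral_lower => x; first exact: poweR_ge0.
  set M := (X in _ <= X).
  have SM n : S n x `^ p <= M.
    rewrite /M (cvg_lim _ (ereal_nondecreasing_cvgn (ndSp x)))//.
    by apply: ereal_sup_ubound; exists n.
  have M0 : 0 <= M by exact: le_trans (poweR_ge0 _ _) (SM 0%N).
  rewrite -[leRHS](@poweRVK _ _ p)//; apply: lee_poweR; first exact: ltW.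
    exact: nneseries_ge0.
  apply: lime_le; first by apply: is_cvg_nneseries => i _ _; exact: f0.
  apply: nearW => n; rewrite -[leLHS](@poweRKV _ _ p)//; last exact: S0.
  apply: lee_poweR; [by rewrite invr_ge0 ltW|exact: poweR_ge0|exact: SM].
rewrite monotone_convergence//; last 2 first.
- by move=> n; exact: measurable_poweR_comp.
- by move=> n x _; exact: poweR_ge0.
apply: lime_le; last by apply: nearW => n; exact: SB.
apply: ereal_nondecreasing_is_cvgn => n k nk; apply: le_integral_lower => x.
  exact: poweR_ge0.
exact: ndSp.
Qed.

End minkowski_series.

Section indicator_series.
Local Open Scope ereal_scope.

Lemma indic_series_measurable d (T : measurableType d) (R : realType)
    (m : {measure set T -> \bar R})
    (c : (\bar R)^nat) (B : (set T)^nat) :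
  (forall i, 0 <= c i) -> (forall i, measurable (B i)) ->
  measurable_fun setT (fun y => \sum_(0 <= i <oo) c i * (\1_(B i) y)%:E)
  /\ \int[m]_y (\sum_(0 <= i <oo) c i * (\1_(B i) y)%:E) =
     \sum_(0 <= i <oo) c i * m (B i).
Proof.
move=> c0 mB; have mt i : measurable_fun setT (fun y => c i * (\1_(B i) y)%:E).
  apply: emeasurable_funM => //; apply/measurable_EFinP.
  exact: measurable_indic.
have t0 i y : 0 <= c i * (\1_(B i) y)%:E.
  by rewrite mule_ge0// lee_fin.
split; first by apply: (@ge0_emeasurable_sum _ _ _ _ _ xpredT).
rewrite integral_nneseries//; apply: eq_eseriesr => i _.
rewrite ge0_integralZl//; last exact/measurable_EFinP/measurable_indic.
by rewrite integral_indic// setIT.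
Qed.

Lemma le_indic_series (T : Type) (R : realType) (c : (\bar R)^nat) (B : (set T)^nat) i (y : T) :
  (forall i, 0 <= c i) -> B i y -> c i <= \sum_(0 <= i <oo) c i * (\1_(B i) y)%:E.
Proof.
move=> c0 By; have t0 j : 0 <= c j * (\1_(B j) y)%:E by rewrite mule_ge0// lee_fin.
apply: (@le_trans _ _ (\sum_(0 <= j < i.+1) c j * (\1_(B j) y)%:E)).
  rewrite big_nat_recr//= indicE mem_set// mule1 leeDr//.
  exact: sume_ge0.
by apply: nneseries_lim_ge => j _ _.
Qed.

(** At most one term is nonzero at [y], so the series is 0 or one of the [c i]. *)
Lemma indic_series_le (T : Type) (R : realType) (c : (\bar R)^nat) (B : (set T)^nat) (y : T) (M : \bar R) :
  (forall i, 0 <= c i) -> 0 <= M ->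
  (forall i j, B i y -> B j y -> i = j) -> (forall i, B i y -> c i <= M) ->
  \sum_(0 <= i <oo) c i * (\1_(B i) y)%:E <= M.
Proof.
move=> c0 M0 Buniq cM.
have [[i Biy]|nB] := pselect (exists i, B i y); last first.
  rewrite eseries0// => i _ _; rewrite indicE memNset ?mule0// => Biy.
  by apply: nB; exists i.
rewrite (@nneseriesD1 _ _ i)// => [|k _]; last by rewrite mule_ge0// lee_fin.
rewrite indicE mem_set// mule1 eseries0 ?adde0 ?cM// => j _ ji.
rewrite indicE memNset ?mule0// => Bjy.
by move: ji; rewrite (Buniq _ _ Biy Bjy) eqxx.
Qed.

End indicator_series.

(** * Metric spaces *)

Lemma ex_natSinv_lt (R : realType) (e : R) : 0 < e ->
  exists n, n.+1%:R^-1 < e.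
Proof.
move=> e0; have [n _ /(_ n (leqnn n)) ne] := near_infty_natSinv_lt (PosNum e0).
by exists n.
Qed.

Section ereal_cvg0.
Context (R : realType) (T : Type) (F : set_system T) (FF : Filter F).
Variable f : T -> \bar R.
Local Open Scope ereal_scope.

Lemma cvge0_near_lt (e : R) : f x @[x --> F] --> 0 -> (0 < e)%R ->
  \forall x \near F, f x < e%:E.
Proof.
move=> f0 e0; apply: (f0 (fun u => u < e%:E)).
by apply: (@open_ereal_lt' _ 0); rewrite lte_fin.
Qed.

Lemma near_le_cvge0 : (forall x, 0 <= f x) ->
  (forall e : R, (0 < e)%R -> \forall x \near F, f x <= e%:E) ->
  f x @[x --> F] --> 0.
Proof.
move=> f0 fe A [e /= e0 eA]; have e20 : (0 < e / 2)%R by rewrite divr_gt0.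
apply: filterS (fe _ e20) => x fx.
have ffin : f x \is a fin_num by rewrite ge0_fin_numE// (le_lt_trans fx)// ltry.
move: (f0 x) fx; rewrite /= -(fineK ffin) !lee_fin => fx0 fx.
by apply: eA; rewrite /ball_/= sub0r normrN ger0_norm//; apply: le_lt_trans fx _; lra.
Qed.

End ereal_cvg0.

Section metric_tools.
Context (R : realType) (X : completeMetricType R).
Implicit Types (x y z : X) (A : set X).

Lemma ballP x (r : R) y : ball x r y <-> mdist x y < r.
Proof. by rewrite ballEmdist. Qed.

Lemma mdist_ltD x y z (a b c : R) : mdist x y < a -> mdist y z <= b ->
  a + b <= c -> mdist x z < c.
Proof.
move=> xy yz; apply: lt_le_trans; apply: le_lt_trans (metric_triangle x y z) _.
exact: ltr_leD.
Qed.

Lemma ball_subset x y (r s : R) : mdist x y + r <= s -> ball y r `<=` ball x s.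
Proof.
move=> xyrs z /ballP yz; apply/ballP; apply: lt_le_trans xyrs.
by apply: le_lt_trans (metric_triangle x y z) _; rewrite ltrD2l.
Qed.

Lemma mball_open x (r : R) : open (ball x r).
Proof.
rewrite openE => y /ballP xy; rewrite /interior; apply/nbhs_ballP.
exists (r - mdist x y); first by rewrite /= subr_gt0.
by apply: ball_subset; rewrite addrC subrK.
Qed.

(** A maximal separated set, given by Zorn's lemma, covers by maximality. Sending its points to
    points of the countable dense set at distance less than [r / 2] is injective; the code of that
    dense point is the index in [nat]. *)
Lemma separated_net A (r : R) : separable X -> 0 < r ->
  exists (D : set nat) (x : nat -> X),
    [/\ forall i, D i -> A (x i),
        forall i j, D i -> D j -> i != j -> r <= mdist (x i) (x j) &
        forall a, A a -> exists2 i, D i & mdist (x i) a < r].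
Proof.
move=> [Q /countable_injP[g ginj] dQ] r0.
pose P (S : set X) := S `<=` A /\
  forall a b, S a -> S b -> a != b -> r <= mdist a b.
have [F FP Ftot|S [[SA Ssep] Smax]] := @Zorn_bigcup _ P.
  split=> [a [S /FP[SA _]]|a b [S FS Sa] [S' FS' S'b]]; first exact: SA.
  have [SS'|S'S] := Ftot _ _ FS FS'.
    by have [_ +] := FP _ FS'; apply => //; exact: SS'.
  by have [_ +] := FP _ FS; apply => //; exact: S'S.
have /choice[q qP] : forall s, exists q, Q q /\ mdist s q < r / 2.
  move=> s; have [||q [/ballP sq Qq]] := dQ (ball s (r / 2)).
  - by exists s; apply/ballP; rewrite mdistxx divr_gt0.
  - exact: mball_open.
  - by exists q.
have finj a b : S a -> S b -> g (q a) = g (q b) -> a = b.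
  move=> Sa Sb /(ginj (q a) (q b)); rewrite !inE.
  move=> /(_ (qP a).1 (qP b).1) qab; apply: contrapT => /eqP ab.
  have := Ssep _ _ Sa Sb ab; apply/negP; rewrite -ltNge.
  apply: (@mdist_ltD _ (q a) _ (r / 2) (r / 2)); first exact: (qP a).2.
    by rewrite qab metric_sym ltW//; exact: (qP b).2.
  by rewrite -splitr.
pose f a := g (q a).
pose x n := xget point [set s | S s /\ f s = n].
have xP n : (f @` S) n -> S (x n) /\ f (x n) = n.
  move=> [s Ss fs]; rewrite /x; case: xgetP => [y _ []//|/(_ s)]; by case.
exists (f @` S), x; split => [i Di|i j Di Dj ij|a Aa].
- by apply: SA; have [] := xP _ Di.
- have [Si fi] := xP _ Di; have [Sj fj] := xP _ Dj.
  by apply: Ssep => //; apply: contra ij => /eqP xij; rewrite -fi -fj xij.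
apply: contrapT => nai.
have far s : S s -> r <= mdist s a.
  move=> Ss; rewrite leNgt; apply/negP => sa; apply: nai.
  exists (f s); first by exists s.
  suff -> : x (f s) = s by [].
  have [|Sx fx] := xP (f s); first by exists s.
  exact: finj.
have nSa : ~ S a by move=> /far; rewrite mdistxx leNgt r0.
apply: (Smax (S `|` [set a])).
  split; first by left.
  by move=> /(_ a) Sa; apply: nSa; apply: Sa; right.
split=> [b [/SA//|->//]|b c [Sb|->] [Sc|->] bc].
- exact: Ssep.
- exact: far.
- by rewrite metric_sym; exact: far.
- by rewrite eqxx in bc.
Qed.

(* The supremum over the empty set is 0, so [tent r set0] vanishes. *)
Definition tent (r : R) A x : R :=
  sup [set Num.max 0 (1 - mdist x a / r) | a in A].

Section tent.
Variables (r : R) (A : set X).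
Hypothesis r0 : 0 < r.

Let T x := [set Num.max 0 (1 - mdist x a / r) | a in A].

Let term_le1 x a : Num.max 0 (1 - mdist x a / r) <= 1.
Proof.
by rewrite ge_max ler01/= gerBl divr_ge0 ?mdist_ge0// ltW.
Qed.

Let hsT x a : A a -> has_sup (T x).
Proof.
by move=> Aa; split; [exists (Num.max 0 (1 - mdist x a / r)), a|
  exists 1 => _ [b _ <-]].
Qed.

Lemma tent_ge x a : A a -> Num.max 0 (1 - mdist x a / r) <= tent r A x.
Proof. by move=> Aa; apply: ub_le_sup; [exact: (hsT x Aa).2|exists a]. Qed.

Lemma tent_set0 x : A = set0 -> tent r A x = 0.
Proof. by move=> A0; rewrite /tent A0 image_set0 sup0. Qed.

Lemma tent_ge0 x : 0 <= tent r A x.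
Proof.
have [A0|/set0P[a Aa]] := eqVneq A set0; first by rewrite tent_set0.
by apply: le_trans (tent_ge x Aa); rewrite le_max lexx.
Qed.

Lemma tent_le1 x : tent r A x <= 1.
Proof.
have [A0|/set0P[a Aa]] := eqVneq A set0; first by rewrite tent_set0.
by apply: ge_sup; [exact: (hsT x Aa).1|move=> _ [b _ <-]].
Qed.

Lemma tent_in x : A x -> tent r A x = 1.
Proof.
move=> Ax; apply/eqP; rewrite eq_le tent_le1/=.
by apply: le_trans (tent_ge x Ax); rewrite mdistxx mul0r subr0 le_max lexx orbT.
Qed.

Lemma tent_far x : (forall a, A a -> r <= mdist x a) -> tent r A x = 0.
Proof.
move=> far; apply/eqP; rewrite eq_le tent_ge0 andbT.
have [A0|/set0P[a Aa]] := eqVneq A set0; first by rewrite tent_set0.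
apply: ge_sup; first exact: (hsT x Aa).1.
by move=> _ [b Ab <-]; rewrite ge_max lexx/= subr_le0 ler_pdivlMr ?mul1r ?far.
Qed.

Lemma tent_lip x y : `|tent r A x - tent r A y| <= mdist x y / r.
Proof.
have [A0|/set0P[a0 Aa0]] := eqVneq A set0.
  by rewrite !tent_set0// subr0 normr0 divr_ge0 ?mdist_ge0// ltW.
have le u v : tent r A u <= tent r A v + mdist u v / r.
  apply: ge_sup; first exact: (hsT u Aa0).1.
  move=> _ [a Aa <-]; rewrite ge_max; apply/andP; split.
    by rewrite addr_ge0 ?tent_ge0// divr_ge0 ?mdist_ge0// ltW.
  apply: (@le_trans _ _ ((1 - mdist v a / r) + mdist u v / r)).
    have : mdist v a / r <= mdist u v / r + mdist u a / r.
      by rewrite -mulrDl ler_pM2r ?invr_gt0// (metric_sym u v) metric_triangle.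
    by move=> h; lra.
  rewrite lerD2r; apply: le_trans (tent_ge v Aa); by rewrite le_max lexx orbT.
rewrite ler_norml; apply/andP; split.
  by rewrite lerNl opprB lerBlDr addrC metric_sym; exact: le.
by rewrite lerBlDr addrC; exact: le.
Qed.

End tent.
End metric_tools.

(** * Borel sets and codimension Hausdorff measures *)

Section caratheodory_criterion.
Context (R : realType) (X : completeMetricType R).
Variable nu : {outer_measure set X -> \bar R}.
Local Open Scope ereal_scope.

Definition metric_outer : Prop := forall (A B : set X) (e : R), (0 < e)%R ->
  (forall a b, A a -> B b -> (e <= mdist a b)%R) -> nu A + nu B <= nu (A `|` B).

Hypothesis nu_metric : metric_outer.

(** Caratheodory's criterion: points outside [Un n.+1] lie at positive distance from [Un n], so the
    measures of the successive layers of [Y] are summable. The part of [Y] in [U] outside [Un N]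
    then has small measure for large [N], and [Un N] is separated from the complement of [U]. *)
Let open_caratheodory (U : set X) : open U -> nu.-caratheodory U.
Proof.
move=> oU; apply: le_caratheodory_measurable => Y.
have [->|Yfin] := eqVneq (nu Y) +oo; first exact: leey.
pose Un n := [set x | ball x n.+1%:R^-1%R `<=` U].
have UnU n : Un n `<=` U.
  by move=> x; apply; apply/ballP; rewrite mdistxx invr_gt0 ltr0n.
have ndUn n : Un n `<=` Un n.+1.
  move=> x Ux; apply: subset_trans Ux; apply: ball_subset.
  by rewrite mdistxx add0r lef_pV2 ?posrE ?ltr0n// ler_nat.
pose D n := Y `&` (Un n.+1 `\` Un n).
have cover N : Y `&` U `<=` (Y `&` Un N) `|` \bigcup_(n in ~` `I_N) D n.
  move=> x [Yx Ux]; have [UNx|nUNx] := pselect (Un N x); first by left.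
  right; have [M UMx] : exists M, Un M x.
    move: oU; rewrite openE => /(_ _ Ux); rewrite /interior => /nbhs_ballP[e /= e0 eU].
    have [M Me] := ex_natSinv_lt e0.
    exists M; apply: subset_trans eU; apply: ball_subset.
    by rewrite mdistxx add0r ltW.
  have mono n k : (n <= k)%N -> Un n `<=` Un k.
    by elim: k => [|k ih]; [rewrite leqn0 => /eqP ->|rewrite leq_eqVlt => /predU1P[->//|/ih h];
      exact: subset_trans (ndUn k)].
  have NM : (N < M)%N by rewrite ltnNge; apply/negP => /mono /(_ _ UMx).
  have exM : exists m, (N < m)%N && `[< Un m x >].
    by exists M; rewrite NM; apply/asboolP.
  case: (ex_minnP exM) => -[//|m] /andP[Nm /asboolP Umx] mmin.
  exists m; first by apply/negP; rewrite -leqNgt.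
  split=> //; split=> // Umx'; have [Nm'|] := ltnP N m.
    by have := mmin m; rewrite Nm' ltnn (asboolT Umx') => /(_ isT).
  by move=> /mono /(_ _ Umx').
have sep n : nu (Y `&` Un n) + nu (D n.+1) <= nu (Y `&` Un n.+2).
  have e0 : (0 < n.+1%:R^-1 - n.+2%:R^-1 :> R)%R.
    by rewrite subr_gt0 ltf_pV2 ?posrE ?ltr0n// ltr_nat.
  apply: le_trans (nu_metric e0 _) _ => [a b [_ Ua] [_ [_ nUb]]|].
    rewrite leNgt; apply/negP => ab; apply: nUb; apply: subset_trans Ua.
    by apply: ball_subset; rewrite -lerBrDr; exact: ltW.
  apply: le_outer_measure => x [[Yx /ndUn/ndUn]|[Yx []]] //.
pose a n := nu (Y `&` Un n).
have aY n : a n <= nu Y by apply: le_outer_measure; exact: subIsetl.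
(* Keeping two consecutive terms on the right lets [sep] advance one layer at a time, replacing the
   usual separate sums over even and odd layers. *)
have sumD n : \sum_(0 <= k < n) nu (D k.+1) <= a n + a n.+1.
  elim: n => [|n ih]; first by rewrite big_nil adde_ge0.
  rewrite big_nat_recr//=; apply: le_trans (leeD ih (lexx _)) _.
  by rewrite addeAC addeC leeD2l//; exact: sep.
have sumDoo : \sum_(0 <= k <oo) nu (D k.+1) < +oo.
  apply: (@le_lt_trans _ _ (nu Y + nu Y)); last first.
    by rewrite lte_add_pinfty// ltey.
  apply: lime_le; first by apply: is_cvg_nneseries.
  by apply: nearW => n; apply: le_trans (sumD n) _; exact: leeD.
have tail : \sum_(N <= k <oo) nu (D k.+1) @[N --> \oo] --> 0.
  exact: nneseries_tail_cvg.
apply/lee_addgt0Pr => e e0.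
have [N _ /(_ N (leqnn N))/= NE] := cvge0_near_lt tail e0.
have le1 : nu (Y `&` U) <= nu (Y `&` Un N.+1) + e%:E.
  apply: le_trans (le_outer_measure nu _ _ (cover N.+1)) _.
  apply: le_trans (outer_measureU2 _ _ _) _; rewrite leeD2l//.
  apply: le_trans (outer_measure_sigma_subadditive_tail nu N.+1 D) _.
  apply: le_trans (ltW NE).
  rewrite -(@nneseries_addn _ (fun k => nu (D k)) N.+1)//.
  rewrite -(@nneseries_addn _ (fun k => nu (D k.+1)) N)//.
  by under eq_eseriesr do rewrite addnS.
apply: le_trans (leeD le1 (lexx _)) _.
have N0 : (0 < N.+2%:R^-1 :> R)%R by rewrite invr_gt0 ltr0n.
rewrite addeAC; apply: leeD => //; apply: le_trans (nu_metric N0 _) _.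
- move=> u v [_ Uu] [_ nUv]; rewrite leNgt; apply/negP => uv.
  by apply: nUv; apply: Uu; apply/ballP.
- by apply: le_outer_measure => x [[]|[]].
Qed.

Lemma borel_caratheodory : <<s @open X >> `<=` nu.-caratheodory.
Proof.
apply: (@smallest_sub _ (sigma_algebra setT)); last exact: open_caratheodory.
split.
- exact: caratheodory_measurable_set0.
- by move=> A mA; rewrite setTD; exact: caratheodory_measurable_setC.
- exact: caratheodory_measurable_bigcup.
Qed.

End caratheodory_criterion.

Section codim_hausdorff_borel.
Context (R : realType) (X : completeMetricType R).
Variable mu : {outer_measure set X -> \bar R}.
Variable theta : R.
Local Open Scope ereal_scope.
Local Notation H := (codim_hausdorff mu theta).

Let term_ge0 (x : X) (r : R) : 0 <= mu (ball x r) * (r `^ (- theta))%:E.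
Proof. by rewrite mule_ge0 ?outer_measure_ge0// lee_fin powR_ge0. Qed.

Lemma codim_content_le (d1 d2 : R) (A : set X) : (d1 <= d2)%R ->
  codim_content mu theta d2 A <= codim_content mu theta d1 A.
Proof.
move=> d12; apply: ereal_inf_le_tmp => _ [[[D x] r] [Dr FI] <-].
by exists (D, x, r) => //; split=> // i /Dr /andP[-> /= rd]; exact: lt_le_trans d12.
Qed.

Lemma codim_content_le_hausdorff (d : R) (A : set X) : (0 < d)%R ->
  codim_content mu theta d A <= H A.
Proof.
move=> d0; rewrite codim_hausdorffE; apply: ereal_sup_ubound; exists d => //.
by rewrite /= in_itv/= d0.
Qed.

(** A ball of radius less than [e / 2] cannot meet both sets, so a covering of the union splits into
    the balls that meet [A] and the others, which cover [B]. *)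
Let content_sep (A B : set X) (e : R) : (0 < e)%R ->
  (forall a b, A a -> B b -> (e <= mdist a b)%R) ->
  codim_content mu theta (e / 2) A + codim_content mu theta (e / 2) B <=
  codim_content mu theta (e / 2) (A `|` B).
Proof.
move=> e0 AB; apply: le_ereal_inf_tmp => _ [[[D x] r] [Dr cov] <-] /=.
pose DA := [set i | ball (x i) (r i) `&` A !=set0].
rewrite (esumID DA)//; apply: leeD; apply: ereal_inf_lbound.
  exists (D `&` DA, x, r) => //; split=> [i [Di _]|a Aa]; first exact: Dr.
  have [|i Di ia] := cov a; first by left.
  by exists i => //; split=> //; exists a.
exists (D `&` ~` DA, x, r) => //; split=> [i [Di _]|b Bb]; first exact: Dr.
have [|i Di ib] := cov b; first by right.
exists i => //; split=> // -[a [ia Aa]].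
have := AB _ _ Aa Bb; rewrite leNgt => /negP; apply.
have /andP[_ rie] := Dr _ Di.
move: ia ib => /ballP; rewrite metric_sym => ai /ballP ib.
apply: (mdist_ltD ai (ltW ib)); lra.
Qed.

Lemma codim_hausdorff_sep (A B : set X) (e : R) : (0 < e)%R ->
  (forall a b, A a -> B b -> (e <= mdist a b)%R) ->
  H A + H B <= H (A `|` B).
Proof.
move=> e0 AB; have [->|Hfin] := eqVneq (H (A `|` B)) +oo; first exact: leey.
have sub (C : set X) : C `<=` A `|` B -> H C \is a fin_num.
  move=> CAB; rewrite ge0_fin_numE ?codim_hausdorff_ge0// ltey.
  apply: contra Hfin => /eqP CE; rewrite -leye_eq -CE; exact: le_codim_hausdorff.
have HAf := sub _ (@subsetUl _ A B); have HBf := sub _ (@subsetUr _ A B).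
(* Independent scales for [A] and [B] allow the two suprema to be taken in turn; [d / 2] is below
   both scales, and [d] below the separation. *)
have key d1 d2 : (0 < d1)%R -> (0 < d2)%R ->
    codim_content mu theta d1 A + codim_content mu theta d2 B <= H (A `|` B).
  move=> d10 d20; set d := Num.min e (Num.min (2 * d1) (2 * d2))%R.
  have d0 : (0 < d)%R by rewrite !lt_min e0 !mulr_gt0.
  have dAB a b : A a -> B b -> (d <= mdist a b)%R.
    by move=> Aa Bb; apply: le_trans (AB _ _ Aa Bb); rewrite ge_min lexx.
  have dd1 : (d / 2 <= d1)%R.
    by rewrite ler_pdivrMr// [(d1 * _)%R]mulrC !ge_min lexx !orbT.
  have dd2 : (d / 2 <= d2)%R.
    by rewrite ler_pdivrMr// [(d2 * _)%R]mulrC !ge_min lexx !orbT.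
  apply: le_trans (leeD (codim_content_le _ dd1) (codim_content_le _ dd2)) _.
  apply: le_trans (content_sep d0 dAB) _.
  by apply: codim_content_le_hausdorff; rewrite divr_gt0.
rewrite -leeBrDr//; rewrite [leLHS]codim_hausdorffE; apply: ge_ereal_sup => _ [d1 /= + <-].
rewrite in_itv/= andbT => d10.
have cfin : codim_content mu theta d1 A \is a fin_num.
  rewrite ge0_fin_numE ?codim_content_ge0//.
  by apply: le_lt_trans (codim_content_le_hausdorff _ d10) _; rewrite -ge0_fin_numE ?codim_hausdorff_ge0.
rewrite leeBrDr// addeC -leeBrDr//.
rewrite [leLHS]codim_hausdorffE; apply: ge_ereal_sup => _ [d2 /= + <-].
rewrite in_itv/= andbT => d20.
by rewrite leeBrDr// addeC; exact: key.
Qed.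

(** The intersection of nearly optimal ball coverings at the scales 1/(n+1) is a G-delta hull: each
    of these coverings still covers it, so its content at every scale is at most the measure of
    [A]. *)
Lemma codim_hausdorff_outer_regular (A : set X) :
  exists B, [/\ <<s @open X >> B, A `<=` B & H B = H A].
Proof.
have [Ay|Afin] := eqVneq (H A) +oo.
  exists setT; split=> //; first by apply: sub_sigma_algebra; exact: openT.
  by rewrite Ay; apply/eqP; rewrite -leye_eq -Ay; exact: le_codim_hausdorff.
have Af : H A \is a fin_num by rewrite ge0_fin_numE ?codim_hausdorff_ge0// ltey.
have /choice[c cP] : forall n, exists c : set nat * (nat -> X) * (nat -> R),
    codim_cover n.+1%:R^-1 A c /\ codim_weight mu theta c <= H A + n.+1%:R^-1%:E.
  move=> n; have n0 : (0 < n.+1%:R^-1 :> R)%R by rewrite invr_gt0 ltr0n.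
  have cH := codim_content_le_hausdorff A n0.
  have cf : codim_content mu theta n.+1%:R^-1 A \is a fin_num.
    rewrite ge0_fin_numE ?codim_content_ge0//.
    by apply: le_lt_trans cH _; rewrite -ge0_fin_numE ?codim_hausdorff_ge0.
  have [_ [c cA <-] cw] := lb_ereal_inf_adherent n0 cf.
  by exists c; split=> //; apply: le_trans (ltW cw) _; rewrite leeD2r.
pose O n := \bigcup_(i in (c n).1.1) ball ((c n).1.2 i) ((c n).2 i).
exists (\bigcap_n O n); split.
- rewrite -[X in <<s _ >> X]setCK setC_bigcap -setTD.
  have [_ sC sU] := smallest_sigma_algebra setT (@open X).
  apply: (sC _); apply: sU => n; rewrite -setTD; apply: sC.
  apply: sub_sigma_algebra; apply: bigcup_open => i _; exact: mball_open.
- move=> a Aa n _; have [+ _] := cP n; rewrite /O.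
  by case: (c n) => -[D x] r /= [_]; exact.
apply/eqP; rewrite eq_le; apply/andP; split; last first.
  apply: le_codim_hausdorff => a Aa n _; have [+ _] := cP n; rewrite /O.
  by case: (c n) => -[D x] r /= [_]; exact.
rewrite [leLHS]codim_hausdorffE; apply: ge_ereal_sup => _ [d /= + <-].
rewrite in_itv/= andbT => d0; apply/lee_addgt0Pr => e e0.
have [|n] := @ex_natSinv_lt _ (Num.min d e); first by rewrite lt_min d0.
rewrite lt_min => /andP[nd ne].
have [cov w] := cP n.
apply: le_trans (codim_content_le _ (ltW nd)) _.
apply: (@le_trans _ _ (codim_weight mu theta (c n))); last first.
  by apply: le_trans w _; rewrite leeD2l// lee_fin ltW.
apply: ereal_inf_lbound; exists (c n) => //; move: cov.
have : \bigcap_n O n `<=` O n by move=> x; apply.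
by rewrite /O; case: (c n) => -[D x] r /= sub [Dr _]; split.
Qed.

End codim_hausdorff_borel.

Section codim_hausdorff_on.
Context (R : realType) (X : completeMetricType R).
Variable mu : {outer_measure set X -> \bar R}.
Variables (theta : R) (E : set X).
Local Open Scope ereal_scope.
Local Notation nu := (codim_hausdorff_on mu theta E).

Lemma codim_hausdorff_on_borel : <<s @open X >> `<=` nu.-caratheodory.
Proof.
apply: borel_caratheodory => A B e e0 AB; rewrite /= /codim_hausdorff_on setIUl.
by apply: (codim_hausdorff_sep mu theta e0) => a b [Aa _] [Bb _]; exact: AB.
Qed.

(** The hull is taken for the part of [A] in [E], hence contains [A] only up to points off [E],
    which are null. *)
Lemma codim_hausdorff_on_outer_regular (A : set X) :
  exists B, [/\ <<s @open X >> B, A `<=` B `|` ~` E & nu B = nu A].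
Proof.
have [B [bB AB BA]] := codim_hausdorff_outer_regular mu theta (A `&` E).
exists B; split=> //.
  move=> x Ax; have [Ex|] := pselect (E x); [by left; apply: AB|by right].
apply/eqP; rewrite eq_le; apply/andP; split.
  by rewrite /codim_hausdorff_on -BA; apply: le_codim_hausdorff; exact: subIsetl.
by apply: le_codim_hausdorff => x [Ax Ex]; split=> //; exact: AB.
Qed.

Lemma codim_hausdorff_onC (A : set X) : A `<=` ~` E -> nu A = 0.
Proof.
move=> AE; rewrite /codim_hausdorff_on (_ : A `&` E = set0) ?codim_hausdorff0//.
by rewrite -subset0 => x [/AE].
Qed.

End codim_hausdorff_on.

(** * Transfer of integrals along nets *)

Section borel_outer.
Context (R : realType) (X : completeMetricType R).
Variable mu : {outer_measure set X -> \bar R}.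
Hypothesis bmu : <<s @open X >> `<=` mu.-caratheodory.
Local Open Scope ereal_scope.
Local Notation T := (caratheodory_type mu).
Local Notation m := (cara mu).

Lemma open_measurable_cara (A : set X) : open A -> measurable (A : set T).
Proof. by move=> oA; apply: bmu; exact: sub_sigma_algebra. Qed.

Lemma ball_measurable_cara (x : X) (r : R) : measurable (ball x r : set T).
Proof. by apply: open_measurable_cara; exact: mball_open. Qed.

Lemma lsc_measurable_cara (f : X -> \bar R) :
  (forall a : R, open [set x | a%:E < f x]) ->
  measurable_fun setT (f : T -> \bar R).
Proof.
move=> of_; apply: (measurability _ (ErealGenOInfty.measurableE R)).
move=> _ [_ [a ->] <-]; rewrite setTI; apply: open_measurable_cara.
rewrite [X in open X](_ : _ = [set x | a%:E < f x])//.
by apply/seteqP; split=> x /=; rewrite in_itv/= andbT.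
Qed.

Lemma lip_measurable_cara (f : X -> R) : lipschitz_fun f ->
  measurable_fun setT (f : T -> R).
Proof.
move=> [L fL]; apply/measurable_EFinP; apply: lsc_measurable_cara => a.
rewrite openE => x /= afx; rewrite /interior; apply/nbhs_ballP.
rewrite lte_fin in afx; pose e := ((f x - a) / (`|L| + 1))%R.
have L0 : (0 < `|L| + 1)%R by rewrite ltr_pwDr.
exists e => [|y /ballP xy]; first by rewrite /= divr_gt0// subr_gt0.
rewrite /= lte_fin.
have fxy : (f x - f y <= (`|L| + 1) * mdist x y)%R.
  apply: le_trans (ler_norm _) _; apply: le_trans (fL x y) _.
  rewrite ler_wpM2r ?mdist_ge0//; apply: le_trans (ler_norm _) _; by rewrite lerDl.
have : ((`|L| + 1) * mdist x y < f x - a)%R by rewrite mulrC -ltr_pdivlMr.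
by move=> h; lra.
Qed.

Lemma lee_integral_sub (A B : set X) (f g : X -> \bar R) : A `<=` B ->
  (forall x, B x -> 0 <= g x) -> (forall x, A x -> 0 <= f x <= g x) ->
  \int[m]_(x in A) f x <= \int[m]_(x in B) g x.
Proof.
move=> AB g0 fg; rewrite integral_mkcond [leRHS]integral_mkcond.
apply: le_integral_lower => x; rewrite !patchE.
  by case: ifPn => // /set_mem /fg /andP[].
have [Ax|nAx] := pselect (A x).
  by rewrite (mem_set Ax) (mem_set (AB _ Ax)); have /andP[] := fg _ Ax.
by rewrite (memNset nAx); case: ifPn => // /set_mem /g0.
Qed.

End borel_outer.

Section net_transfer.
Context (R : realType) (X : completeMetricType R).
Hypothesis sepX : separable X.
Variables m1 m2 : {outer_measure set X -> \bar R}.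
Hypotheses (b1 : <<s @open X >> `<=` m1.-caratheodory)
           (b2 : <<s @open X >> `<=` m2.-caratheodory).
Local Open Scope ereal_scope.

(** [H] sums, over the net, the supremum of [h] on the ball of radius [2 * rho] times the indicator
    of that ball. The balls of radius [rho / 2] are disjoint, so the same coefficients on them give
    a function below [g]. [H] is fixed before [g], so one majorant can be tested against a whole
    family; [h] and [g] are arbitrary functions, in view of [mean_osc]. *)
Lemma net_transfer (A : set X) (rho K : R) (h : X -> \bar R) :
  (0 < rho)%R -> (0 <= K)%R ->
  (forall a, A a -> m1 (ball a (2 * rho)) <= K%:E * m2 (ball a (rho / 2))) ->
  (forall x, 0 <= h x) ->
  exists H : X -> \bar R,
    [/\ measurable_fun setT (H : caratheodory_type m1 -> \bar R),
        forall x, 0 <= H x,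
        forall a x, A a -> (mdist a x < rho)%R -> h x <= H x &
        forall g : X -> \bar R, (forall y, 0 <= g y) ->
          (forall a x y, A a -> (mdist a x < 2 * rho)%R ->
             (mdist x y < 3 * rho)%R -> h x <= g y) ->
          \int[cara m1]_x H x <= K%:E * \int[cara m2]_y g y].
Proof.
move=> rho0 K0 m12 h0.
have [D [x [DA Dsep Dcov]]] := separated_net A sepX rho0.
pose c i := ereal_sup (h @` ball (x i) (2 * rho)).
pose B i := [set y | D i /\ ball (x i) (2 * rho) y].
pose b i := [set y | D i /\ ball (x i) (rho / 2) y].
have c0 i : 0 <= c i.
  apply: le_trans (h0 (x i)) _; apply: ereal_sup_ubound; exists (x i) => //.
  by apply/ballP; rewrite mdistxx mulr_gt0.
have mball (mu : {outer_measure set X -> \bar R}) (i : nat) (r : R) :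
    <<s @open X >> `<=` mu.-caratheodory ->
    measurable ([set y | D i /\ ball (x i) r y] : set (caratheodory_type mu)).
  move=> bmu; have [Di|nDi] := pselect (D i).
    rewrite (_ : [set _ | _] = ball (x i) r); first exact: ball_measurable_cara.
    by apply/seteqP; split=> [y []|y].
  rewrite (_ : [set _ | _] = set0)//; apply/seteqP; split=> [y []|y] //.
have mB i : measurable (B i : set (caratheodory_type m1)) := mball m1 i _ b1.
have mb i : measurable (b i : set (caratheodory_type m2)) := mball m2 i _ b2.
have [mH iH] := indic_series_measurable (cara m1) c0 mB.
have [mG iG] := indic_series_measurable (cara m2) c0 mb.
exists (fun y => \sum_(0 <= i <oo) c i * (\1_(B i) y)%:E); split=> //.
- by move=> y; apply: nneseries_ge0 => i _ _; rewrite mule_ge0// lee_fin.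
- move=> a y Aa ay; have [i Di ia] := Dcov _ Aa.
  have iy : ball (x i) (2 * rho) y.
    apply/ballP; apply: (mdist_ltD ia (ltW ay)); lra.
  apply: le_trans (le_indic_series c0 (conj Di iy : B i y)).
  by apply: ereal_sup_ubound; exists y.
move=> g g0 hg; rewrite iH.
apply: (@le_trans _ _ (\sum_(0 <= i <oo) K%:E * (c i * m2 (b i)))).
  apply: lee_nneseries => [i _ _|i _]; first by rewrite mule_ge0.
  rewrite muleCA; apply: lee_pmul => //.
  have [Di|nDi] := pselect (D i).
    rewrite (_ : B i = ball (x i) (2 * rho)); last by apply/seteqP; split=> [y []|].
    rewrite (_ : b i = ball (x i) (rho / 2)); last by apply/seteqP; split=> [y []|].
    exact/m12/DA.
  rewrite (_ : B i = set0) ?measure0; last by apply/seteqP; split=> [y []|].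
  by rewrite mule_ge0// lee_fin.
rewrite nneseriesZl => [|i _]; last by rewrite mule_ge0.
rewrite lee_wpmul2l ?lee_fin// -iG.
apply: le_integral_lower => y.
  by apply: nneseries_ge0 => i _ _; rewrite mule_ge0// lee_fin.
apply: indic_series_le => // [i j [Di /ballP iy] [Dj /ballP jy]|i [Di /ballP iy]].
  apply/eqP; apply: contraT => ij; have := Dsep _ _ Di Dj ij.
  rewrite leNgt => /negP; case; rewrite metric_sym in jy.
  by apply: (mdist_ltD iy (ltW jy)); rewrite -splitr.
(* A point of the large ball and one of the small ball are less than [2 * rho + rho / 2] apart,
   within the range [3 * rho] of the Harnack hypothesis. *)
apply: ge_ereal_sup => _ [z /ballP iz <-]; apply: (hg (x i)) => //.
  exact: DA.
rewrite metric_sym in iz; apply: (mdist_ltD iz (ltW iy)); lra.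
Qed.

End net_transfer.

(** * Ball averages, oscillations and doubling *)

Section ball_average.
Context (R : realType) (X : completeMetricType R).
Variable mu : {outer_measure set X -> \bar R}.
Hypothesis bmu : <<s @open X >> `<=` mu.-caratheodory.
Hypothesis mu_ball : forall (x : X) (r : R), (0 < r)%R -> (0 < mu (ball x r) < +oo)%E.
Local Open Scope ereal_scope.
Local Notation T := (caratheodory_type mu).
Local Notation m := (cara mu).
Local Notation V x r := (fine (mu (ball x r))).
Implicit Types (x y : X) (r s t : R).

Lemma mu_ball_fineK x r : (0 < r)%R -> (V x r)%:E = mu (ball x r).
Proof.
by move=> r0; have /andP[? ?] := mu_ball x r0; rewrite fineK// gt0_fin_numE.
Qed.

Lemma mu_ball_fine_gt0 x r : (0 < r)%R -> (0 < V x r)%R.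
Proof. by move=> r0; rewrite fine_gt0// mu_ball. Qed.

Lemma ball_avgE (g : X -> \bar R) x r : (0 < r)%R ->
  ball_avg mu g x r = ((V x r)^-1)%:E * \int[m]_(y in ball x r) g y.
Proof.
move=> r0; rewrite /ball_avg -(mu_ball_fineK x r0) inver gt_eqF//.
exact: mu_ball_fine_gt0.
Qed.

Lemma ball_avg_ge0 (g : X -> \bar R) x r : (0 < r)%R ->
  (forall y, ball x r y -> 0 <= g y) -> 0 <= ball_avg mu g x r.
Proof.
move=> r0 g0; rewrite ball_avgE// mule_ge0// ?lee_fin ?invr_ge0.
  by rewrite ltW// mu_ball_fine_gt0.
by apply: integral_ge0.
Qed.

Lemma le_ball_avg (g h : X -> \bar R) x r : (0 < r)%R ->
  (forall y, ball x r y -> 0 <= g y <= h y) ->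
  ball_avg mu g x r <= ball_avg mu h x r.
Proof.
move=> r0 gh; rewrite !ball_avgE// lee_wpmul2l//.
  by rewrite lee_fin invr_ge0 ltW// mu_ball_fine_gt0.
by apply: lee_integral_sub => // y /gh /andP[] /le_trans h1 /h1.
Qed.

Lemma ball_avg_cst (c : \bar R) x r : (0 < r)%R ->
  ball_avg mu (fun=> c) x r = c.
Proof.
move=> r0; rewrite ball_avgE// (integral_cst m (ball_measurable_cara bmu x r) c).
transitivity (((V x r)^-1)%:E * (c * (V x r)%:E)); first by rewrite mu_ball_fineK.
rewrite muleCA -EFinM mulVf ?mule1//.
by rewrite gt_eqF// mu_ball_fine_gt0.
Qed.

Lemma ball_avgD (g h : X -> \bar R) x r : (0 < r)%R ->
  measurable_fun (ball x r : set T) (g : T -> \bar R) ->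
  measurable_fun (ball x r : set T) (h : T -> \bar R) ->
  (forall y, ball x r y -> 0 <= g y) -> (forall y, ball x r y -> 0 <= h y) ->
  ball_avg mu (fun y => g y + h y) x r = ball_avg mu g x r + ball_avg mu h x r.
Proof.
move=> r0 mg mh g0 h0; rewrite !ball_avgE//.
rewrite (ge0_integralD m (ball_measurable_cara bmu x r))// muleDr//.
by apply: ge0_adde_def; rewrite inE; apply: integral_ge0.
Qed.

Lemma ball_avgZ (k : R) (g : X -> \bar R) x r : (0 < r)%R -> (0 <= k)%R ->
  measurable_fun (ball x r : set T) (g : T -> \bar R) ->
  (forall y, ball x r y -> 0 <= g y) ->
  ball_avg mu (fun y => k%:E * g y) x r = k%:E * ball_avg mu g x r.
Proof.
move=> r0 k0 mg g0; rewrite !ball_avgE// muleCA; congr (_ * _).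
exact: (ge0_integralZl m (ball_measurable_cara bmu x r)).
Qed.

Lemma ball_avg_compare (c : R) (g : X -> \bar R) x r y s :
  (0 < r)%R -> (0 < s)%R -> ball x r `<=` ball y s ->
  mu (ball y s) <= c%:E * mu (ball x r) -> (forall z, 0 <= g z) ->
  ball_avg mu g x r <= c%:E * ball_avg mu g y s.
Proof.
move=> r0 s0 xy; rewrite -(mu_ball_fineK x r0) -(mu_ball_fineK y s0) -EFinM lee_fin => cV g0.
have Vx := mu_ball_fine_gt0 x r0; have Vy := mu_ball_fine_gt0 y s0.
rewrite !ball_avgE// muleA -EFinM; apply: lee_pmul.
- by rewrite lee_fin invr_ge0 ltW.
- by apply: integral_ge0.
- by rewrite lee_fin ler_pdivlMr// ler_pdivrMl// mulrC.
- by apply: lee_integral_sub => // z _; rewrite g0/=.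
Qed.

Lemma measurable_dist (f : X -> R) (c : R) x r :
  measurable_fun (ball x r : set T) (EFin \o f : T -> \bar R) ->
  measurable_fun (ball x r : set T) ((fun y => `|f y - c|%:E) : T -> \bar R).
Proof.
move=> /measurable_EFinP mf; apply/measurable_EFinP; apply: measurableT_comp => //.
exact: measurable_funB.
Qed.

Lemma ball_avg_dist (f : X -> R) (c : R) x r : (0 < r)%R ->
  m.-integrable (ball x r) (EFin \o f) ->
  (`|fine (ball_avg mu (EFin \o f) x r) - c|)%:E <=
  ball_avg mu (fun y => `|f y - c|%:E) x r.
Proof.
move=> r0 fi; have mB := ball_measurable_cara bmu x r.
have Vx := mu_ball_fine_gt0 x r0.
have ci : m.-integrable (ball x r) (EFin \o cst c).
  apply/integrableP; split; first by apply/measurable_EFinP; exact: measurable_cst.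
  rewrite (integral_cst m mB `|c%:E|) lte_mul_pinfty//.
  by have /andP[] := mu_ball x r0.
have E1 : \int[m]_(y in ball x r) (f y - c)%:E =
    \int[m]_(y in ball x r) (f y)%:E - c%:E * mu (ball x r).
  under eq_integral do rewrite EFinB.
  by rewrite (integralB mB fi ci)//= (integral_cst m mB).
have If := integrable_fin_num mB fi.
have E2 : (fine (ball_avg mu (EFin \o f) x r) - c)%:E =
    ((V x r)^-1)%:E * \int[m]_(y in ball x r) (f y - c)%:E.
  rewrite E1 ball_avgE// -[X in _ - _ * X](mu_ball_fineK x r0).
  rewrite -[in RHS](fineK If) -[in LHS](fineK If) /=; congr EFin.
  by rewrite mulrBr mulrCA mulVf ?mulr1// gt_eqF.
rewrite -abse_EFin E2 abseM gee0_abs ?lee_fin ?invr_ge0 ?(ltW Vx)// ball_avgE//.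
rewrite lee_wpmul2l ?lee_fin ?invr_ge0 ?(ltW Vx)//.
apply: (@le_trans _ _ (\int[m]_(y in ball x r) `|(f y - c)%:E|)).
  apply: le_abse_integral => //; apply/measurable_EFinP; apply: measurable_funB => //.
  by apply/measurable_EFinP; exact: measurable_int fi.
by under eq_integral do rewrite abse_EFin.
Qed.

Lemma mean_osc_ge0 (f : X -> R) t x : (0 < t)%R -> 0 <= mean_osc mu f t x.
Proof. by move=> t0; apply: ball_avg_ge0 => // y _; rewrite lee_fin. Qed.

(** The mean is a nearly optimal constant: its distance to [c] is at most the average distance of
    [f] to [c], whence the factor 2. *)
Lemma mean_osc_le (f : X -> R) (c : R) t x : (0 < t)%R ->
  m.-integrable (ball x t) (EFin \o f) ->
  mean_osc mu f t x <= 2%:E * ball_avg mu (fun y => `|f y - c|%:E) x t.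
Proof.
move=> t0 fi; rewrite /mean_osc; set a := fine _.
have mf := measurable_int _ fi.
apply: (@le_trans _ _ (ball_avg mu (fun y => `|f y - c|%:E + `|a - c|%:E) x t)).
  apply: le_ball_avg => // y _; rewrite -EFinD !lee_fin normr_ge0/=.
  rewrite (distrC a) (_ : f y - a = (f y - c) + (c - a))%R; last by ring.
  exact: ler_normD.
rewrite ball_avgD//; last exact: measurable_dist.
rewrite ball_avg_cst// mule_natl mule2n leeD2l//.
exact: ball_avg_dist.
Qed.

Lemma mean_osc_compare (C : R) (f : X -> R) x r y s :
  loc_integrable mu f -> (0 < r)%R -> (0 < s)%R -> ball x r `<=` ball y s ->
  mu (ball y s) <= C%:E * mu (ball x r) -> 
  mean_osc mu f r x <= (2 * C)%:E * mean_osc mu f s y.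
Proof.
move=> fi r0 s0 xy C0.
apply: le_trans (mean_osc_le (fine (ball_avg mu (EFin \o f) y s)) r0 (fi x _ r0)) _.
rewrite EFinM -muleA lee_wpmul2l ?lee_fin//.
by apply: ball_avg_compare => // z; rewrite lee_fin.
Qed.

Lemma ball_avg_jensen (f : X -> R) (p : R) x r : (1 <= p)%R -> (0 < r)%R ->
  measurable_fun (ball x r : set T) (f : T -> R) ->
  (ball_avg mu (fun y => `|f y|%:E) x r) `^ p <=
  ball_avg mu (fun y => (`|f y| `^ p)%:E) x r.
Proof.
move=> p1 r0 mf; have p0 : (0 < p)%R by exact: lt_le_trans p1.
have mfp : measurable_fun (ball x r : set T) ((fun y => (`|f y| `^ p)%:E) : T -> \bar R).
  apply/measurable_EFinP; apply: (measurableT_comp (measurable_powR _)).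
  exact: measurableT_comp.
have mfn : measurable_fun (ball x r : set T) ((fun y => (`|f y|)%:E) : T -> \bar R).
  by apply/measurable_EFinP; exact: measurableT_comp.
set A := ball_avg mu (fun y => `|f y|%:E) x r; set B := ball_avg _ _ _ _.
have A0 : 0 <= A by apply: ball_avg_ge0 => // y _; rewrite lee_fin.
have B0 : 0 <= B by apply: ball_avg_ge0 => // y _; rewrite lee_fin powR_ge0.
(* Young's inequality gives the tangent line of [u `^ p] at the average *)
have young (u a : R) : (0 <= u)%R -> (0 <= a)%R ->
    (p * a `^ (p - 1) * u <= u `^ p + (p - 1) * a `^ p)%R.
  move=> u0 a0; have [<-|pn1] := eqVneq 1%R p.
    by rewrite subrr powRr0 mul0r addr0 !mul1r powRr1.
  have p11 : (0 < p - 1)%R by rewrite subr_gt0 lt_neqAle pn1.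
  have := @conjugate_powR _ u (a `^ (p - 1))%R p (p / (p - 1))%R u0 (powR_ge0 _ _) p0.
  rewrite divr_gt0// => /(_ isT) h.
  have /h : (p^-1 + (p / (p - 1))^-1 = 1)%R.
    by rewrite invf_div -[X in (X + _)%R]mul1r -mulrDl addrC subrK mulfV// gt_eqF.
  rewrite -powRrM mulrCA mulfV ?gt_eqF// mulr1 => {}h.
  have : (p * (u * a `^ (p - 1)) <= p * (u `^ p / p + a `^ p / (p / (p - 1))))%R.
    by rewrite ler_pM2l.
  have -> : (p * (u `^ p / p + a `^ p / (p / (p - 1))) = u `^ p + (p - 1) * a `^ p)%R.
    by field; rewrite !gt_eqF.
  by rewrite mulrCA mulrC -mulrA.
have tangent (a : R) : (0 <= a)%R ->
    (p * a `^ (p - 1))%:E * A <= B + ((p - 1) * a `^ p)%:E.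
  move=> a0; have c0 : (0 <= (p - 1) * a `^ p)%R by rewrite mulr_ge0 ?powR_ge0// subr_ge0.
  have k0 : (0 <= p * a `^ (p - 1))%R by rewrite mulr_ge0 ?powR_ge0// ltW.
  rewrite -ball_avgZ//.
  rewrite -[X in _ <= _ + X](ball_avg_cst _ x r0) -ball_avgD//.
  apply: le_ball_avg => // y _; rewrite -EFinM -EFinD !lee_fin.
  by rewrite mulr_ge0//=; exact: young.
have [Afin|] := boolP (A \is a fin_num); last first.
  rewrite ge0_fin_numE// -leNgt leye_eq => /eqP Ay.
  (* When the average is infinite, the tangent line at 1 already forces the right-hand side to be
     infinite. *)
  have := tangent 1%R ler01; rewrite !powR1 !mulr1 Ay gt0_muley ?lte_fin//.
  rewrite poweRyr ?gt_eqF// !leye_eq => /eqP BE; apply/eqP.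
  by case: (B) BE.
(* The tangent line at the average itself: p A^p is at most B + (p - 1) A^p. *)
have := tangent (fine A) (fine_ge0 A0).
rewrite -{2}(fineK Afin) -[in A `^ p](fineK Afin) poweR_EFin -EFinM.
rewrite -mulrA [(_ `^ _ * fine A)%R]mulrC mulr_powRB1 ?fine_ge0// => h.
move: h; rewrite -leeBlDr// -EFinB (_ : (_ - _ = fine A `^ p)%R)//; ring.
Qed.

End ball_average.

Section doubling.
Context (R : realType) (X : completeMetricType R).
Variable mu : {outer_measure set X -> \bar R}.
Hypothesis bmu : <<s @open X >> `<=` mu.-caratheodory.
Hypothesis mu_ball : forall (x : X) (r : R), (0 < r)%R -> (0 < mu (ball x r) < +oo)%E.
Hypothesis sepX : separable X.
Variable C : R.
Hypothesis C0 : 0 < C.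
Hypothesis dbl : forall (x : X) (r : R), (0 < r <= 8)%R ->
  (mu (ball x (2 * r)%R) <= C%:E * mu (ball x r))%E.
Local Open Scope ereal_scope.
Local Notation m := (cara mu).
Implicit Types (x y : X) (r s t : R).

Lemma doubling_iter k x r : (0 < r)%R -> (2 ^+ k * r <= 16)%R ->
  mu (ball x (2 ^+ k * r)) <= (C ^+ k)%:E * mu (ball x r).
Proof.
move=> r0; elim: k => [|k ih] kr; first by rewrite !expr0 mul1r mul1e.
have k0 : (0 < 2 ^+ k * r)%R by rewrite mulr_gt0// exprn_gt0.
have kr8 : (2 ^+ k * r <= 8)%R by move: kr; rewrite exprS -mulrA => kr; lra.
rewrite exprS -mulrA; apply: le_trans (dbl _ _) _; first by rewrite k0.
rewrite exprS EFinM -muleA lee_wpmul2l ?lee_fin ?(ltW C0)//; apply: ih.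
by apply: le_trans kr8 _; lra.
Qed.

Lemma doubling_ball k x y r s : (0 < r)%R -> (2 ^+ k * r <= 16)%R ->
  (mdist x y + s <= 2 ^+ k * r)%R ->
  mu (ball y s) <= (C ^+ k)%:E * mu (ball x r).
Proof.
move=> r0 kr xy; apply: le_trans (doubling_iter x r0 kr).
by apply: le_outer_measure; exact: ball_subset.
Qed.

(** As [g] satisfies no Harnack inequality, each net point carries a multiple of the average of [g]
    over its doubled ball, and bounded overlap of these balls replaces disjointness. A factor
    [C ^+ 2] compares a ball of radius [t] with the doubled ball of a nearby net point, and [C ^+ 4]
    bounds the overlap. It serves with nu as [m1] for the coarsest averages in the trace bound, and
    with mu as [m1] for averaging at large scales in the extension. *)
Lemma net_average (m1 : {outer_measure set X -> \bar R}) (A : set X) (t K : R)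
    (g : X -> \bar R) :
  <<s @open X >> `<=` m1.-caratheodory ->
  (0 < t <= 1)%R -> (0 <= K)%R ->
  (forall a, A a -> m1 (ball a t) <= K%:E * mu (ball a t)) ->
  measurable_fun setT (g : caratheodory_type mu -> \bar R) -> (forall x, 0 <= g x) ->
  exists H : X -> \bar R,
    [/\ measurable_fun setT (H : caratheodory_type m1 -> \bar R),
        forall x, 0 <= H x,
        forall x, A x -> ball_avg mu g x t <= H x &
        \int[cara m1]_x H x <= (K * C ^+ 6)%:E * \int[m]_x g x].
Proof.
move=> b1 /andP[t0 t1] K0 m1K mg g0.
have [D [x [DA Dsep Dcov]]] := separated_net A sepX t0.
have t20 : (0 < 2 * t)%R by rewrite mulr_gt0.
pose c i := (C ^+ 2)%:E * ball_avg mu g (x i) (2 * t).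
pose B r i := [set y | D i /\ ball (x i) r y].
have BE r i : D i -> B r i = ball (x i) r.
  by move=> Di; apply/seteqP; split=> [y []|y].
have BN r i : ~ D i -> B r i = set0 by move=> nDi; apply/seteqP; split=> [y []|].
have avg0 i : 0 <= ball_avg mu g (x i) (2 * t).
  by apply: (ball_avg_ge0 mu_ball).
have c0 i : 0 <= c i by rewrite mule_ge0// lee_fin exprn_ge0// ltW.
have mB (nu : {outer_measure set X -> \bar R}) (r : R) i :
    <<s @open X >> `<=` nu.-caratheodory ->
    measurable (B r i : set (caratheodory_type nu)).
  move=> bnu; have [Di|nDi] := pselect (D i).
    by rewrite BE//; exact: ball_measurable_cara.
  by rewrite BN.
have [mH iH] := indic_series_measurable (cara m1) c0 (fun i => mB m1 t i b1).
exists (fun y => \sum_(0 <= i <oo) c i * (\1_(B t i) y)%:E); split=> //.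
- by move=> y; apply: nneseries_ge0 => i _ _; rewrite mule_ge0// lee_fin.
- move=> y Ay; have [i Di iy] := Dcov _ Ay.
  apply: le_trans (@le_indic_series _ _ c (B t) i y c0 _); last first.
    by split=> //; apply/ballP.
  apply: (ball_avg_compare mu_ball) => //.
    by apply: ball_subset; lra.
  apply: doubling_ball => //; rewrite ?(metric_sym y) expr2; lra.
(* points whose doubled balls contain y have disjoint small balls near y *)
have overlap y : \sum_(0 <= i <oo) (\1_(B (2 * t)%R i) y)%:E <= (C ^+ 4)%:E.
  have M0 : (0 < 5 / 2 * t)%R by rewrite mulr_gt0.
  set M := mu (ball y (5 / 2 * t)).
  have Mgt : (0 < fine M)%R by exact: mu_ball_fine_gt0.
  have ME : (fine M)%:E = M by exact: mu_ball_fineK.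
  (* The middle factor is everything or nothing: it keeps the indices whose doubled ball contains
     the fixed [y], so that the disjoint small balls inside the ball of radius [5 / 2 * t] count
     them. *)
  pose b i := B (2 * t)%R i `&` [set _ | ball (x i) (2 * t) y] `&` B (t / 2)%R i.
  have mb i : measurable (b i : set (caratheodory_type mu)).
    apply: measurableI; last exact: mB.
    apply: measurableI; first exact: mB.
    by have [iy|niy] := pselect (ball (x i) (2 * t) y);
      [rewrite (_ : [set _ | _] = setT)|rewrite (_ : [set _ | _] = set0)] => //;
      apply/seteqP; split.
  have [_ ib] := @indic_series_measurable _ _ _ m (fun=> 1) b (fun=> lee01) mb.
  have sumb : \sum_(0 <= i <oo) 1 * m (b i) <= M.
    rewrite -ib; apply: (@le_trans _ _ (\int[m]_z (\1_(ball y (5 / 2 * t)%R) z)%:E)).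
      apply: le_integral_lower => z.
        by apply: nneseries_ge0 => i _ _; rewrite mule_ge0// lee_fin.
      apply: indic_series_le => //.
        move=> i j [_ [Di /ballP iz]] [_ [Dj /ballP jz]].
        apply/eqP; apply: contraT => ij; have := Dsep _ _ Di Dj ij.
        rewrite leNgt => /negP; case; rewrite metric_sym in jz.
        by apply: (mdist_ltD iz (ltW jz)); rewrite -splitr.
      move=> i [[_ /ballP iy] [_ /ballP iz]]; rewrite indicE mem_set//.
      apply/ballP; rewrite metric_sym in iy; apply: (mdist_ltD iy (ltW iz)); lra.
    by rewrite integral_indic ?setIT//; exact: ball_measurable_cara.
  rewrite -(@lee_pmul2l _ (fine M)%:E)//.
  rewrite -nneseriesZl => [|i _]; last by rewrite lee_fin.
  apply: (@le_trans _ _ (\sum_(0 <= i <oo) (C ^+ 4)%:E * (1 * m (b i)))).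
    apply: lee_nneseries => [i _ _|i _].
      by rewrite mule_ge0// lee_fin// ltW.
    rewrite indicE; case: (boolP (y \in _)) => [/set_mem[Di iy]|_]; last first.
      by rewrite mule0 mule_ge0 ?mul1e// lee_fin exprn_ge0// ltW.
    rewrite mule1 mul1e ME (_ : b i = ball (x i) (t / 2)).
      move/ballP in iy.
      apply: doubling_ball; first by rewrite divr_gt0.
        by rewrite (_ : 2 ^+ 4 = 16)%R; [lra|ring].
      by rewrite (_ : 2 ^+ 4 = 16)%R; [lra|ring].
    rewrite /b !BE//; apply/seteqP; split=> [z [_]//|z iz]; split=> //; split=> //.
    by apply: (ball_subset _ iz); rewrite mdistxx; lra.
  rewrite nneseriesZl => [|i _]; last by rewrite mul1e.
  rewrite muleC ME; apply: lee_wpmul2r => //.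
  by rewrite lee_fin exprn_ge0// ltW.
rewrite iH.
apply: (@le_trans _ _ (\sum_(0 <= i <oo) (K * C ^+ 2)%:E *
    \int[m]_y (g y * (\1_(B (2 * t)%R i) y)%:E))).
  have KC0 : 0 <= (K * C ^+ 2)%:E by rewrite lee_fin mulr_ge0// exprn_ge0// ltW.
  have Ig0 i : 0 <= \int[m]_y (g y * (\1_(B (2 * t)%R i) y)%:E).
    by apply: integral_ge0 => y _; rewrite mule_ge0// lee_fin.
  apply: lee_nneseries => [i _ _|i _]; first by rewrite mule_ge0.
  have [Di|nDi] := pselect (D i); last first.
    by rewrite BN// measure0 mule0 mule_ge0.
  have -> : \int[m]_y (g y * (\1_(B (2 * t)%R i) y)%:E) =
      \int[m]_(y in ball (x i) (2 * t)) g y.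
    rewrite [RHS]integral_mkcond; apply: eq_integral => y _.
    by rewrite epatch_indic BE.
  rewrite BE// /c (ball_avgE mu_ball)//.
  have Vgt := mu_ball_fine_gt0 mu_ball (x i) t20.
  rewrite [X in _ <= X * _]EFinM [X in _ <= X * _]muleC -!muleA.
  set I := \int[m]_(y in _) _; have I0 : 0 <= I by apply: integral_ge0.
  (* The measure of the doubled ball will cancel the normalisation of the average in [c i]. *)
  have mt : m1 (ball (x i) t) <= K%:E * (fine (mu (ball (x i) (2 * t))))%:E.
    apply: le_trans (m1K _ (DA _ Di)) _; rewrite (mu_ball_fineK mu_ball)//.
    rewrite lee_wpmul2l ?lee_fin//; apply: le_outer_measure; apply: ball_subset.
    by rewrite mdistxx; lra.
  rewrite lee_wpmul2l ?lee_fin ?exprn_ge0 ?(ltW C0)//.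
  apply: (@le_trans _ _ (((fine (mu (ball (x i) (2 * t))))^-1)%:E *
    (I * (K%:E * (fine (mu (ball (x i) (2 * t))))%:E)))).
    by rewrite lee_wpmul2l ?lee_fin ?invr_ge0 ?(ltW Vgt)// lee_wpmul2l.
  rewrite (muleCA I) [leLHS]muleCA (muleC I) (muleA (_^-1)%:E) -EFinM.
  by rewrite mulVf ?gt_eqF// mul1e.
have gB0 i y : 0 <= g y * (\1_(B (2 * t)%R i) y)%:E by rewrite mule_ge0// lee_fin.
rewrite nneseriesZl => [|i _]; last by apply: integral_ge0.
rewrite (_ : K * C ^+ 6 = (K * C ^+ 2) * C ^+ 4)%R; last by ring.
rewrite [X in _ <= X * _]EFinM -muleA lee_wpmul2l ?lee_fin ?mulr_ge0 ?exprn_ge0 ?(ltW C0)//.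
rewrite -integral_nneseries//; last first.
  move=> i; apply: emeasurable_funM => //; apply/measurable_EFinP.
  by apply: measurable_indic; exact: mB.
rewrite -ge0_integralZl//; last by rewrite lee_fin exprn_ge0// ltW.
apply: le_integral_lower => y; first by apply: nneseries_ge0 => i _ _.
have CC : (0 < C ^+ 4)%R by rewrite exprn_gt0.
(* A finite value of [g] factors out of the series; an infinite one makes the right-hand side
   infinite. *)
move: (g0 y) (gB0^~ y); case: (g y) => [r r0 rB0| |//]; last first.
  by move=> _ _; rewrite gt0_muley ?lte_fin// leey.
rewrite nneseriesZl => [|i _]; last by rewrite lee_fin.
by rewrite muleC; apply: lee_wpmul2r.
Qed.

End doubling.

(** * Traces of Besov functions *)

(** This persists at infinite [y] because [fine] sends both infinities to 0. *)
Lemma fine_mulEFin (R : realType) (c : R) (y : \bar R) :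
  fine (c%:E * y)%E = c * fine y.
Proof.
case: y => [r//| |].
- have -> : c * fine (+oo%E : \bar R) = 0 by exact: mulr0.
  have [c0|c0|->] := ltgtP c 0; last by rewrite mul0e.
    by rewrite lt0_muley ?lte_fin.
  by rewrite gt0_muley ?lte_fin.
- have -> : c * fine (-oo%E : \bar R) = 0 by exact: mulr0.
  have [c0|c0|->] := ltgtP c 0; last by rewrite mul0e.
    by rewrite lt0_muleNy ?lte_fin.
  by rewrite gt0_muleNy ?lte_fin.
Qed.

(** The series of increments converges absolutely. This serves both the dyadic averages of a Besov
    function and the partial sums of a series of extensions. *)
Lemma cvg_increments (R : realType) (A : R^nat) (y : (\bar R)^nat) (D : R) :
  (forall k, 0 <= y k)%E -> (0 <= D)%R -> (\sum_(0 <= k <oo) y k < +oo)%E ->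
  (forall k, (`|A k.+1 - A k|)%:E <= D%:E * y k)%E ->
  exists l : R, [/\ A k @[k --> \oo] --> l, (y k @[k --> \oo] --> 0)%E &
    (`|l|%:E <= `|A 0%N|%:E + D%:E * \sum_(0 <= k <oo) y k)%E].
Proof.
move=> y0 D0 Sy Ay; set S := (\sum_(0 <= k <oo) y k)%E in Sy *.
have tail k : (y k <= \sum_(k <= i <oo) y i)%E.
  apply: le_trans (@nneseries_lim_ge _ y xpredT k k.+1 _) => //.
  by rewrite big_nat1.
have yS k : (y k <= S)%E.
  apply: le_trans (@nneseries_lim_ge _ y xpredT 0 k.+1 _) => //.
  by rewrite big_nat_recr//= leeDr// sume_ge0.
have S0 : (0 <= S)%E by exact: le_trans (yS 0%N).
have Sf : S \is a fin_num by rewrite ge0_fin_numE.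
have yf k : y k \is a fin_num by rewrite ge0_fin_numE// (le_lt_trans (yS k)).
pose u := telescope A.
have nu_ n : [normed series u] n <= D * fine S.
  rewrite -lee_fin EFinM fineK// /series/= -sumEFin.
  apply: (@le_trans _ _ (\sum_(0 <= k < n) D%:E * y k)%E).
    by apply: lee_sum => k _; exact: Ay.
  rewrite -ge0_sume_distrr//; apply: lee_wpmul2l; first by rewrite lee_fin.
  exact: nneseries_lim_ge.
have cu : cvgn (series u).
  apply: normed_cvg; apply: nondecreasing_is_cvgn.
    apply/nondecreasing_seqP => n; rewrite /series/=.
    by rewrite [leRHS]big_nat_recr//= lerDl.
  by exists (D * fine S) => _ [n _ <-].
have cA : cvgn A.
  rewrite (_ : A = (fun n => A 0%N + series u n)); first by apply: is_cvgD; [exact: is_cvg_cst|exact: cu].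
  by apply/funext => n; rewrite -eq_sum_telescope.
exists (limn A); split => //.
  apply: near_le_cvge0 => // e e0.
  have tcvg : (\sum_(N <= k <oo) y k @[N --> \oo] --> 0)%E by exact: nneseries_tail_cvg.
  by apply: filterS (cvge0_near_lt tcvg e0) => k /ltW; apply: le_trans.
rewrite -(fineK Sf) -EFinM -EFinD lee_fin.
rewrite -(cvg_lim _ (cvg_norm cA))//.
apply: limr_le; first exact: is_cvg_norm.
apply: nearW => n; rewrite (eq_sum_telescope A n).
apply: le_trans (ler_normD _ _) _; rewrite lerD2l; apply: le_trans (nu_ n).
by rewrite /series/=; exact: ler_norm_sum.
Qed.

Section ball_integral_measurable.
Context (R : realType) (X : completeMetricType R).
Variables mu nu : {outer_measure set X -> \bar R}.
Hypothesis bmu : <<s @open X >> `<=` mu.-caratheodory.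
Hypothesis bnu : <<s @open X >> `<=` nu.-caratheodory.
Hypothesis mu_ball : forall (x : X) (r : R), (0 < r)%R -> (0 < mu (ball x r) < +oo)%E.
Local Open Scope ereal_scope.
Local Notation m := (cara mu).

(** Lower semicontinuity in the centre: a slightly smaller concentric ball carries almost all of the
    integral, and it is contained in the ball of radius [t] around every nearby point. Superlevel
    sets are thus open, so a mu-measurable [g] yields a nu-measurable function. *)
Lemma measurable_ball_integral_ge0 (g : X -> \bar R) (t : R) : (0 < t)%R ->
  measurable_fun setT (g : caratheodory_type mu -> \bar R) -> (forall x, 0 <= g x) ->
  measurable_fun setT
    ((fun x => \int[m]_(y in ball x t) g y) : caratheodory_type nu -> \bar R).
Proof.
move=> t0 mg g0; apply: (lsc_measurable_cara bnu) => a.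
rewrite openE => x /= ax; rewrite /interior; apply/nbhs_ballP.
pose F n : set X := ball x (t - n.+1%:R^-1).
have FE : \bigcup_n F n = ball x t.
  apply/seteqP; split=> [y [n _]|y /ballP xy].
    by apply: ball_subset; rewrite mdistxx add0r gerBl.
  have [|n nxy] := @ex_natSinv_lt _ (t - mdist x y); first by rewrite subr_gt0.
  by exists n => //; apply/ballP; rewrite ltrBrDr addrC -ltrBrDr.
have ndF : {homo F : n k / (n <= k)%N >-> (n <= k)%O}.
  move=> n k nk; apply/subsetPset; apply: ball_subset.
  by rewrite mdistxx add0r lerB// lef_pV2 ?posrE ?ltr0n// ler_nat.
have cF := @ge0_nondecreasing_set_cvg_integral _ (caratheodory_type mu) R F g m ndF
  (fun i => ball_measurable_cara bmu _ _)
  (fun i => measurable_funTS mg) (fun i y _ => g0 y).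
have [n _ /(_ n (leqnn n))/= an] : \forall n \near \oo, a%:E < \int[m]_(y in F n) g y.
  apply: (cF (fun u => a%:E < u)).
  by apply: (@open_ereal_gt' _ (\int[m]_(y in \bigcup_i F i) g y)); rewrite FE.
exists (n.+1%:R^-1)%R => [|y /ballP xy]; first by rewrite /= invr_gt0 ltr0n.
apply: lt_le_trans an _; apply: lee_integral_sub => // [|z _]; last by rewrite g0/=.
apply: ball_subset; rewrite metric_sym addrC; apply: ltW.
by rewrite -ltrBrDl opprB addrC subrK.
Qed.

Lemma measurable_ball_integral (f : X -> R) (t : R) : (0 < t)%R ->
  measurable_fun setT (f : caratheodory_type mu -> R) ->
  measurable_fun setT
    ((fun x => \int[m]_(y in ball x t) (f y)%:E) : caratheodory_type nu -> \bar R).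
Proof.
move=> t0 /measurable_EFinP mf; under eq_fun do rewrite integralE.
apply: emeasurable_funB; apply: measurable_ball_integral_ge0 => //.
- exact: measurable_funepos.
- exact: measurable_funeneg.
Qed.

Lemma measurable_fine_ball_avg (f : X -> R) (t : R) : (0 < t)%R ->
  measurable_fun setT (f : caratheodory_type mu -> R) ->
  measurable_fun setT
    ((fun x => fine (ball_avg mu (EFin \o f) x t)) : caratheodory_type nu -> R).
Proof.
move=> t0 mf.
(* The measure of the ball is the ball integral of the constant 1, so its inverse is measurable as
   well. *)
have -> : (fun x => fine (ball_avg mu (EFin \o f) x t)) = (fun x =>
    (fine (\int[m]_(y in ball x t) cst 1 y)) `^ (-1) *
    fine (\int[m]_(y in ball x t) (f y)%:E))%R.
  apply/funext => x; rewrite (ball_avgE mu_ball)// fine_mulEFin.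
  rewrite (integral_cst m (ball_measurable_cara bmu x t) 1) mul1e.
  by rewrite powR_inv1// fine_ge0.
apply: measurable_funM.
  apply: (measurableT_comp (measurable_powR _)).
  apply: measurableT_comp => //; apply: measurable_ball_integral_ge0 => //.
by apply: measurableT_comp => //; exact: measurable_ball_integral.
Qed.

End ball_integral_measurable.

Section trace.
Context (R : realType) (X : completeMetricType R).
Variable mu : {outer_measure set X -> \bar R}.
Hypothesis bmu : <<s @open X >> `<=` mu.-caratheodory.
Hypothesis mu_ball : forall (x : X) (r : R), (0 < r)%R -> (0 < mu (ball x r) < +oo)%E.
Hypothesis sepX : separable X.
Variable C : R.
Hypothesis C0 : 0 < C.
Hypothesis dbl : forall (x : X) (r : R), (0 < r <= 8)%R ->
  (mu (ball x (2 * r)%R) <= C%:E * mu (ball x r))%E.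
Variables (theta p : R) (E : set X).
Hypothesis p1 : 1 <= p.
Hypothesis theta0 : 0 < theta.
Local Open Scope ereal_scope.
Local Notation m := (cara mu).
Local Notation nu := (codim_hausdorff_on mu theta E).
Local Notation s := (theta / p)%R.
Variable c2 : R.
Hypothesis c20 : (0 < c2)%R.
Hypothesis nu_le : forall (x : X) (r : R), E x -> (0 < r <= 1)%R ->
  nu (ball x r) <= c2%:E * (mu (ball x r) * (r `^ theta)^-1%:E).

Let bnu : <<s @open X >> `<=` nu.-caratheodory.
Proof. exact: codim_hausdorff_on_borel. Qed.

Let p0 : (0 < p)%R. Proof. exact: lt_le_trans p1. Qed.

Let pV0 : (0 <= p^-1)%R. Proof. by rewrite invr_ge0 ltW. Qed.

(** A Harnack inequality across scales: for [u] between [2 * t] and [4 * t], the ball of radius [t]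
    at [x] lies in the ball of radius [u] at any [y] closer than 3t/4, so the oscillation at [x] is
    at most [2 * C ^+ 3] times that at [y]. The p-th powers are transferred along a net of spacing
    [t / 4]. As [Y] does not depend on [u], one dyadic scale can be compared with an integral over a
    whole interval of scales. *)
Lemma mean_osc_transfer (f : X -> R) (t : R) : loc_integrable mu f ->
  (0 < t <= 4^-1)%R ->
  exists Y : X -> \bar R,
    [/\ measurable_fun setT (Y : caratheodory_type nu -> \bar R),
        forall x, 0 <= Y x,
        forall x, E x -> mean_osc mu f t x <= (2 * C ^+ 3)%:E * Y x &
        forall u, (2 * t < u < 4 * t)%R ->
          'N[cara nu]_p%:E[Y] <=
          ((c2 * C ^+ 2) `^ p^-1 * (t / 2) `^ (- s))%:E *
            'N[m]_p%:E[mean_osc mu f u]].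
Proof.
move=> fi /andP[t0 t4]; have CC : (0 < 2 * C ^+ 3)%R by rewrite mulr_gt0// exprn_gt0.
pose h x := ((2 * C ^+ 3)^-1%:E * mean_osc mu f t x) `^ p.
have osc0 u x : (0 < u)%R -> 0 <= mean_osc mu f u x.
  by move=> u0; apply: (mean_osc_ge0 mu_ball).
have h0 x : 0 <= h x by exact: poweR_ge0.
have rho0 : (0 < t / 4)%R by rewrite divr_gt0.
have K0 : (0 <= c2 * C ^+ 2 * (t / 2) `^ (- theta))%R.
  by rewrite !mulr_ge0 ?powR_ge0 ?exprn_ge0// ltW.
have nuK a : E a -> nu (ball a (2 * (t / 4))) <=
    (c2 * C ^+ 2 * (t / 2) `^ (- theta))%:E * mu (ball a (t / 4 / 2)).
  move=> Ea; rewrite (_ : 2 * (t / 4) = t / 2)%R; last by field.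
  have t20 : (0 < t / 2)%R by rewrite divr_gt0.
  apply: le_trans (nu_le Ea _) _; first by rewrite t20/=; lra.
  rewrite powRN -mulrA [in leRHS]EFinM -muleA lee_wpmul2l ?lee_fin ?(ltW c20)//.
  rewrite EFinM muleAC; apply: lee_wpmul2r; first by rewrite lee_fin invr_ge0 powR_ge0.
  apply: (doubling_ball C0 dbl) => //; rewrite ?mdistxx ?expr2; lra.
have [H [mH H0 hH iH]] := net_transfer sepX bnu bmu rho0 K0 nuK h0.
exists (fun x => H x `^ p^-1); split.
- exact: measurable_poweR_comp.
- by move=> x; exact: poweR_ge0.
- move=> x Ex; have hHx : h x <= H x by apply: (hH x) => //; rewrite mdistxx.
  rewrite -lee_pdivrMl// -[leLHS](@poweRKV _ _ p)//; last first.
    by rewrite mule_ge0 ?osc0// lee_fin invr_ge0 ltW.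
  exact: lee_poweR pV0 (h0 x) hHx.
move=> u /andP[ut tu]; have u0 : (0 < u)%R by apply: lt_trans ut; rewrite mulr_gt0.
rewrite Lnorm_root//; apply: (@le_trans _ _
  (((c2 * C ^+ 2 * (t / 2) `^ (- theta))%:E *
     \int[m]_y (mean_osc mu f u y) `^ p) `^ p^-1)).
  apply: lee_poweR => //; first by apply: integral_ge0.
  apply: iH => [y|a x y Ea ax xy]; first exact: poweR_ge0.
  apply: lee_poweR; first exact: ltW.
    by rewrite mule_ge0 ?osc0// lee_fin invr_ge0 ltW.
  rewrite lee_pdivrMl//; apply: (mean_osc_compare bmu mu_ball) => //.
    by apply: ball_subset; rewrite metric_sym; lra.
  apply: (doubling_ball C0 dbl) => //; first by rewrite (_ : 2 ^+ 3 = 8)%R; [lra|ring].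
  by rewrite (_ : 2 ^+ 3 = 8)%R; [lra|ring].
rewrite poweRM ?lee_fin//; last by apply: integral_ge0 => y _; exact: poweR_ge0.
rewrite (@Lnorm_ge0E _ _ _ m p (mean_osc mu f u)) => [|y]; last exact: osc0.
rewrite poweR_EFin powRM ?powR_ge0//; last by rewrite mulr_ge0 ?exprn_ge0// ltW.
by rewrite -powRrM mulNr.
Qed.

(** The radii start at 1/4 so that the intervals from [2 * tk k] to [4 * tk k] are disjoint and fill
    the scales below 1 up to endpoints. *)
Let tk k : R := ((2 ^+ k.+2)^-1)%R.

Let tk0 k : (0 < tk k)%R. Proof. by rewrite invr_gt0 exprn_gt0. Qed.

Let tk4 k : (tk k <= 4^-1)%R.
Proof.
rewrite lef_pV2 ?posrE ?exprn_gt0// (_ : 4 = 2 ^+ 2)%R; last by ring.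
by apply: ler_weXn2l => //; rewrite ler1n.
Qed.

Let tkS k : tk k = (2 * tk k.+1)%R.
Proof. by rewrite /tk [in RHS]exprS [in RHS]invfM mulVKf. Qed.

Let itv_tk k : [set u | (2 * tk k < u < 4 * tk k)%R] =
  `](2 ^+ k.+1)^-1%R, (2 ^+ k)^-1%R[%classic.
Proof.
have E2 : (2 * tk k = (2 ^+ k.+1)^-1)%R by rewrite /tk exprS invfM mulVKf.
have E4 : (4 * tk k = (2 ^+ k)^-1)%R.
  by rewrite (_ : 4 = 2 * 2)%R -?mulrA ?E2 ?exprS ?invfM ?mulVKf//; ring.
by apply/seteqP; split=> u /=; rewrite in_itv/= E2 E4.
Qed.

(** The factor 1/2 is the length of the k-th interval over its right end [4 * tk k]; the power of 8
    comes from the ratio of [tk k / 2] to that end. *)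
Let beta : R := (2^-1 * 8 `^ (- s) / (c2 * C ^+ 2) `^ p^-1)%R.

(** The step function with value [c k] on the k-th interval lies below the Besov integrand, and its
    integral is the left-hand side. *)
Lemma sum_mean_osc_transfer (f : X -> R) (n : (\bar R)^nat) :
  (forall k, 0 <= n k) ->
  (forall k u, (2 * tk k < u < 4 * tk k)%R ->
     n k <= ((c2 * C ^+ 2) `^ p^-1 * (tk k / 2) `^ (- s))%:E *
            'N[m]_p%:E[mean_osc mu f u]) ->
  beta%:E * \sum_(0 <= k <oo) n k <= besov_seminorm mu s p f.
Proof.
move=> n0 nN; set kap := ((c2 * C ^+ 2) `^ p^-1)%R in nN *.
have kap0 : (0 < kap)%R by rewrite powR_gt0// mulr_gt0// exprn_gt0.
have s0 : (0 <= s)%R by rewrite divr_ge0// ltW.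
pose c k : \bar R := ((4 * tk k) `^ (- s) * (4 * tk k)^-1 *
  (kap^-1 * (tk k / 2) `^ s))%:E * n k.
pose I k := [set u : R | (2 * tk k < u < 4 * tk k)%R].
have c0 k : 0 <= c k.
  by rewrite mule_ge0// lee_fin !mulr_ge0 ?powR_ge0 ?invr_ge0 ?mulr_ge0 ?(ltW kap0) ?(ltW (tk0 _)).
have mI k : measurable (I k : set (measurableTypeR R)).
  by rewrite /I itv_tk; exact: measurable_itv.
have [_ iI] := indic_series_measurable (@lebesgue_measure R) c0 mI.
have cI k : beta%:E * n k = c k * lebesgue_measure (I k).
  rewrite /I itv_tk lebesgue_measure_itv/= lte_fin ltf_pV2 ?posrE ?exprn_gt0//.
  rewrite ltr_eXn2l ?ltr1n// ltnSn -EFinB /c muleAC -EFinM; congr (_%:E * _).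
  have t0 := tk0 k; have E2 : ((2 ^+ k)^-1 - (2 ^+ k.+1)^-1 = 2 * tk k)%R.
    rewrite /tk !exprS; field; by rewrite expf_neq0.
  rewrite E2 /beta -/kap; have -> : (tk k / 2 = 8^-1 * (4 * tk k))%R by field.
  rewrite (@powRM _ 8^-1 (4 * tk k) s) ?invr_ge0// ?mulr_ge0 ?(ltW t0)//.
  have -> : (8^-1 `^ s = 8 `^ (- s) :> R)%R.
    by rewrite -powR_inv1// -powRrM mulN1r.
  set A := ((4 * tk k) `^ (- s))%R; have -> : ((4 * tk k) `^ s = A^-1)%R.
    by rewrite /A powRN invrK.
  have A0 : A != 0%R by rewrite gt_eqF// powR_gt0// mulr_gt0.
  by field; rewrite A0 (gt_eqF kap0) gt_eqF.
rewrite -nneseriesZl// (eq_eseriesr (fun k _ => cI k)) -iI.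
rewrite /besov_seminorm [leRHS]integral_mkcond; apply: le_integral_lower => u.
  by apply: nneseries_ge0 => k _ _; rewrite mule_ge0// lee_fin.
have I01 k : I k `<=` `]0%R, 1%R[%classic.
  rewrite /I itv_tk => v /=; rewrite !in_itv/= => /andP[v1 v2]; apply/andP; split.
    by apply: le_lt_trans v1; rewrite invr_ge0 exprn_ge0.
  by apply: lt_le_trans v2 _; rewrite invf_le1 ?exprn_gt0// exprn_ege1// ler1n.
have N0 v : 0 <= 'N[m]_p%:E[mean_osc mu f v] by exact: Lnorm_ge0.
apply: indic_series_le => //.
- rewrite patchE; case: ifPn => // /set_mem; rewrite /= in_itv/= => /andP[u0 _].
  by rewrite !mule_ge0// lee_fin ?powR_ge0 ?invr_ge0// ltW.
- move=> i j; rewrite /I !itv_tk /= !in_itv/= => /andP[i1 i2] /andP[j1 j2].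
  have aux a b : (a < b)%N -> ((2 ^+ b)^-1 <= (2 ^+ a.+1)^-1 :> R)%R.
    by move=> ab; rewrite lef_pV2 ?posrE ?exprn_gt0// ler_eXn2l// ltr1n.
  case: (ltngtP i j) => // [/aux ij|/aux ji].
    by have := lt_trans i1 (lt_le_trans j2 ij); rewrite ltxx.
  by have := lt_trans j1 (lt_le_trans i2 ji); rewrite ltxx.
move=> k Iku; have := I01 _ _ Iku; rewrite /= in_itv/= => /andP[u0 u1].
rewrite patchE mem_set; last by rewrite /= in_itv/= u0.
have nku := nN _ _ Iku; case/andP: Iku => u2 u4; have t0 := tk0 k.
rewrite muleAC -EFinM /c [X in X * _ <= _]EFinM -[leLHS]muleA; apply: lee_pmul.
- by rewrite lee_fin mulr_ge0 ?powR_ge0// invr_ge0 mulr_ge0// ltW.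
- by rewrite mule_ge0// lee_fin mulr_ge0 ?powR_ge0// invr_ge0 ltW.
- rewrite lee_fin ler_pM ?powR_ge0 ?invr_ge0 ?mulr_ge0 ?(ltW t0)//; last first.
    by rewrite lef_pV2 ?posrE ?mulr_gt0// ltW.
  rewrite !powRN lef_pV2 ?posrE ?powR_gt0 ?mulr_gt0//.
  apply: ge0_ler_powR => //; [exact: ltW u0| |exact: ltW u4].
  by rewrite nnegrE mulr_ge0// ltW.
rewrite EFinM -muleA lee_pdivrMl// muleC -lee_pdivlMr ?powR_gt0 ?divr_gt0//.
by rewrite -powRN muleAC -EFinM.
Qed.

(** The modulus of [f] is at most 1 plus its p-th power, and balls have finite measure. *)
Lemma Lfun_loc_integrable (f : X -> R) :
  (f : caratheodory_type mu -> R) \in Lfun m p%:E -> loc_integrable mu f.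
Proof.
move=> /[dup] /(Lfun_integrable p1) /integrableP[_ fp] /andP[/[!inE]/= mf _] x r r0.
have mB := ball_measurable_cara bmu x r.
apply/integrableP; split.
  by apply/measurable_EFinP; exact: measurable_funTS.
have m1 : measurable_fun (ball x r : set (caratheodory_type mu))
    ((fun y => (`|f y| `^ p)%:E) : caratheodory_type mu -> \bar R).
  apply/measurable_EFinP; apply: (measurableT_comp (measurable_powR _)).
  by apply: measurableT_comp => //; exact: measurable_funTS.
apply: (@le_lt_trans _ _ (\int[m]_(y in ball x r) (1 + (`|f y| `^ p)%:E))).
  apply: lee_integral_sub => // y _; first by rewrite adde_ge0 ?lee_fin ?powR_ge0.
  rewrite abse_ge0/= -EFinD lee_fin; have [f1|f1] := leP `|f y|%R 1%R.
    by apply: le_trans f1 _; rewrite lerDl powR_ge0.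
  by apply: le_trans (le1r_powR (ltW f1) p1) _; rewrite lerDr.
rewrite ge0_integralD//.
rewrite lte_add_pinfty//.
  rewrite (integral_cst m mB 1) mul1e; by have /andP[] := mu_ball x r0.
apply: le_lt_trans fp; under [leRHS]eq_integral do rewrite gee0_abs ?lee_fin ?powR_ge0//.
by apply: lee_integral_sub => // y _; rewrite !lee_fin ?powR_ge0 ?lexx.
Qed.

Lemma nu_ae_mem : {ae cara nu, forall x, E x}.
Proof.
exists (~` E); split=> //; last exact: codim_hausdorff_onC.
apply: le_caratheodory_measurable => Y.
rewrite [X in X + _](_ : _ = 0) ?add0e.
  by apply: le_outer_measure; exact: subIsetl.
by apply: codim_hausdorff_onC; exact: subIsetr.
Qed.

(** A small radius lies between [tk k.+1] and [tk k], so the average over its ball is at most [C]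
    times that over the larger dyadic ball; the latter is at most the oscillation plus the distance
    of the dyadic average to [l]. *)
Lemma mean_osc_cvg_trace (f : X -> R) (x : X) (l : R) : loc_integrable mu f ->
  mean_osc mu f (tk k) x @[k --> \oo] --> 0 ->
  fine (ball_avg mu (EFin \o f) x (tk k)) @[k --> \oo] --> l ->
  ball_avg mu (fun y => `|f y - l|%:E) x r @[r --> 0%R^'+] --> 0.
Proof.
move=> fi osc0 Al; apply: near_le_cvge0.
  move=> r; rewrite /ball_avg mule_ge0 ?inve_ge0//.
  by apply: integral_ge0 => y _; rewrite lee_fin.
move=> e e0; pose e1 := (e / (2 * C))%R.
have e10 : (0 < e1)%R by rewrite divr_gt0// mulr_gt0.
have [N1 _ oN] := cvge0_near_lt osc0 e10.
have [N2 _ AN] := (@cvgrPdist_le _ _ _ _ _ _ _).1 Al _ e10.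
pose N := maxn N1 N2.
near=> r; have r0 : (0 < r)%R by near: r; exact: nbhs_right_gt.
have rN : (r < tk N)%R by near: r; apply: nbhs_right_lt.
have ex : exists k, (tk k.+1 <= r)%R.
  have [n nr] := ex_natSinv_lt r0; exists n; apply: ltW; apply: le_lt_trans nr.
  rewrite lef_pV2 ?posrE ?exprn_gt0// -natrX ler_nat.
  by apply: leq_trans (ltn_expl n (leqnn 2)) _; rewrite leq_exp2l// -addn3 leq_addr.
case: (ex_minnP ex) => k kr kmin.
have tkle i j : (i <= j)%N -> (tk j <= tk i)%R.
  by move=> ij; rewrite lef_pV2 ?posrE ?exprn_gt0// ler_weXn2l// ?ler1n.
have Nk : (N <= k)%N.
  rewrite leqNgt; apply/negP => kN.
  by have := lt_le_trans rN (le_trans (tkle _ _ kN) kr); rewrite ltxx.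
have Ck : mu (ball x (tk k)) <= C%:E * mu (ball x r).
  rewrite -[C]expr1; apply: (doubling_ball C0 dbl) => //; rewrite ?expr1 ?mdistxx.
    by have := tk4 N; lra.
  by rewrite add0r tkS ler_pM2l.
(* Minimality of [k] gives this for positive [k]; for [k = 0] the bound by [tk N] does. *)
have rk : (r <= tk k)%R.
  have [k0|k0] := posnP k.
    by apply: le_trans (ltW rN) _; apply: tkle; rewrite k0.
  by rewrite leNgt; apply/negP => /ltW tr; have := kmin k.-1; rewrite prednK// => /(_ tr); rewrite leqNgt ltn_predL k0.
apply: (@le_trans _ _ (C%:E * ball_avg mu (fun y => `|f y - l|%:E) x (tk k))).
  apply: (ball_avg_compare mu_ball) => //.
  by apply: ball_subset; rewrite mdistxx add0r.
rewrite -lee_pdivlMl//; set a := fine (ball_avg mu (EFin \o f) x (tk k)).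
have fk := fi x _ (tk0 k).
apply: (@le_trans _ _ (ball_avg mu (fun y => `|f y - a|%:E + `|a - l|%:E) x (tk k))).
  apply: (le_ball_avg mu_ball) => // y _; rewrite -EFinD !lee_fin normr_ge0/=.
  by rewrite (_ : f y - l = (f y - a) + (a - l))%R ?ler_normD//; ring.
rewrite (ball_avgD bmu mu_ball)//; last exact: measurable_dist (measurable_int _ fk).
rewrite (ball_avg_cst bmu mu_ball)//.
apply: (@le_trans _ _ (e1%:E + e1%:E)); last first.
  rewrite -EFinD -EFinM (_ : e1 + e1 = C^-1 * e)%R//.
  by rewrite /e1; field; rewrite gt_eqF.
apply: leeD; first by apply: ltW; apply: oN => /=; apply: leq_trans Nk; exact: leq_maxl.
rewrite lee_fin distrC; apply: AN => /=; apply: leq_trans Nk; exact: leq_maxr.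
Unshelve. all: by end_near. Qed.

Lemma besov_trace : exists K : R, (0 < K)%R /\ forall f : X -> R, besov mu s p f ->
  exists phi : X -> R, is_trace mu theta E f phi /\
    'N[cara nu]_p%:E[EFin \o phi] <= K%:E * besov_norm mu s p f.
Proof.
have beta0 : (0 < beta)%R.
  by rewrite /beta divr_gt0 ?mulr_gt0 ?powR_gt0 ?mulr_gt0 ?exprn_gt0.
pose K0 := (c2 * ((4^-1) `^ theta)^-1)%R.
have K00 : (0 < K0)%R by rewrite mulr_gt0// invr_gt0 powR_gt0.
(* The first [C] passes from the ball of radius [tk k.+1] to the one of radius [tk k]; the rest
   comes from [mean_osc_transfer]. *)
pose D := (C * (2 * C ^+ 3))%R.
have D0 : (0 < D)%R by rewrite !mulr_gt0// exprn_gt0.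
pose a := ((K0 * C ^+ 6) `^ p^-1)%R.
have a0 : (0 < a)%R by rewrite powR_gt0// mulr_gt0// exprn_gt0.
exists (a + D / beta)%R; split; first by rewrite addr_gt0// divr_gt0.
move=> f [fL sf]; have fi := Lfun_loc_integrable fL.
move: (fL) => /andP[/[!inE]/= mf _].
have tkP k : (0 < tk k <= 4^-1)%R by rewrite tk0 tk4.
have /choice[Y YP] := fun k => mean_osc_transfer fi (tkP k).
have mY k : measurable_fun setT (Y k : caratheodory_type nu -> \bar R) by have [] := YP k.
have Y0 k x : 0 <= Y k x by have [_ + _ _] := YP k.
pose T := \sum_(0 <= k <oo) 'N[cara nu]_p%:E[Y k].
have TS : beta%:E * T <= besov_seminorm mu s p f.
  apply: sum_mean_osc_transfer => [k|k u uk]; first exact: Lnorm_ge0.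
  by have [_ _ _ +] := YP k; exact.
pose SY x := \sum_(0 <= k <oo) Y k x.
have SY0 x : 0 <= SY x by apply: nneseries_ge0.
have mSY : measurable_fun setT (SY : caratheodory_type nu -> \bar R).
  by apply: (@ge0_emeasurable_sum _ _ _ _ _ xpredT).
have NSY : 'N[cara nu]_p%:E[SY] <= T by exact: Lnorm_nneseries.
have Ty : T < +oo.
  rewrite -(@lte_pmul2l _ beta%:E)//; apply: le_lt_trans TS _.
  by rewrite gt0_muley ?lte_fin.
have aeSY : {ae cara nu, forall x, SY x < +oo}.
  by apply: (Lnorm_fin_ae p0) => //; exact: le_lt_trans Ty.
pose A k x := fine (ball_avg mu (EFin \o f) x (tk k)).
have mA k : measurable_fun setT (A k : caratheodory_type nu -> R).
  exact: (measurable_fine_ball_avg bmu bnu mu_ball).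
(* The upper limit is measurable on the whole space and agrees with the limit wherever the averages
   converge. *)
pose L x : \bar R := limn_esup (fun k => (A k x)%:E).
have mL : measurable_fun setT (L : caratheodory_type nu -> \bar R).
  by apply: measurable_fun_limn_esup => k; exact/measurable_EFinP.
pose phi := fine \o L.
have mphi : measurable_fun setT (phi : caratheodory_type nu -> R).
  exact: (@measurableT_comp _ _ _ _ _ _ (@fine R)).
have key x : E x -> SY x < +oo ->
    ball_avg mu (fun y => `|f y - phi x|%:E) x r @[r --> 0%R^'+] --> 0 /\
    `|phi x|%:E <= `|A 0%N x|%:E + D%:E * SY x.
  move=> Ex SYx.
  have [k|l [Al Yl lb]] := @cvg_increments _ (A^~ x) (Y^~ x) D (Y0^~ x) (ltW D0) SYx.
    have fk := fi x _ (tk0 k.+1).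
    apply: le_trans (ball_avg_dist bmu mu_ball (A k x) (tk0 _) fk) _.
    rewrite /D EFinM -muleA.
    have [_ _ + _] := YP k => /(_ _ Ex) oscY.
    apply: le_trans (lee_wpmul2l _ oscY); last by rewrite lee_fin ltW.
    apply: (ball_avg_compare mu_ball) => //.
      apply: ball_subset; rewrite mdistxx add0r [leRHS]tkS.
      by have := tk0 k.+1; lra.
    rewrite -[C]expr1; apply: (doubling_ball C0 dbl) => //; rewrite ?expr1 ?mdistxx.
      by have := tk4 k.+1; lra.
    by rewrite add0r tkS.
  have phil : phi x = l.
    have cA : (fun k => (A k x)%:E) @ \oo --> l%:E by exact: (cvg_comp _ _ Al).
    by rewrite /phi /= /L (cvg_limn_einf_sup cA).2.
  rewrite phil; split=> //; apply: mean_osc_cvg_trace => //.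
  apply: near_le_cvge0 => [k|e e0]; first exact: (mean_osc_ge0 mu_ball).
  have CC : (0 < 2 * C ^+ 3)%R by rewrite mulr_gt0// exprn_gt0.
  have e1 : (0 < (2 * C ^+ 3)^-1 * e)%R by rewrite mulr_gt0// invr_gt0.
  apply: filterS (cvge0_near_lt Yl e1) => k /ltW Yk.
  have [_ _ + _] := YP k => /(_ _ Ex) /le_trans; apply.
  by rewrite -lee_pdivlMl// -EFinM.
have istr : is_trace mu theta E f phi.
  split=> //; apply: (@filterS _ _ (ae_filter_ringOfSetsType (cara nu)) _ _ _ aeSY) => x SYx Ex.
  by have [] := key x Ex SYx.
exists phi; split=> //.
(* The coarsest average, at radius 1/4, is controlled by the L_p-norm of [f] through Jensen's
   inequality and [net_average]; the increments are controlled by the seminorm. *)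
pose g x : \bar R := (`|f x| `^ p)%:E.
have mg : measurable_fun setT (g : caratheodory_type mu -> \bar R).
  apply/measurable_EFinP; apply: (measurableT_comp (measurable_powR _)).
  exact: measurableT_comp.
have g0 x : 0 <= g x by rewrite lee_fin powR_ge0.
have t01 : (0 < tk 0 <= 1)%R by rewrite tk0/=; apply: le_trans (tk4 0) _; lra.
have [|H [mH H0 Hg iH]] := net_average bmu mu_ball sepX C0 dbl bnu t01 (ltW K00) (A := E) _ mg g0.
  move=> b Eb; apply: le_trans (nu_le Eb t01) _.
  rewrite /K0 EFinM -muleA [mu _ * _]muleC.
  by rewrite (_ : tk 0 = 4^-1)%R// /tk (_ : 4 = 2 ^+ 2)%R//; ring.
pose W x := H x `^ p^-1 + D%:E * SY x.
have mHp : measurable_fun setT ((fun x => H x `^ p^-1) : caratheodory_type nu -> \bar R).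
  exact: measurable_poweR_comp.
have mDS : measurable_fun setT ((fun x => D%:E * SY x) : caratheodory_type nu -> \bar R).
  exact: measurable_funeM.
apply: (@le_trans _ _ ('N[cara nu]_p%:E[W])).
  apply: (le_Lnorm_ae p0).
  - exact/measurable_EFinP.
  - exact: emeasurable_funD.
  apply: (@filterS2 _ _ (ae_filter_ringOfSetsType (cara nu)) _ _ _ _ nu_ae_mem aeSY) => x Ex SYx.
  have [_ /le_trans] := key x Ex SYx; rewrite /= [leRHS]gee0_abs; last first.
    by rewrite adde_ge0 ?poweR_ge0// mule_ge0// lee_fin ltW.
  apply; rewrite leeD2r//.
  have := ball_avg_dist bmu mu_ball 0%R (tk0 0) (fi x _ (tk0 0)).
  rewrite subr0 => /le_trans; apply.
  have -> : (fun y => `|f y - 0|%:E) = (fun y => `|f y|%:E) by apply/funext => y; rewrite subr0.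
  rewrite -[leLHS](@poweRKV _ _ p)//; last first.
    by apply: (ball_avg_ge0 mu_ball) => // y _; rewrite lee_fin.
  apply: lee_poweR => //; first exact: poweR_ge0.
  apply: le_trans (Hg x Ex); apply: (ball_avg_jensen bmu mu_ball) => //.
  exact: measurable_funTS.
have Hp0 x : 0 <= H x `^ p^-1 by exact: poweR_ge0.
have DS0 x : 0 <= D%:E * SY x by rewrite mule_ge0// lee_fin ltW.
apply: (le_trans (ge0_minkowski (cara nu) p1 mHp mDS Hp0 DS0)).
rewrite Lnorm_root// Lnorm_scale ?(ltW D0)//.
have sem0 : 0 <= besov_seminorm mu s p f.
  apply: le_trans TS; rewrite mule_ge0 ?lee_fin ?(ltW beta0)//.
  by apply: nneseries_ge0 => k _ _; exact: Lnorm_ge0.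
have -> : (a + D / beta)%:E * besov_norm mu s p f =
    a%:E * besov_norm mu s p f + (D / beta)%:E * besov_norm mu s p f.
  rewrite EFinD ge0_muleDl//; first by rewrite lee_fin ltW.
  by rewrite lee_fin; apply: divr_ge0; exact: ltW.
apply: leeD.
  apply: (@le_trans _ _ (a%:E * 'N[m]_p%:E[EFin \o f])); last first.
    by apply: lee_wpmul2l; rewrite ?lee_fin ?(ltW a0)// leeDl.
  rewrite unlock/= /a -poweR_EFin -poweRM; last 2 first.
  - by rewrite lee_fin mulr_ge0 ?exprn_ge0// ltW.
  - by apply: integral_ge0.
  by apply: (lee_poweR pV0 _ iH); apply: integral_ge0.
rewrite [(D / beta)%:E]EFinM -[leRHS]muleA.
apply: lee_wpmul2l; first by rewrite lee_fin ltW.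
apply: le_trans NSY _; rewrite lee_pdivlMl//; apply: le_trans TS _.
by rewrite leeDr// Lnorm_ge0.
Qed.

End trace.

(** * Density of Lipschitz functions *)

Import HBSimple HBNNSimple.

(** Dominated convergence for the p-th powers, with the power of [g] as integrable bound. *)
Lemma Lnorm_dominated d (T : measurableType d) (R : realType)
    (m : {measure set T -> \bar R}) (p : R) (D : (T -> R)^nat) (g : T -> R) :
  0 < p -> (forall n, measurable_fun setT (D n)) -> measurable_fun setT g ->
  ('N[m]_p%:E[EFin \o g] < +oo)%E -> (forall n x, `|D n x| <= g x) ->
  (forall x e, 0 < e -> \forall n \near \oo, `|D n x| <= e) ->
  forall e, 0 < e -> exists n, ('N[m]_p%:E[EFin \o D n] <= e%:E)%E.
Proof.
move=> p0 mD mg gy Dg D0 e e0; have pV0 : 0 <= p^-1 by rewrite invr_ge0 ltW.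
have mp (f : T -> R) : measurable_fun setT f ->
    measurable_fun setT (fun x => (`|f x| `^ p)%:E).
  move=> mf; apply/measurable_EFinP.
  by apply: (measurableT_comp (measurable_powR _)); exact: measurableT_comp.
have g0 x : 0 <= g x by exact: le_trans (Dg 0%N x).
have ig : m.-integrable setT (fun x => (`|g x| `^ p)%:E).
  apply/integrableP; split; first exact: mp.
  under eq_integral do rewrite gee0_abs ?lee_fin ?powR_ge0//.
  move: gy; rewrite unlock /=; under eq_integral do rewrite ?abse_EFin ?poweR_EFin.
  apply: contraTT; rewrite -!leNgt !leye_eq => /eqP ->.
  by rewrite poweRyr// invr_eq0 gt_eqF.
have [|||_ /= cv _] := @dominated_convergence _ _ _ m setT measurableT
    (fun n x => (`|D n x| `^ p)%:E) (cst 0%E) _ (fun n => mp _ (mD n)) _ _ ig.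
- exact: measurable_cst.
- apply: aeW => x _; apply: near_le_cvge0 => [n|a a0]; first by rewrite lee_fin powR_ge0.
  have ap : 0 < a `^ p^-1 by rewrite powR_gt0.
  apply: filterS (D0 x _ ap) => n Dn; rewrite lee_fin.
  rewrite -[leRHS]powRr1 ?(ltW a0)// -[X in _ <= _ `^ X](@mulVf _ p) ?gt_eqF//.
  by rewrite powRrM ge0_ler_powR ?nnegrE ?powR_ge0// ltW.
- apply: aeW => x n _; rewrite gee0_abs ?lee_fin ?powR_ge0//.
  rewrite ge0_ler_powR ?nnegrE// ?(ltW p0)//.
  by rewrite [leRHS]ger0_norm.
have ep : 0 < e `^ p by rewrite powR_gt0.
have [n _ /(_ n (leqnn n))/= ne] := cvge0_near_lt cv ep.
exists n; rewrite unlock/= -[e%:E](@poweRKV _ _ p)//; last by rewrite lee_fin ltW.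
apply: lee_poweR => //; first by apply: integral_ge0.
rewrite poweR_EFin; apply: le_trans (ltW ne).
by apply: le_integral_lower => // x; rewrite subr0 lee_fin ler_norm.
Qed.

Lemma Lnorm_indic d (T : measurableType d) (R : realType)
    (m : {measure set T -> \bar R}) (p : R) (A : set T) : 0 < p ->
  measurable A -> ('N[m]_p%:E[(fun x => (\1_A x)%:E)] = m A `^ p^-1)%E.
Proof.
move=> p0 mA; rewrite Lnorm_ge0E//; congr (_ `^ _)%E.
rewrite (eq_integral (fun x => (\1_A x)%:E)) ?integral_indic ?setIT// => x _.
by rewrite indicE; case: (_ \in _); rewrite ?poweR1r// poweR0r// gt_eqF.
Qed.

Section lipschitz_density.
Context (R : realType) (X : completeMetricType R).
Variable nu : {outer_measure set X -> \bar R}.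
Hypothesis bnu : <<s @open X >> `<=` nu.-caratheodory.
Variables (p : R) (x0 : X).
Hypothesis p1 : 1 <= p.
Hypothesis nu_ball : forall r : R, (nu (ball x0 r) < +oo)%E.
Hypothesis nu_regular : forall A : set X,
  exists B, [/\ <<s @open X >> B, nu (A `\` B) = 0%E & nu B = nu A].
Local Open Scope ereal_scope.
Local Notation T := (caratheodory_type nu).
Local Notation n_ := (cara nu).
Local Notation N f := ('N[cara nu]_p%:E[EFin \o f]).

Let p0 : (0 < p)%R. Proof. exact: lt_le_trans p1. Qed.

Definition lip_bsupp (G : X -> R) : Prop :=
  lipschitz_fun G /\ exists r : R, forall x, (r <= mdist x0 x)%R -> G x = 0%R.

Lemma lip_bsuppD (F G : X -> R) : lip_bsupp F -> lip_bsupp G ->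
  lip_bsupp (F \+ G)%R.
Proof.
move=> [[L FL] [r Fr]] [[M GM] [t Gt]]; split.
  exists (L + M)%R => x y; rewrite /= opprD addrACA mulrDl.
  by apply: le_trans (ler_normD _ _) _; exact: lerD.
exists (Num.max r t) => x; rewrite ge_max => /andP[rx tx].
by rewrite /= Fr// Gt// addr0.
Qed.

Lemma lip_bsuppZ (c : R) (F : X -> R) : lip_bsupp F ->
  lip_bsupp (fun x => c * F x)%R.
Proof.
move=> [[L FL] [r Fr]]; split; last by exists r => x /Fr ->; rewrite mulr0.
exists (`|c| * L)%R => x y.
by rewrite -mulrBr normrM -mulrA; exact: ler_wpM2l.
Qed.

Lemma lip_bsupp0 : lip_bsupp (cst 0%R).
Proof.
split; last by exists 0%R.
by exists 0%R => x y /=; rewrite subrr normr0 mul0r.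
Qed.

Definition lip_limit (f : X -> R) : Prop :=
  measurable_fun setT (f : T -> R) /\
  forall e : R, (0 < e)%R -> exists2 G, lip_bsupp G & N (f \- G)%R <= e%:E.

Lemma lip_limit_lim (f : X -> R) : measurable_fun setT (f : T -> R) ->
  (forall e : R, (0 < e)%R -> exists2 g, lip_limit g & N (f \- g)%R <= e%:E) ->
  lip_limit f.
Proof.
move=> mf fe; split=> // e e0; have e20 : (0 < e / 2)%R by rewrite divr_gt0.
have [g [mg ge] fg] := fe _ e20; have [G lG gG] := ge _ e20.
exists G => //; have mG := lip_measurable_cara bnu lG.1.
have -> : (f \- G)%R = ((f \- g) \+ (g \- G))%R.
  by apply/funext => x /=; rewrite addrA subrK.
apply: le_trans (minkowski_EFin _ _ _ p1) _; try exact: measurable_funB.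
by rewrite [e%:E](_ : _ = (e / 2)%:E + (e / 2)%:E) ?leeD// -EFinD -splitr.
Qed.

Lemma lip_limitD (f g : X -> R) : lip_limit f -> lip_limit g ->
  lip_limit (f \+ g)%R.
Proof.
move=> [mf fe] [mg ge]; split=> [|e e0]; first exact: measurable_funD.
have e20 : (0 < e / 2)%R by rewrite divr_gt0.
have [F lF fF] := fe _ e20; have [G lG gG] := ge _ e20.
have mF := lip_measurable_cara bnu lF.1; have mG := lip_measurable_cara bnu lG.1.
exists (F \+ G)%R; first exact: lip_bsuppD.
have -> : ((f \+ g) \- (F \+ G))%R = ((f \- F) \+ (g \- G))%R.
  by apply/funext => x /=; rewrite opprD addrACA.
apply: le_trans (minkowski_EFin _ _ _ p1) _; try exact: measurable_funB.
by rewrite [e%:E](_ : _ = (e / 2)%:E + (e / 2)%:E) ?leeD// -EFinD -splitr.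
Qed.

Lemma lip_limitZ (c : R) (f : X -> R) : lip_limit f ->
  lip_limit (fun x => c * f x)%R.
Proof.
move=> [mf fe]; split=> [|e e0]; first exact: measurable_funM.
have c0 : (0 < `|c| + 1)%R by rewrite ltr_wpDl.
have ec : (0 < e / (`|c| + 1))%R by rewrite divr_gt0.
have [G lG fG] := fe _ ec; exists (fun x => c * G x)%R; first exact: lip_bsuppZ.
have mG := lip_measurable_cara bnu lG.1.
apply: (@le_trans _ _ ('N[n_]_p%:E[(fun x => (`|c| + 1)%:E * `|f x - G x|%:E)])).
  apply: le_Lnorm => // x; rewrite /= -mulrBr normrM lee_fin normrM.
  by rewrite ler_pM// ?normr_id// [leRHS]ger0_norm ?lerDl// ltW.
rewrite (@Lnorm_scale _ _ _ n_ _ p0) ?(ltW c0)//; last first.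
  by apply/measurable_EFinP; apply: measurableT_comp => //; exact: measurable_funB.
rewrite -lee_pdivlMl// -EFinM mulrC; apply: le_trans fG.
by apply: le_Lnorm => // x; rewrite /= normr_id.
Qed.

Lemma lip_limit_sum (I : Type) (s : seq I) (f : I -> X -> R) :
  (forall i, lip_limit (f i)) -> lip_limit (fun x => \sum_(i <- s) f i x)%R.
Proof.
move=> lf; elim: s => [|i s IH].
  rewrite (_ : (fun _ => _) = cst 0%R); last by apply/funext => x; rewrite big_nil.
  split=> [|e e0]; first exact: measurable_cst.
  exists (cst 0%R); first exact: lip_bsupp0.
  rewrite (_ : EFin \o _ = cst 0); last by apply/funext => x /=; rewrite subrr.
  by rewrite Lnorm0 ?lee_fin ?(ltW e0)// gt_eqF.
rewrite (_ : (fun _ => _) = (f i \+ (fun x => \sum_(i <- s) f i x))%R).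
  exact: lip_limitD.
by apply/funext => x; rewrite big_cons.
Qed.

Lemma lip_limit_dominated (f : X -> R) (h : (X -> R)^nat) (g : X -> R) :
  measurable_fun setT (f : T -> R) -> measurable_fun setT (g : T -> R) ->
  (forall n, lip_limit (h n)) -> N g < +oo ->
  (forall n x, (`|f x - h n x| <= g x)%R) ->
  (forall x (e : R), (0 < e)%R -> \forall n \near \oo, (`|f x - h n x| <= e)%R) ->
  lip_limit f.
Proof.
move=> mf mg lh gy fg f0; apply: lip_limit_lim => // e e0.
have mD n : measurable_fun setT ((fun x => f x - h n x)%R : T -> R).
  by apply: measurable_funB => //; have [] := lh n.
have [n fn] := Lnorm_dominated p0 mD mg gy fg f0 e0.
by exists (h n).
Qed.

Section set_approximation.
Variable n : nat.
Local Notation U := (ball x0 n%:R : set X).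

Let mU : measurable (U : set T). Proof. exact: ball_measurable_cara. Qed.

Let N1U : N (\1_U : X -> R) < +oo.
Proof.
rewrite (@Lnorm_indic _ _ _ n_ _ _ p0 mU); apply: poweR_lty; exact: nu_ball.
Qed.

(** The functions [G k] vanish off [V] and equal 1 at distance at least 1/(k+1) from its complement,
    so they converge to the indicator of [V], dominated by that of [U]. *)
Lemma lip_limit_open (A : set X) : open A -> lip_limit (\1_(A `&` U) : X -> R).
Proof.
move=> oA; set V := A `&` U; have oV : open V by apply: openI => //; exact: mball_open.
have mV : measurable (V : set T) by exact: open_measurable_cara.
pose G k x := (1 - tent k.+1%:R^-1 (~` V) x)%R.
have k0 k : (0 < k.+1%:R^-1 :> R)%R by rewrite invr_gt0.
have G0 k x : ~ V x -> G k x = 0%R by move=> Vx; rewrite /G tent_in// subrr.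
have lG k : lip_bsupp (G k).
  split.
    exists (k.+1%:R)%R => x y; rewrite /G opprB addrC addrA subrK distrC mulrC.
    by have := tent_lip (~` V) (k0 k) x y; rewrite invrK.
  exists n%:R => x nx; apply: G0 => -[_ /ballP]; by rewrite ltNge nx.
have limG k : lip_limit (G k).
  split=> [|e e0]; first exact: (lip_measurable_cara bnu (lG k).1).
  exists (G k) => //.
  rewrite (_ : EFin \o _ = cst 0); last by apply/funext => x /=; rewrite subrr.
  by rewrite Lnorm0 ?lee_fin ?(ltW e0)// gt_eqF.
apply: (@lip_limit_dominated _ G (\1_U)) => //; try exact: N1U.
- move=> k x; have [Vx|Vx] := pselect (V x); last first.
    by rewrite G0// indicE memNset// subrr normr0 indicE.
  rewrite !indicE (mem_set Vx) (mem_set Vx.2) /G opprB addrC subrK.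
  by rewrite ger0_norm ?tent_ge0// tent_le1.
- move=> x e e0; have [Vx|Vx] := pselect (V x); last first.
    by apply: nearW => k; rewrite G0// indicE memNset// subrr normr0 ltW.
  have /nbhs_ballP[d /= d0 dV] : nbhs x V by rewrite nbhsE; exists V.
  have := near_infty_natSinv_lt (PosNum d0).
  apply: filterS => k /= kd; rewrite indicE (mem_set Vx) /G tent_far ?subr0 ?subrr ?normr0 ?ltW//.
  move=> a; apply: contra_notP => /negP; rewrite -ltNge => xa.
  by apply: dV; apply/ballP; exact: lt_trans kd.
Qed.

(** Open sets form a pi-system, and the sets with this property a lambda-system: proper differences
    by linearity, increasing unions by domination. Cutting with [U] supplies the dominating function
    of finite norm. *)
Lemma lip_limit_borel : <<s @open X >> `<=`
  [set A : set X | lip_limit (\1_(A `&` U) : X -> R)].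
Proof.
apply: (@lambda_system_subset _ (@open X) _ setT
  [set A | lip_limit (\1_(A `&` U) : X -> R)]) => //.
- by move=> ? ?; exact: openI.
- split=> //.
  + by apply: lip_limit_open; exact: openT.
  + move=> A B BA /= lA lB.
    have -> : (\1_((A `\` B) `&` U) : X -> R) =
        (\1_(A `&` U) \+ (fun x => (-1) * \1_(B `&` U) x))%R.
      apply/funext => x /=; rewrite mulN1r.
      have [Ux|Ux] := pselect (U x); last first.
        by rewrite !indicE !memNset ?subrr// => -[].
      have [Bx|Bx] := pselect (B x).
        rewrite !indicE (mem_set (conj Bx Ux : (B `&` U) x)).
        rewrite (mem_set (conj (BA _ Bx) Ux : (A `&` U) x)) subrr memNset//.
        by case=> -[].
      rewrite !indicE (@memNset _ (B `&` U)) ?subr0; last by case.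
      by congr (_ _)%:R; apply/asboolP/asboolP => [[[]]|[]].
    by apply: lip_limitD => //; exact: lip_limitZ.
  + move=> F ndF lF /=.
    have mF k : measurable (F k `&` U : set T).
      have := (lF k).1 measurableT _ (@measurable_set1 _ 1%R).
      rewrite setTI (_ : _ @^-1` _ = F k `&` U)//.
      apply/seteqP; split=> x /=; rewrite indicE; last by move=> Fx; rewrite mem_set.
      by case: (boolP (x \in _)) => [/set_mem//|_ /eqP]; rewrite eq_sym oner_eq0.
    have mFU : measurable ((\bigcup_k F k) `&` U : set T).
      by rewrite setI_bigcupl; exact: bigcup_measurable.
    apply: (@lip_limit_dominated _ (fun k => \1_(F k `&` U)) (\1_U)) => //; try exact: N1U.
    * move=> k x; rewrite !indicE.
      have [Ux|Ux] := pselect (U x); last first.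
        by rewrite !memNset ?subrr ?normr0// => -[].
      rewrite (mem_set Ux).
      by do 2 case: (_ \in _); rewrite ?subrr ?subr0 ?sub0r ?normrN ?normr0 ?normr1.
    * move=> x e e0; have [[[k _ Fk] Ux]|nF] := pselect (((\bigcup_k F k) `&` U) x).
        exists k => // j /= kj; have Fj : F j x by have /subsetPset := ndF _ _ kj; exact.
        rewrite !indicE !mem_set//; first by rewrite subrr normr0 ltW.
        by split=> //; exists k.
      apply: nearW => k; rewrite !indicE !memNset ?subrr ?normr0 ?ltW//.
      by move=> [Fk Ux]; apply: nF; split=> //; exists k.
- by move=> ? oA; exact: lip_limit_open.
Qed.

(** [A] cut by [U] has finite measure, so it differs from its Borel hull [B] by a null set, and
    approximations of one indicator approximate the other. *)
Lemma lip_limit_measurable (A : set X) : measurable (A : set T) ->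
  lip_limit (\1_(A `&` U) : X -> R).
Proof.
move=> mA; have mAU : measurable (A `&` U : set T) by exact: measurableI.
have [B [bB AB BA]] := nu_regular (A `&` U).
have mB : measurable (B : set T) by exact: bnu.
have [mBU lB] := lip_limit_borel bB.
have null : n_ (((A `&` U) `\` B) `|` (B `\` (A `&` U))) = 0.
  apply/eqP; rewrite -measure_le0; apply: le_trans (measureU2 _ _ _) _.
  - exact: measurableD.
  - exact: measurableD.
  rewrite [X in X + _](_ : _ = 0)// add0e.
  have fin : n_ (A `&` U) < +oo.
    by apply: le_lt_trans (nu_ball n%:R); apply: le_outer_measure => x [].
  have AUB : n_ ((A `&` U) `&` B) = n_ (A `&` U).
    have := measureDI n_ mAU mB; rewrite [X in _ = X + _](_ : _ = 0)// add0e.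
    by move=> ->.
  rewrite measureD//; last by rewrite [X in X < _]BA.
  rewrite [X in _ - X](_ : _ = nu (A `&` U)); last by rewrite -[RHS]AUB setIC.
  by rewrite [X in X - _]BA subee// ge0_fin_numE.
split=> [|e e0]; first exact: measurable_indic.
have [G lG BG] := lB _ e0; exists G => //; apply: le_trans BG.
have mG := lip_measurable_cara bnu lG.1.
rewrite le_eqVlt; apply/orP; left; apply/eqP; apply: eq_Lnorm_ae => //.
- by apply/measurable_EFinP; apply: measurable_funB => //; exact: measurable_indic.
- by apply/measurable_EFinP; apply: measurable_funB.
exists (((A `&` U) `\` B) `|` (B `\` (A `&` U))); split=> //.
  by apply: measurableU; exact: measurableD.
move=> x /=; apply: contra_notP => /not_orP[h1 h2].
congr (_ - _)%:E; rewrite !indicE; congr (_ _)%:R; apply/asboolP/asboolP.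
  move=> AUx; split; last exact: AUx.2.
  by apply: contrapT => Bx; apply: h1.
move=> [Bx Ux]; split=> //; have [//|nA] := pselect (A x).
by exfalso; apply: h2; split=> // -[].
Qed.

End set_approximation.

(** For nonnegative functions, simple approximations cut to growing balls converge under domination,
    and each is a finite combination of indicators of level sets inside a ball. Positive and
    negative parts give the general case. *)
Lemma lip_bsupp_dense (f : X -> R) : (f : T -> R) \in Lfun n_ p%:E ->
  forall e : R, (0 < e)%R -> exists2 G, lip_bsupp G & N (f \- G)%R <= e%:E.
Proof.
have pos (g : X -> R) : measurable_fun setT (g : T -> R) ->
    (forall x, (0 <= g x)%R) -> N g < +oo -> lip_limit g.
  move=> mg g0 gy.
  have mEg : measurable_fun setT ((EFin \o g) : T -> \bar R) by exact/measurable_EFinP.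
  pose hs k : {nnsfun T >-> R} := @nnsfun_approx _ T _ setT measurableT _ mEg k.
  pose h k (x : X) : R := hs k (x : T).
  pose U k := ball x0 k%:R.
  have mU k : measurable (U k : set T) by exact: ball_measurable_cara.
  have hg k x : (h k x <= g x)%R.
    by rewrite /h /hs nnsfun_approxE -lee_fin; exact: (@le_approx _ T _ setT (EFin \o g) k x (fun _ _ => g0 _) I).
  have hE k x : (h k x * \1_(U k) x =
      \sum_(y <- finmap.enum_fset (fset_set (range (hs k))))
        y * \1_(hs k @^-1` [set y] `&` U k) x)%R.
    rewrite /h fimfunE fsbig_finite ?mulr_suml//=.
    by apply: eq_bigr => y _; rewrite -mulrA indicI.
  apply: (@lip_limit_dominated _ (fun k x => h k x * \1_(U k) x)%R g) => //.
  - move=> k; rewrite (_ : (fun _ => _) = (fun x =>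
        \sum_(y <- finmap.enum_fset (fset_set (range (hs k))))
        y * \1_(hs k @^-1` [set y] `&` U k) x)%R); last by apply/funext => x.
    by apply: lip_limit_sum => y; apply: lip_limitZ; exact: lip_limit_measurable.
  - move=> k x; rewrite indicE; case: (_ \in _); last first.
      by rewrite mulr0 subr0 ger0_norm.
    by rewrite mulr1 ger0_norm ?subr_ge0// lerBlDr lerDl.
  - move=> x e e0.
    have hx : (h k x)%:E @[k --> \oo] --> (g x)%:E.
      exact: (@cvg_nnsfun_approx _ T _ setT measurableT _ mEg (fun y _ => g0 y) x I).
    have {}hx : h k x @[k --> \oo] --> g x by have /fine_cvgP[_ +] := hx; exact.
    have [r xr] : exists k, (mdist x0 x < k%:R)%R.
      by exists (Num.bound (mdist x0 x)); exact/archi_boundP/mdist_ge0.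
    near=> k; rewrite indicE mem_set ?mulr1.
      by near: k; move/cvgrPdist_le : hx; exact.
    apply/ballP; apply: lt_le_trans xr _; rewrite ler_nat; near: k.
    exact: nbhs_infty_ge.
move=> /andP[/[!inE]/= mf fy] e e0.
have pp := @pos (fun x => Num.max (f x) 0)%R.
have pn := @pos (fun x => Num.max (- f x) 0)%R.
have lf : lip_limit f.
  rewrite (_ : f = ((fun x => Num.max (f x) 0) \+ (fun x => -1 * Num.max (- f x) 0))%R).
    apply: lip_limitD; [apply: pp|apply: lip_limitZ; apply: pn].
    - by apply: measurable_maxr.
    - by move=> x; rewrite le_max lexx orbT.
    - apply: le_lt_trans fy; apply: le_Lnorm => // x; rewrite lee_fin.
      by rewrite [leLHS]ger0_norm ?le_max ?lexx ?orbT// ge_max ler_norm normr_ge0.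
    - by apply: measurable_maxr => //; exact: measurable_funN.
    - by move=> x; rewrite le_max lexx orbT.
    - apply: le_lt_trans fy; apply: le_Lnorm => // x; rewrite lee_fin.
      rewrite [leLHS]ger0_norm ?le_max ?lexx ?orbT// ge_max normr_ge0 andbT.
      by rewrite -normrN ler_norm.
  apply/funext => x /=; rewrite mulN1r.
  by have [f0|f0] := leP 0%R (f x); rewrite ?oppr_le0 ?oppr_ge0; case: (leP 0%R (- f x)%R) => ?; lra.
exact: lf.2.
Unshelve. all: by end_near. Qed.

End lipschitz_density.

(** * Power integrals over the scales *)

Section powR_integrals.
Context (R : realType).
Local Open Scope ereal_scope.
Local Notation leb := (@lebesgue_measure R).

Lemma integral_powR (a x y : R) : a != 0%R -> (0 < x)%R -> (x < y)%R ->
  \int[leb]_(t in `[x, y]) (t `^ (a - 1))%:E = ((y `^ a - x `^ a) / a)%:E.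
Proof.
move=> a0 x0 xy.
have der (t : R) : (0 < t)%R -> is_derive t (1%R : R) (fun t : R => t `^ a / a)%R (t `^ (a - 1))%R.
  move=> t0; rewrite (_ : (fun t => _) = (a^-1 *: (@powR R ^~ a))%R); last first.
    by apply/funext => u /=; rewrite mulrC.
  apply: is_derive_eq; first exact: (is_deriveZ _ (is_derive1_powR a t0)).
  by rewrite scalerA mulVf// scale1r.
have cpow (b t : R) : (0 < t)%R -> {for t, continuous (@powR R ^~ b)}.
  move=> t0; apply: differentiable_continuous; apply/derivable1_diffP.
  by apply: derivable_powR; rewrite in_itv/= t0.
have ca (t : R) : (0 < t)%R -> {for t, continuous (fun t : R => t `^ a / a)%R}.
  by move=> t0; apply: continuousM; [exact: cpow|exact: cvg_cst].
have x0y t : (x <= t)%R -> (0 < t)%R by exact: lt_le_trans.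
rewrite (@continuous_FTC2 _ _ (fun t => t `^ a / a)%R)//.
- by rewrite -EFinB mulrBl.
- apply: continuous_in_subspaceT => t; rewrite inE/= in_itv/= => /andP[xt _].
  exact/cpow/x0y.
- split.
  + move=> t; rewrite in_itv/= => /andP[xt _].
    by apply: ex_derive; apply: der; exact: lt_trans xt.
  + by apply: cvg_at_right_filter; exact: ca.
  + by apply: cvg_at_left_filter; apply: ca; exact: lt_trans xy.
- move=> t; rewrite in_itv/= => /andP[xt _]; rewrite derive1E.
  by have [_ ->] := der _ (lt_trans x0 xt).
Qed.

(** Because of the singularity at 0, the interval is exhausted by those from y/(n+2) to y; starting
    at 2 keeps them nondegenerate, as [integral_powR] demands. *)
Lemma integral_powR0 (s y : R) : (s < 1)%R -> (0 < y)%R ->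
  \int[leb]_(t in `]0%R, y]) (t `^ (- s))%:E <= (y `^ (1 - s) / (1 - s))%:E.
Proof.
move=> s1 y0; have s10 : (0 < 1 - s)%R by rewrite subr_gt0.
pose S (n : nat) : set R := `[(y / n.+2%:R)%R, y]%classic.
have nS : (0 < y / _.+2%:R :> R)%R by move=> n; rewrite divr_gt0.
have SE : `]0%R, y]%classic = \bigcup_n S n.
  apply/seteqP; split=> t /=; rewrite in_itv/=.
    move=> /andP[t0 ty].
    have [n nt] := ex_natSinv_lt (divr_gt0 t0 y0).
    exists n => //; rewrite /S/= in_itv/= ty andbT.
    rewrite mulrC -ler_pdivlMr//; apply: le_trans (ltW nt).
    by rewrite lef_pV2 ?posrE// ler_nat.
  move=> [n _]; rewrite /S/= in_itv/= => /andP[nt ->]; rewrite andbT.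
  exact: lt_le_trans nt.
have mpow A : measurable_fun A (fun t : R => (t `^ (- s))%:E).
  by apply/measurable_funTS/measurable_EFinP; exact: measurable_powR.
have pow0 (t : R) : 0 <= (t `^ (- s))%:E by rewrite lee_fin powR_ge0.
rewrite SE; have /cvg_lim <- // : \int[leb]_(t in S n) (t `^ (- s))%:E @[n --> \oo] -->
    \int[leb]_(t in \bigcup_n S n) (t `^ (- s))%:E.
  apply: ge0_nondecreasing_set_cvg_integral => //.
  - move=> m n mn; apply/subsetPset => t; rewrite /S/= !in_itv/= => /andP[+ ->].
    rewrite andbT; apply: le_trans.
    by rewrite ler_pM2l// lef_pV2 ?posrE// ler_nat.
  - by move=> n; exact: measurable_itv.
  - by move=> n; exact: mpow.
apply: lime_le.
  apply: ereal_nondecreasing_is_cvgn => m n mn; apply: ge0_subset_integral => //; try exact: measurable_itv; first exact: mpow.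
  move=> t; rewrite /S/= !in_itv/= => /andP[+ ->]; rewrite andbT; apply: le_trans.
  by rewrite ler_pM2l// lef_pV2 ?posrE// ler_nat.
apply: nearW => n; have := @integral_powR (1 - s) (y / n.+2%:R) y.
rewrite addrAC subrr add0r => -> //; last 2 first.
- by rewrite gt_eqF.
- by rewrite ltr_pdivrMr// ltr_pMr// ltr1n.
by rewrite lee_fin ler_pM2r ?invr_gt0// gerBl powR_ge0.
Qed.

Lemma integral_powR1 (s x : R) : (0 < s)%R -> (0 < x < 1)%R ->
  \int[leb]_(t in `[x, 1%R]) (t `^ (- s - 1))%:E <= (x `^ (- s) / s)%:E.
Proof.
move=> s0 /andP[x0 x1]; rewrite integral_powR ?oppr_eq0 ?gt_eqF// powR1 lee_fin.
by rewrite invrN mulrN -mulNr opprB ler_pM2r ?invr_gt0// gerBl.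
Qed.

(** Splitting at [r], the powers of [r] cancel in both halves. Below [r] the integral converges
    because s < 1 and gives [(1 - s)^-1]; above [r] it is at most [s^-1]. *)
Lemma integral_min_powR (s r : R) : (0 < s < 1)%R -> (0 < r < 1)%R ->
  \int[leb]_(t in `]0%R, 1%R[) (r `^ s * Num.min (t / r) 1 * t `^ (- s - 1))%:E <=
    ((1 - s)^-1 + s^-1)%:E.
Proof.
move=> /andP[s0 s1] /andP[r0 r1]; pose w (t : R) := (r `^ s * Num.min (t / r) 1 * t `^ (- s - 1))%:E.
have powR1B (x b : R) : (0 < x)%R -> (x `^ (b - 1) = x `^ b / x)%R.
  by move=> x0; rewrite powRB ?(gt_eqF x0) ?implybT// powRr1 ?(ltW x0).
have mpow (k b : R) A : measurable_fun A (fun t : R => (k * t `^ b)%:E).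
  apply/measurable_funTS/measurable_EFinP; exact: measurable_funM.
have w0 t : 0 <= w t \/ (t <= 0)%R.
  have [t0|t0] := leP t 0%R; [by right|left].
  by rewrite /w lee_fin !mulr_ge0 ?powR_ge0// le_min ler01 divr_ge0// ltW.
pose f t := if (t <= r)%R then (r `^ (s - 1) * t `^ (- s))%:E
  else (r `^ s * t `^ (- s - 1))%:E.
have f0 t : 0 <= f t.
  by rewrite /f; case: ifP => _; rewrite lee_fin mulr_ge0 ?powR_ge0.
have mf : measurable_fun setT f.
  by apply: measurable_fun_ifT => //; exact: measurable_fun_ler.
apply: (@le_trans _ _ (\int[leb]_(t in `]0%R, r] `|` `]r, 1%R]) f t)).
  rewrite integral_mkcond [leRHS]integral_mkcond.
  apply: le_integral_lower => t; rewrite !patchE.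
    by case: ifPn => // /set_mem/=; rewrite in_itv/= => /andP[t0 _]; case: (w0 t) => //; rewrite leNgt t0.
  case: ifPn => [/set_mem/=|_]; last by case: ifPn.
  rewrite in_itv/= => /andP[t0 t1]; rewrite mem_set; last first.
    by rewrite /= !in_itv/= t0 (ltW t1) andbT; apply/orP; case: (leP t r) => //= /ltW.
  rewrite /f; case: (leP t r) => tr; rewrite lee_fin.
    apply: (@le_trans _ _ (r `^ s * (t / r) * t `^ (- s - 1))%R).
      by rewrite ler_wpM2r ?powR_ge0// ler_wpM2l ?powR_ge0// ge_min lexx.
    rewrite !powR1B//.
    by rewrite le_eqVlt; apply/orP; left; apply/eqP; field; rewrite !gt_eqF.
  rewrite ler_wpM2r ?powR_ge0// -[leRHS]mulr1 ler_wpM2l ?powR_ge0//.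
  by rewrite ge_min lexx orbT.
rewrite ge0_integral_setU//; last 2 first.
- exact: measurable_funTS.
- by apply/disj_setPS => t [] /=; rewrite !in_itv/= => /andP[_ tr] /andP[]; rewrite ltNge tr.
apply: (@le_trans _ _ ((r `^ (s - 1))%:E * \int[leb]_(t in `]0%R, r]) (t `^ (- s))%:E
  + (r `^ s)%:E * \int[leb]_(t in `[r, 1%R]) (t `^ (- s - 1))%:E)).
  have mpow1 (b : R) A : measurable_fun A (fun t : R => (t `^ b)%:E).
    by apply/measurable_funTS/measurable_EFinP; exact: measurable_powR.
  rewrite -!ge0_integralZl ?lee_fin ?powR_ge0//; try by [move=> t _; rewrite lee_fin powR_ge0|exact: mpow1].
  apply: leeD.
    rewrite le_eqVlt; apply/orP; left; apply/eqP; apply: eq_integral => t.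
    by rewrite inE/= in_itv/= => /andP[_ tr]; rewrite /f tr.
  rewrite integral_mkcond [leRHS]integral_mkcond; apply: le_integral_lower => t; rewrite !patchE.
    by case: ifPn.
  case: ifPn => [/set_mem/=|_]; last by case: ifPn => // _; rewrite lee_fin mulr_ge0 ?powR_ge0.
  rewrite in_itv/= => /andP[rt t1]; rewrite mem_set; last by rewrite /= in_itv/= (ltW rt).
  by rewrite /f (lt_geF rt).
rewrite EFinD; apply: leeD.
  apply: le_trans (lee_wpmul2l _ (integral_powR0 s1 r0)) _; first by rewrite lee_fin powR_ge0.
  rewrite -EFinM lee_fin mulrA -powRD ?(gt_eqF r0) ?implybT//.
  by rewrite (_ : s - 1 + (1 - s) = 0)%R ?powRr0 ?mul1r//; ring.
apply: le_trans (lee_wpmul2l _ (integral_powR1 s0 _)) _; first by rewrite lee_fin powR_ge0.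
  by rewrite r0.
by rewrite -EFinM lee_fin mulrA -powRD ?(gt_eqF r0) ?implybT// subrr powRr0 mul1r.
Qed.

End powR_integrals.

(** * Extension of Lipschitz functions *)

Section cutoff.
Context (R : realType) (X : completeMetricType R).
Variables (G : X -> R) (E : set X) (L rho r : R) (x0 : X).
Hypotheses (L0 : 0 <= L) (r0 : 0 < r).
Hypothesis GL : forall x y, `|G x - G y| <= L * mdist x y.
Hypothesis Grho : forall x, rho <= mdist x0 x -> G x = 0.

Definition cutoff x : R := G x * tent r E x.

Lemma cutoff_in x : E x -> cutoff x = G x.
Proof. by move=> Ex; rewrite /cutoff tent_in// mulr1. Qed.

Lemma cutoff_far x : (forall a, E a -> r <= mdist a x) -> cutoff x = 0.
Proof. by move=> far; rewrite /cutoff tent_far ?mulr0// => a /far; rewrite metric_sym. Qed.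

Lemma cutoff_le x : `|cutoff x| <= `|G x|.
Proof.
by rewrite normrM ler_piMr// ger0_norm ?tent_ge0// tent_le1.
Qed.

(** A product rule arranged so that the bound involves [G] at the first point only; for fixed [x] it
    is uniform over [y] in a ball. *)
Lemma cutoff_incr x y : `|cutoff x - cutoff y| <= mdist x y / r * (`|G x| + r * L).
Proof.
have -> : cutoff x - cutoff y =
    G x * (tent r E x - tent r E y) + tent r E y * (G x - G y).
  by rewrite /cutoff; ring.
apply: le_trans (ler_normD _ _) _; rewrite [leRHS]mulrDr; apply: lerD; rewrite normrM.
  by rewrite mulrC ler_wpM2r// tent_lip.
rewrite (_ : mdist x y / r * (r * L) = L * mdist x y); last by field; rewrite gt_eqF.
apply: le_trans (GL x y); rewrite ler_piMl// ger0_norm ?tent_ge0//.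
by rewrite tent_le1.
Qed.

Lemma cutoff_lip : lipschitz_fun cutoff.
Proof.
(* The support is bounded, so [G] exceeds its value at [x0] by at most [L] times the radius; the
   modulus covers a negative [rho]. *)
pose M := `|G x0| + L * `|rho|.
have GM x : `|G x| <= M.
  have M0 : 0 <= M by rewrite addr_ge0// mulr_ge0.
  have [/Grho ->|xr] := leP rho (mdist x0 x); first by rewrite normr0.
  rewrite -[G x](subrK (G x0)) addrC; apply: le_trans (ler_normD _ _) _.
  rewrite lerD2l; apply: le_trans (GL x x0) _; rewrite metric_sym ler_wpM2l//.
  exact: le_trans (ltW xr) (ler_norm _).
exists ((M + r * L) / r) => x y; apply: le_trans (cutoff_incr x y) _.
rewrite (_ : (M + r * L) / r * mdist x y = mdist x y / r * (M + r * L)); last by ring.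
by rewrite ler_wpM2l ?lerD2r// divr_ge0 ?mdist_ge0 ?ltW.
Qed.

End cutoff.

Section extension.
Context (R : realType) (X : completeMetricType R).
Variable mu : {outer_measure set X -> \bar R}.
Hypothesis bmu : <<s @open X >> `<=` mu.-caratheodory.
Hypothesis mu_ball : forall (x : X) (r : R), (0 < r)%R -> (0 < mu (ball x r) < +oo)%E.
Hypothesis sepX : separable X.
Variable C : R.
Hypothesis C0 : 0 < C.
Hypothesis dbl : forall (x : X) (r : R), (0 < r <= 8)%R ->
  (mu (ball x (2 * r)%R) <= C%:E * mu (ball x r))%E.
Variables (theta p : R) (E : set X).
Hypothesis p1 : 1 <= p.
Hypothesis theta0 : 0 < theta.
Hypothesis thetap : theta < p.
Hypothesis closedE : closed E.
Local Open Scope ereal_scope.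
Local Notation m := (cara mu).
Local Notation nu := (codim_hausdorff_on mu theta E).
Local Notation s := (theta / p)%R.
Variables c1 c2 : R.
Hypothesis c10 : (0 < c1)%R.
Hypothesis c20 : (0 < c2)%R.
Hypothesis nu_ge : forall (x : X) (r : R), E x -> (0 < r <= 1)%R ->
  c1%:E * (mu (ball x r) * (r `^ theta)^-1%:E) <= nu (ball x r).
Hypothesis nu_le : forall (x : X) (r : R), E x -> (0 < r <= 1)%R ->
  nu (ball x r) <= c2%:E * (mu (ball x r) * (r `^ theta)^-1%:E).

Let bnu : <<s @open X >> `<=` nu.-caratheodory.
Proof. exact: codim_hausdorff_on_borel. Qed.

Let p0 : (0 < p)%R. Proof. exact: lt_le_trans p1. Qed.

Let pV0 : (0 <= p^-1)%R. Proof. by rewrite invr_ge0 ltW. Qed.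

Let s0 : (0 < s)%R. Proof. by rewrite divr_gt0. Qed.

Let s1 : (s < 1)%R. Proof. by rewrite ltr_pdivrMr// mul1r. Qed.

(** Regularity only concerns balls of radius at most 1 centred on [E]; a net of [E] of spacing 1/2
    carries the bound over to arbitrary balls. *)
Lemma codim_hausdorff_on_ball (x0 : X) (r : R) : nu (ball x0 r) < +oo.
Proof.
pose h x : \bar R := (\1_(ball x0 r) x)%:E.
have h0 x : 0 <= h x by rewrite lee_fin.
have r0 : (0 < 2^-1 :> R)%R by rewrite invr_gt0.
have K0 : (0 <= c2 * C ^+ 2)%R by rewrite mulr_ge0 ?exprn_ge0// ltW.
have [|H [mH H0 hH iH]] := net_transfer sepX bnu bmu (A := E) r0 K0 _ h0.
  move=> a Ea; rewrite mulfV//; apply: le_trans (nu_le Ea _) _; first by rewrite ltr01/=.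
  rewrite powR1 invr1 mule1 EFinM -muleA lee_wpmul2l ?lee_fin ?(ltW c20)//.
  by apply: (doubling_ball C0 dbl) => //; rewrite ?mdistxx; lra.
have mE : measurable (E : set (caratheodory_type nu)).
  have oE : open (~` E) by exact: closed_openC.
  by have := measurableC (open_measurable_cara bnu oE); rewrite setCK.
have mBE : measurable (ball x0 r `&` E : set (caratheodory_type nu)).
  by apply: measurableI => //; exact: ball_measurable_cara.
have -> : nu (ball x0 r) = nu (ball x0 r `&` E).
  by rewrite /codim_hausdorff_on -setIA setIid.
rewrite (_ : nu _ = cara nu (ball x0 r `&` E))// -[X in cara nu X]setIT -integral_indic//.
apply: (@le_lt_trans _ _ (\int[cara nu]_x H x)).
  apply: le_integral_lower => x; first by rewrite lee_fin.
  rewrite indicE; case: (boolP (x \in _)) => [/set_mem[Bx Ex]|_]; last exact: H0.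
  apply: le_trans (hH x x Ex _); last by rewrite mdistxx.
  by rewrite /h indicE mem_set.
pose g y : \bar R := (\1_(ball x0 (`|r| + 2)) y)%:E.
have g0 y : 0 <= g y by rewrite lee_fin.
apply: le_lt_trans (iH g g0 _) _.
  move=> a x y Ea ax xy; rewrite /h indicE.
  case: (boolP (x \in _)) => [/set_mem/ballP x0x|_]; last exact: g0.
  rewrite /g indicE mem_set//; apply/ballP; apply: mdist_ltD x0x (ltW xy) _.
  by have := ler_norm r; lra.
rewrite integral_indic//; last exact: ball_measurable_cara.
rewrite setIT lte_mul_pinfty ?lee_fin//.
by have /andP[] := mu_ball x0 (ltr_wpDl (normr_ge0 r) (ltr0Sn R 1)).
Qed.

Lemma codim_hausdorff_on_regular (A : set X) :
  exists B, [/\ <<s @open X >> B, nu (A `\` B) = 0 & nu B = nu A].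
Proof.
have [B [bB AB BA]] := codim_hausdorff_on_outer_regular mu theta E A.
exists B; split=> //; apply: codim_hausdorff_onC => x [/AB[//|//]].
Qed.

(** Oscillations of infinitely many extensions will be summed, so measurable majorants are recorded:
    [M] in space, for Minkowski's inequality, and [b] in scale, for exchanging sum and integral. The
    number [q] then bounds the seminorm. *)
Definition osc_majorized (f : X -> R) (q : R) : Prop :=
  exists b : R -> \bar R,
    [/\ measurable_fun (`]0%R, 1%R[%classic : set R) b,
        \int[lebesgue_measure]_(t in `]0%R, 1%R[) b t <= q%:E &
        forall t, (0 < t < 1)%R -> exists M : X -> \bar R,
          [/\ measurable_fun setT (M : caratheodory_type mu -> \bar R),
              forall x, 0 <= M x, forall x, mean_osc mu f t x <= M x &
              (t `^ (- s))%:E * 'N[m]_p%:E[M] * t^-1%:E <= b t]].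

Variable x0 : X.

(** The strict bound by [Q] leaves room for the error of the transfer, which is proportional to [r]
    and is absorbed by taking [r] small. Thus [r] depends on [G], while [K] does not. *)
Lemma lip_extension : exists K : R, (0 < K)%R /\ forall (G : X -> R) (Q : R),
  lip_bsupp x0 G -> 'N[cara nu]_p%:E[EFin \o G] < Q%:E ->
  exists F : X -> R, [/\ lipschitz_fun F, forall x, E x -> F x = G x,
    'N[m]_p%:E[EFin \o F] <= (K * Q)%:E & osc_majorized F (K * Q)].
Proof.
(* Transfer from nu to mu: [C ^+ 2] passes from radius [4 * r] to [r], and [c1] compares mu with nu
   at radius [r]. *)
pose A := ((C ^+ 2 / c1) `^ p^-1)%R.
have A0 : (0 < A)%R by rewrite powR_gt0// divr_gt0// exprn_gt0.
(* The cost of averaging at scales above [r], from [net_average]. *)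
pose D := ((C ^+ 6) `^ p^-1)%R.
have D0 : (0 < D)%R by rewrite powR_gt0// exprn_gt0.
(* The part [2 * A] serves the scales up to [r], and [2 * A * D] the larger ones. *)
pose B := (2 * A * (1 + D))%R.
have B0 : (0 < B)%R by rewrite !mulr_gt0// addr_gt0.
pose W := ((1 - s)^-1 + s^-1)%R.
have W0 : (0 < W)%R by rewrite addr_gt0// invr_gt0// subr_gt0.
exists (A + B * W)%R; split; first by rewrite addr_gt0// mulr_gt0.
move=> G Q lG GQ; have mG := lip_measurable_cara bnu lG.1.
case: lG => -[L' GL'] [rho Grho].
pose L := Num.max 0%R L'; have L0 : (0 <= L)%R by rewrite le_max lexx.
have GL x y : (`|G x - G y| <= L * mdist x y)%R.
  apply: le_trans (GL' x y) _; rewrite ler_wpM2r ?mdist_ge0//.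
  by rewrite le_max lexx orbT.
pose B1 : set X := ball x0 (rho + 1)%R; pose B4 : set X := ball x0 (rho + 4)%R.
have mB4 : measurable (B4 : set (caratheodory_type nu)).
  exact: ball_measurable_cara.
have N1 : 'N[cara nu]_p%:E[(fun x => (\1_B4 x)%:E)] < +oo.
  rewrite (@Lnorm_indic _ _ _ (cara nu) _ _ p0 mB4); apply: poweR_lty.
  exact: codim_hausdorff_on_ball.
have Nfin : 'N[cara nu]_p%:E[(fun x => (\1_B4 x)%:E)] \is a fin_num.
  by rewrite ge0_fin_numE// Lnorm_ge0.
pose n1 := fine ('N[cara nu]_p%:E[(fun x => (\1_B4 x)%:E)]).
have n10 : (0 <= n1)%R by apply: fine_ge0; exact: Lnorm_ge0.
have GF : 'N[cara nu]_p%:E[EFin \o G] \is a fin_num.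
  by rewrite ge0_fin_numE ?Lnorm_ge0//; apply: lt_trans GQ _; exact: ltry.
pose nG := fine ('N[cara nu]_p%:E[EFin \o G]).
have nGQ : (nG < Q)%R by rewrite -lte_fin fineK.
have nG0 : (0 <= nG)%R by apply: fine_ge0; exact: Lnorm_ge0.
have Q0 : (0 < Q)%R by exact: le_lt_trans nGQ.
pose e := (Q - nG)%R; have e0 : (0 < e)%R by rewrite subr_gt0.
have k0 : (0 < 7 * L * n1 + 1)%R by rewrite ltr_wpDl// !mulr_ge0.
(* The bound 1/4 keeps the transferred points inside [B4]; the other one makes the error
   [7 * r * L * n1] at most [e], the summand 1 excluding a zero denominator. *)
pose r := Num.min 4^-1%R (e / (7 * L * n1 + 1))%R.
have r0 : (0 < r)%R by rewrite lt_min invr_gt0 ltr0n divr_gt0.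
have r4 : (r <= 4^-1)%R by rewrite ge_min lexx.
have rLe : (7 * r * L * n1 <= e)%R.
  have : (r * (7 * L * n1 + 1) <= e)%R by rewrite -ler_pdivlMr// ge_min lexx orbT.
  by move: r0; lra.
pose F := cutoff G E r.
have lF : lipschitz_fun F by exact: (cutoff_lip _ L0 r0 GL Grho).
have mF := lip_measurable_cara bmu lF.
(* Near [E], [h0] bounds the modulus of [F], and [t / r] times [h0] bounds its increments over
   distance [t]. The indicator keeps the constant term near the support of [G]. *)
pose h0 x := (`|G x| + r * L * \1_B1 x)%R.
have h00 x : (0 <= h0 x)%R by rewrite addr_ge0// !mulr_ge0// ltW.
pose h x : \bar R := ((h0 x) `^ p)%:E.
have hge0 x : 0 <= h x by rewrite lee_fin powR_ge0.
(* Passing from [G x] to [G y] for points less than [6 * r] apart costs [6 * r * L]; the term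
   [r * L] of [h0] makes it 7. *)
pose g0 x := (`|G x| + 7 * r * L * \1_B4 x)%R.
have g00 x : (0 <= g0 x)%R by rewrite addr_ge0// !mulr_ge0// ltW.
pose g x : \bar R := ((g0 x) `^ p)%:E.
have gge0 x : 0 <= g x by rewrite lee_fin powR_ge0.
pose K := (C ^+ 2 / c1 * r `^ theta)%R.
have K0 : (0 < K)%R by rewrite mulr_gt0 ?powR_gt0// divr_gt0// exprn_gt0.
have rr : (0 < 2 * r)%R by rewrite mulr_gt0.
have [|H [mH H0 hH iH]] := net_transfer sepX bmu bnu (A := E) rr (ltW K0) _ hge0.
  move=> a Ea; rewrite (_ : 2 * r / 2 = r)%R; last by field.
  have r1 : (0 < r <= 1)%R by rewrite r0; apply: le_trans r4 _; lra.
  apply: (@le_trans _ _ ((C ^+ 2)%:E * mu (ball a r))).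
    apply: (doubling_ball C0 dbl) => //; last by rewrite mdistxx add0r expr2 mulrA.
    by apply: (@le_trans _ _ (2 ^+ 2 * 4^-1)%R); [rewrite ler_pM2l ?exprn_gt0|lra].
  apply: le_trans (lee_wpmul2l _ (nu_ge Ea r1)); last by rewrite lee_fin ltW.
  rewrite -(mu_ball_fineK mu_ball a r0) -!EFinM lee_fin.
  rewrite le_eqVlt; apply/orP; left; apply/eqP; rewrite /K; field.
  by rewrite !gt_eqF// powR_gt0.
have hHp a x : E a -> (mdist a x < 2 * r)%R -> (h0 x)%:E <= H x `^ p^-1.
  move=> Ea ax; rewrite -[leLHS](@poweRKV _ _ p) ?lee_fin//.
  have hHx := hH a x Ea ax.
  by rewrite [(h0 x)%:E `^ p]poweR_EFin; exact: (lee_poweR pV0 (hge0 x) hHx).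
have iHp : (\int[m]_x H x) `^ p^-1 <= (A * r `^ s * Q)%:E.
  have hg : \int[m]_x H x <= K%:E * \int[cara nu]_y g y.
    apply: (iH g gge0) => a x y Ea ax xy; rewrite lee_fin.
    apply: ge0_ler_powR; rewrite ?nnegrE// ?(ltW p0)//.
    have [x1|x1] := ltP (mdist x0 x) (rho + 1)%R; last first.
      rewrite /h0 Grho ?normr0 ?add0r; last by move: x1; lra.
      by rewrite indicE memNset ?mulr0// => /ballP; rewrite ltNge x1.
    rewrite /h0 /g0 !indicE !mem_set; last 2 first.
    - by apply/ballP; apply: mdist_ltD x1 (ltW xy) _; move: r4; lra.
    - exact/ballP.
    have GG : (`|G x| <= `|G y| + 6 * r * L)%R.
      rewrite -[G x](subrK (G y)) addrC; apply: le_trans (ler_normD _ _) _.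
      rewrite lerD2l; apply: le_trans (GL x y) _.
      rewrite mulrC ler_wpM2r//; move: xy; lra.
    by rewrite !mulr1; move: GG; lra.
  apply: le_trans (lee_poweR pV0 _ hg) _; first exact: integral_ge0.
  rewrite poweRM ?lee_fin ?(ltW K0)//; last by apply: integral_ge0.
  rewrite (_ : (A * r `^ s * Q)%:E = K%:E `^ p^-1 * Q%:E); last first.
    rewrite poweR_EFin -EFinM /K powRM ?powR_ge0//; last first.
      by rewrite divr_ge0 ?exprn_ge0 ?(ltW C0)// ltW.
    by rewrite -powRrM.
  apply: lee_wpmul2l; first exact: poweR_ge0.
  have -> : (\int[cara nu]_y g y) `^ p^-1 = 'N[cara nu]_p%:E[EFin \o g0].
    rewrite Lnorm_ge0E// => x; by rewrite lee_fin.
  have m1 : measurable_fun setT ((fun x => `|G x|%:E) : caratheodory_type nu -> \bar R).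
    by apply/measurable_EFinP; exact: measurableT_comp.
  have m4 : measurable_fun setT ((fun x => (\1_B4 x)%:E) : caratheodory_type nu -> \bar R).
    by apply/measurable_EFinP; exact: measurable_indic.
  have rL0 : (0 <= 7 * r * L)%R by rewrite !mulr_ge0// ltW.
  apply: le_trans (ge0_minkowski (cara nu) p1 m1
    (measurable_funeM (7 * r * L)%:E m4) _ _) _ => //.
    by move=> x; rewrite mule_ge0 ?lee_fin.
  rewrite Lnorm_scale//.
  have -> : 'N[cara nu]_p%:E[(fun x => `|G x|%:E)] = nG%:E.
    by rewrite /nG fineK// -[RHS]Lnorm_abse.
  rewrite -(fineK Nfin) -/n1 -EFinM -EFinD lee_fin.
  by move: rLe; rewrite /e; lra.
have FH x : `|F x|%:E <= H x `^ p^-1.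
  have [[a Ea ax]|far] := pselect (exists2 a, E a & (mdist a x < r)%R).
    apply: le_trans (hHp a x Ea _); last by move: r0; lra.
    rewrite lee_fin; apply: le_trans (cutoff_le _ _ r0 x) _.
    by rewrite lerDl !mulr_ge0// ltW.
  rewrite /F cutoff_far ?normr0 ?poweR_ge0// => a Ea.
  by rewrite leNgt; apply/negP => ax; apply: far; exists a.
have FHp x : (`|F x| `^ p)%:E <= H x.
  rewrite -(@poweRVK _ (H x) p)// -poweR_EFin.
  by apply: lee_poweR; rewrite ?lee_fin ?(ltW p0).
have NF : 'N[m]_p%:E[EFin \o F] <= (A * r `^ s * Q)%:E.
  apply: le_trans iHp; rewrite -Lnorm_root//; apply: le_Lnorm => // x.
  by rewrite /= [leRHS]gee0_abs ?poweR_ge0.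
have FL : (F : caratheodory_type mu -> R) \in Lfun m p%:E.
  apply/andP; split; rewrite !inE//=.
  by apply: le_lt_trans NF _; exact: ltry.
have iF := Lfun_loc_integrable bmu mu_ball p1 FL.
(* Up to scale [r] the values on the ball are compared with [F x]. When [x] is at least [2 * r] away
   from [E], or at least [rho + 1] from [x0], [F] vanishes on the whole ball. *)
have oscs x t : (0 < t <= r)%R -> mean_osc mu F t x <= (2 * (t / r))%:E * H x `^ p^-1.
  move=> /andP[t0 tr]; apply: le_trans (mean_osc_le bmu mu_ball (F x) t0 (iF x t t0)) _.
  rewrite EFinM -muleA; apply: lee_wpmul2l => //.
  rewrite -[leRHS](ball_avg_cst bmu mu_ball _ x t0).
  apply: (le_ball_avg mu_ball t0) => y /ballP xy; rewrite lee_fin normr_ge0/=.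
  have c0 : 0 <= (t / r)%:E * H x `^ p^-1.
    by rewrite mule_ge0 ?poweR_ge0// lee_fin divr_ge0 ?ltW.
  have [[a Ea ax]|far] := pselect (exists2 a, E a & (mdist a x < 2 * r)%R); last first.
    suff [-> ->] : F x = 0%R /\ F y = 0%R by rewrite subrr normr0.
    split; apply: cutoff_far => // a Ea; rewrite leNgt; apply/negP => az; apply: far; exists a => //.
      by move: az r0; lra.
    by rewrite metric_sym in xy; apply: mdist_ltD az (ltW xy) _; lra.
  have [x1|x1] := ltP (mdist x0 x) (rho + 1)%R; last first.
    suff [-> ->] : F x = 0%R /\ F y = 0%R by rewrite subrr normr0.
    have Gx : G x = 0%R by apply: Grho; apply: le_trans x1; rewrite lerDl.
    have Gy : G y = 0%R.
      apply: Grho; rewrite leNgt; apply/negP => yr; rewrite metric_sym in xy.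
      have := mdist_ltD yr (ltW xy) (lexx _); rewrite ltNge => /negP; apply.
      by apply: le_trans x1; rewrite lerD2l (le_trans tr)// (le_trans r4)// invf_le1// ler1n.
    by rewrite /F /cutoff Gx Gy !mul0r.
  apply: (@le_trans _ _ ((t / r)%:E * (h0 x)%:E)); last first.
    by apply: lee_wpmul2l (hHp a x Ea ax); rewrite lee_fin divr_ge0 ?ltW.
  rewrite -EFinM lee_fin distrC; apply: le_trans (cutoff_incr E r0 GL x y) _.
  rewrite /h0 indicE mem_set ?mulr1; last exact/ballP.
  by rewrite ler_wpM2r ?addr_ge0 ?mulr_ge0 ?(ltW r0)// ler_pM2r ?invr_gt0// ltW.
have rs1 : (r `^ s <= 1)%R.
  rewrite (_ : 1%R = 1 `^ s)%R; last by rewrite powR1.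
  apply: ge0_ler_powR.
  - exact: ltW s0.
  - by rewrite nnegrE ltW.
  - by rewrite nnegrE.
  - by rewrite (le_trans r4)// invf_le1// ler1n.
exists F; split=> //.
- by move=> x Ex; exact: cutoff_in.
- apply: le_trans NF _; rewrite lee_fin ler_wpM2r ?(ltW Q0)//.
  apply: (@le_trans _ _ A); first by rewrite ler_piMr// ltW.
  by rewrite lerDl mulr_ge0 ?ltW.
have BQ0 : (0 <= B * Q)%R by rewrite mulr_ge0 ?ltW.
pose w (t : R) := (r `^ s * Num.min (t / r) 1 * t `^ (- s - 1))%:E.
have mw S : measurable_fun S w.
  apply/measurable_funTS/measurable_EFinP; apply: measurable_funM.
    apply: measurable_funM => //; apply: measurable_minr => //.
    exact: measurable_funM.
  exact: measurable_powR.
exists (fun t => (B * Q)%:E * w t); split.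
- exact: measurable_funeM.
- rewrite ge0_integralZl//=; last 2 first.
  + exact: mw.
  + move=> t; rewrite in_itv/= => /andP[t0 _].
    by rewrite lee_fin !mulr_ge0 ?powR_ge0// le_min ler01 divr_ge0 ?ltW.
  have s01 : (0 < s < 1)%R by rewrite s0.
  have r01 : (0 < r < 1)%R by rewrite r0 (le_lt_trans r4)// invf_lt1// ltr1n.
  apply: le_trans (lee_wpmul2l _ (integral_min_powR s01 r01)) _ => //.
  rewrite -EFinM lee_fin -/W -mulrA [(Q * W)%R]mulrC mulrA ler_wpM2r ?(ltW Q0)//.
  by rewrite lerDr ltW.
move=> t /andP[t0 t1].
(* Both ranges of [t] reduce to this bound on the norm of a majorant, which turns into the weight
   [w]. *)
have wrap (M : X -> \bar R) :
    'N[m]_p%:E[M] <= (B * Q * r `^ s * Num.min (t / r) 1)%:E ->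
    (t `^ (- s))%:E * 'N[m]_p%:E[M] * t^-1%:E <= (B * Q)%:E * w t.
  move=> NM; apply: le_trans (lee_wpmul2r _ (lee_wpmul2l _ NM)) _.
  - by rewrite lee_fin invr_ge0 ltW.
  - by rewrite lee_fin powR_ge0.
  rewrite -!EFinM lee_fin powRB ?(gt_eqF t0) ?implybT// powRr1 ?(ltW t0)//.
  by rewrite le_eqVlt; apply/orP; left; apply/eqP; ring.
have [tr|rt] := leP t r.
  have tr0 : (0 <= t / r)%R by rewrite divr_ge0 ?ltW.
  have mHp : measurable_fun setT ((fun x => H x `^ p^-1) : caratheodory_type mu -> \bar R).
    exact: measurable_poweR_comp.
  exists (fun x => (2 * (t / r))%:E * H x `^ p^-1); split.
  - exact: measurable_funeM.
  - by move=> x; rewrite mule_ge0 ?poweR_ge0// lee_fin; apply: mulr_ge0.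
  - by move=> x; apply: oscs; rewrite t0.
  have tr20 : (0 <= 2 * (t / r))%R by rewrite mulr_ge0.
  apply: wrap; rewrite Lnorm_scale//; last by move=> x; exact: poweR_ge0.
  rewrite Lnorm_root//; apply: le_trans (lee_wpmul2l _ iHp) _; first by rewrite lee_fin.
  rewrite -EFinM lee_fin min_l; last by rewrite ler_pdivrMr// mul1r.
  rewrite (_ : 2 * (t / r) * (A * r `^ s * Q) = 2 * A * Q * r `^ s * (t / r))%R; last by ring.
  rewrite !ler_wpM2r ?powR_ge0 ?(ltW Q0)// /B ler_peMr ?lerDl ?(ltW D0)//.
  by rewrite mulr_ge0 ?ltW.
(* Above scale [r] the oscillation is at most twice the average of the modulus of [F], whose p-th
   power is at most the average of [H] by Jensen's inequality. *)
have t01 : (0 < t <= 1)%R by rewrite t0 ltW.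
have [|Ht [mHt Ht0 HtH iHt]] := net_average bmu mu_ball sepX C0 dbl bmu t01 (@ler01 R) (A := setT) _ mH H0.
  by move=> a _; rewrite mul1e.
have mHp : measurable_fun setT ((fun x => Ht x `^ p^-1) : caratheodory_type mu -> \bar R).
  exact: measurable_poweR_comp.
exists (fun x => 2%:E * Ht x `^ p^-1); split.
- exact: measurable_funeM.
- by move=> x; rewrite mule_ge0 ?poweR_ge0.
- move=> x; apply: le_trans (mean_osc_le bmu mu_ball 0%R t0 (iF x t t0)) _.
  apply: lee_wpmul2l => //.
  have -> : (fun y => `|F y - 0|%:E) = (fun y => `|F y|%:E).
    by apply/funext => y; rewrite subr0.
  rewrite -[leLHS](@poweRKV _ _ p)//; last by apply: (ball_avg_ge0 mu_ball) => // y _; rewrite lee_fin.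
  apply: lee_poweR => //; first exact: poweR_ge0.
  apply: le_trans (ball_avg_jensen bmu mu_ball p1 t0 _) _; first exact: measurable_funTS.
  apply: le_trans (HtH x I); apply: (le_ball_avg mu_ball t0) => y _.
  by rewrite lee_fin powR_ge0/=.
apply: wrap; rewrite Lnorm_scale//; last by move=> x; exact: poweR_ge0.
rewrite Lnorm_root//.
apply: (@le_trans _ _ (2%:E * (D%:E * (A * r `^ s * Q)%:E))).
  apply: lee_wpmul2l => //.
  apply: (@le_trans _ _ (D%:E * (\int[m]_x H x) `^ p^-1)); last first.
    by apply: lee_wpmul2l iHp; rewrite lee_fin ltW.
  rewrite /D -poweR_EFin -poweRM ?lee_fin ?exprn_ge0 ?(ltW C0)//; last exact: integral_ge0.
  apply: lee_poweR => //; first exact: integral_ge0.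
  by rewrite mul1r in iHt.
rewrite -!EFinM lee_fin min_r; last by rewrite ler_pdivlMr// mul1r ltW.
rewrite mulr1 (_ : 2 * (D * (A * r `^ s * Q)) = 2 * A * D * Q * r `^ s)%R; last by ring.
rewrite !ler_wpM2r ?powR_ge0 ?(ltW Q0)// /B ler_wpM2l ?lerDr//.
by rewrite mulr_ge0 ?ltW.
Qed.

End extension.

(** * Sums of extensions *)

Section series.
Context (R : realType) (X : completeMetricType R).
Variable mu : {outer_measure set X -> \bar R}.
Hypothesis bmu : <<s @open X >> `<=` mu.-caratheodory.
Hypothesis mu_ball : forall (x : X) (r : R), (0 < r)%R -> (0 < mu (ball x r) < +oo)%E.
Variables (theta p : R).
Hypothesis p1 : 1 <= p.
Local Open Scope ereal_scope.
Local Notation T := (caratheodory_type mu).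
Local Notation m := (cara mu).
Local Notation s := (theta / p)%R.
Local Notation N f := ('N[cara mu]_p%:E[EFin \o f]).

Let p0 : (0 < p)%R. Proof. exact: lt_le_trans p1. Qed.

Let pV0 : (0 <= p^-1)%R. Proof. by rewrite invr_ge0 ltW. Qed.

Lemma mean_oscD (u v : X -> R) (x : X) (t : R) : loc_integrable mu u ->
  loc_integrable mu v -> (0 < t)%R ->
  mean_osc mu (u \+ v)%R t x <= mean_osc mu u t x + mean_osc mu v t x.
Proof.
move=> ui vi t0; have mB := ball_measurable_cara bmu x t.
have ut := ui x t t0; have vt := vi x t t0.
have mut := measurable_int _ ut; have mvt := measurable_int _ vt.
rewrite /mean_osc; set a := fine (ball_avg mu (EFin \o u) x t).
set b := fine (ball_avg mu (EFin \o v) x t).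
have -> : fine (ball_avg mu (EFin \o (u \+ v)%R) x t) = (a + b)%R.
  rewrite /a /b !ball_avgE// (_ : EFin \o (u \+ v)%R = (EFin \o u) \+ (EFin \o v))//.
  rewrite integralD// -(fineK (integrable_fin_num mB ut)).
  by rewrite -(fineK (integrable_fin_num mB vt)) -EFinD -!EFinM/= mulrDr.
rewrite -ball_avgD//; last 2 first.
- exact: measurable_dist.
- exact: measurable_dist.
apply: (le_ball_avg mu_ball t0) => y _; rewrite lee_fin normr_ge0 -EFinD lee_fin.
by rewrite opprD addrACA ler_normD.
Qed.

(** Jensen's inequality. The constant may depend on the ball, as it only serves to pass to a limit
    on a fixed ball. *)
Lemma ball_avg_Lnorm (x : X) (t : R) : (0 < t)%R -> exists2 c : R, (0 < c)%R &
  forall f : X -> R, measurable_fun setT (f : T -> R) ->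
  ball_avg mu (fun y => `|f y|%:E) x t <= c%:E * N f.
Proof.
move=> t0; have Vx := mu_ball_fine_gt0 mu_ball x t0.
exists ((fine (mu (ball x t)))^-1 `^ p^-1)%R; first by rewrite powR_gt0// invr_gt0.
move=> f mf; have a0 : 0 <= ball_avg mu (fun y => `|f y|%:E) x t.
  by apply: (ball_avg_ge0 mu_ball) => // y _; rewrite lee_fin.
rewrite -[leLHS](@poweRKV _ _ p)// unlock/= -poweR_EFin -poweRM; last 2 first.
- by rewrite lee_fin invr_ge0 ltW.
- exact: integral_ge0.
apply: lee_poweR => //; first exact: poweR_ge0.
apply: le_trans (ball_avg_jensen bmu mu_ball p1 t0 _) _; first exact: measurable_funTS.
rewrite ball_avgE// lee_wpmul2l//; first by rewrite lee_fin invr_ge0 ltW.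
by apply: lee_integral_sub => // y _; rewrite lee_fin powR_ge0/=.
Qed.

(** On a fixed ball the oscillation of the remainder is at most twice the average of its modulus,
    hence small with its norm; partial sums are handled by subadditivity. *)
Lemma mean_osc_series (f : X -> R) (F : nat -> X -> R) (t : R) (x : X) :
  (0 < t)%R -> loc_integrable mu f -> (forall k, loc_integrable mu (F k)) ->
  (forall k, measurable_fun setT (F k : T -> R)) -> measurable_fun setT (f : T -> R) ->
  (forall e : R, (0 < e)%R -> exists n,
     N (fun y => f y - \sum_(k < n) F k y)%R <= e%:E) ->
  mean_osc mu f t x <= \sum_(0 <= k <oo) mean_osc mu (F k) t x.
Proof.
move=> t0 fi Fi mF mf fe; have [c c0 cP] := ball_avg_Lnorm x t0.
have osc0 k : 0 <= mean_osc mu (F k) t x by exact: (mean_osc_ge0 mu_ball).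
pose S n y := (\sum_(k < n) F k y)%R.
have SS n : S n.+1 = (S n \+ F n)%R by apply/funext => y; rewrite /S big_ord_recr.
have mS n : measurable_fun setT (S n : T -> R) by exact: measurable_sum.
have Si n : loc_integrable mu (S n).
  elim: n => [|n IH] z r r0.
    rewrite (_ : EFin \o _ = cst 0); first exact: integrable0.
    by apply/funext => y; rewrite /= /S big_ord0.
  rewrite SS (_ : EFin \o _ = (EFin \o S n) \+ (EFin \o F n))//.
  by apply: integrableD; [exact: ball_measurable_cara|exact: IH|exact: Fi].
have oscS n : mean_osc mu (S n) t x <= \sum_(0 <= k < n) mean_osc mu (F k) t x.
  elim: n => [|n IH].
    rewrite big_nil; apply: le_trans (mean_osc_le bmu mu_ball 0%R t0 (Si 0%N x t t0)) _.
    rewrite (_ : (fun y => _) = fun=> 0); last first.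
      by apply/funext => y; rewrite /S big_ord0 subrr normr0.
    by rewrite ball_avg_cst// mule0.
  rewrite SS big_nat_recr//=.
  by apply: (le_trans (mean_oscD x (Si n) (Fi n) t0)); exact: leeD2r.
apply/lee_addgt0Pr => e e0.
have ec : (0 < e / (2 * c))%R by rewrite divr_gt0// mulr_gt0.
have [n fn] := fe _ ec.
pose g y := (f y - S n y)%R.
have gi : loc_integrable mu g.
  move=> z r r0; rewrite (_ : EFin \o g = (EFin \o f) \- (EFin \o S n)).
    by apply: integrableB; [exact: ball_measurable_cara|exact: fi|exact: Si].
  by apply/funext => y.
have mg : measurable_fun setT (g : T -> R) by exact: measurable_funB.
have -> : f = (S n \+ g)%R by apply/funext => y; rewrite /g /= addrC subrK.
apply: (le_trans (mean_oscD x (Si n) gi t0)); apply: leeD.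
  apply: le_trans (oscS n) _.
  by apply: (@nneseries_lim_ge _ _ xpredT 0 n) => k _ _; exact: osc0.
apply: le_trans (mean_osc_le bmu mu_ball 0%R t0 (gi x t t0)) _.
rewrite (_ : (fun y => `|g y - 0|%:E) = (fun y => `|g y|%:E)); last first.
  by apply/funext => y; rewrite subr0.
apply: le_trans (lee_wpmul2l _ (cP g mg)) _ => //.
apply: le_trans (lee_wpmul2l _ (lee_wpmul2l _ fn)) _ => //; first by rewrite lee_fin ltW.
rewrite -!EFinM lee_fin le_eqVlt; apply/orP; left; apply/eqP; field.
by rewrite gt_eqF.
Qed.

(** Every remainder is estimated, because the trace bound will be applied to each of them. The
    factor 2 counts the norm and the seminorm, each at most [c / 2 ^+ n]. *)
Lemma besov_series (F : nat -> X -> R) (c : R) : (0 <= c)%R ->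
  (forall n, measurable_fun setT (F n : T -> R)) ->
  (forall n, N (F n) <= (c / (2 ^ n.+1)%:R)%:E) ->
  (forall n, osc_majorized mu theta p (F n) (c / (2 ^ n.+1)%:R)) ->
  exists f : X -> R, forall n : nat,
    besov mu s p (fun x => f x - \sum_(k < n) F k x)%R /\
    besov_norm mu s p (fun x => f x - \sum_(k < n) F k x)%R <=
      (2 * (c / 2 ^+ n))%:E.
Proof.
move=> c0 mF NF oF.
pose S n x := (\sum_(k < n) F k x)%R.
have mS n : measurable_fun setT (S n : T -> R) by exact: measurable_sum.
have tailsum n : \sum_(0 <= k <oo) (c / (2 ^ (k + n.+1))%:R)%:E = (c / 2 ^+ n)%:E.
  by apply/cvg_lim => //; exact: cvg_geometric_eseries_half.
have maF n : measurable_fun setT ((fun x => `|F n x|%:E) : T -> \bar R).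
  by apply/measurable_EFinP; exact: measurableT_comp.
pose tl n x := \sum_(0 <= k <oo) `|F (k + n)%N x|%:E.
have tl0 n x : 0 <= tl n x by apply: nneseries_ge0 => k _ _; rewrite lee_fin.
have mtl n : measurable_fun setT (tl n : T -> \bar R).
  apply: (@ge0_emeasurable_sum _ _ _ _ _ xpredT) => // k x _; rewrite lee_fin.
have Ntl n : 'N[m]_p%:E[tl n] <= (c / 2 ^+ n)%:E.
  apply: (@le_trans _ _ (\sum_(0 <= k <oo) 'N[m]_p%:E[(fun x => `|F (k + n)%N x|%:E)])).
    by apply: (Lnorm_nneseries m p1) => [k|k x]; [exact: maF|rewrite lee_fin].
  rewrite -tailsum; apply: lee_nneseries => [k _ _|k _]; first exact: Lnorm_ge0.
  rewrite addnS; apply: le_trans (NF (k + n)%N); apply: le_Lnorm => // x.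
  by rewrite /= normr_id.
have aetl : {ae m, forall x, tl 0%N x < +oo}.
  by apply: (Lnorm_fin_ae p0) => //; apply: le_lt_trans (Ntl 0%N) _; exact: ltry.
(* The upper limit makes [f] measurable everywhere; it is the sum wherever [tl 0] is finite, that
   is, almost everywhere. *)
pose f := fine \o (fun x => limn_esup (fun n => (S n x)%:E)).
have mf : measurable_fun setT (f : T -> R).
  apply: (@measurableT_comp _ _ _ _ _ _ (@fine R)) => //.
  by apply: measurable_fun_limn_esup => k; exact/measurable_EFinP.
have tl_le n x : tl n x <= tl 0%N x.
  pose y k := `|F k x|%:E; have y0 k : 0 <= y k by rewrite lee_fin.
  rewrite /tl (@nneseries_addn _ y n)// (@nneseries_addn _ y 0%N)//.
  rewrite (@nneseries_split _ y 0%N n)// add0n leeDr//.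
  by apply: sume_ge0 => k _.
have key x n : tl 0%N x < +oo -> `|f x - S n x|%:E <= tl n x.
  move=> tlx.
  have incr j : exists l : R, (S (k + j)%N x - S j x)%R @[k --> \oo] --> l /\
      `|l|%:E <= tl j x.
    have [k|||k|l [Sl _ ltl]] := @cvg_increments R (fun k => S (k + j)%N x - S j x)%R
        (fun k => `|F (k + j)%N x|%:E) 1%R.
    - by rewrite lee_fin.
    - exact: ler01.
    - exact: le_lt_trans (tl_le j x) tlx.
    - rewrite mul1e lee_fin addSn /S big_ord_recr/=.
      by rewrite opprB addrA subrK addrC addKr.
    - exists l; split=> //; apply: le_trans ltl _.
      by rewrite add0n subrr normr0 add0e mul1e.
  have [l [Sl _]] := incr 0%N.
  have {}Sl : S k x @[k --> \oo] --> l.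
    rewrite (_ : S^~ x = fun k => S (k + 0)%N x - S 0%N x)%R//.
    by apply/funext => k; rewrite addn0 {3}/S big_ord0 subr0.
  have fl : f x = l.
    have cS : (fun k => (S k x)%:E) @ \oo --> l%:E by exact: (cvg_comp _ _ Sl).
    by rewrite /f /= (cvg_limn_einf_sup cS).2.
  have [l' [Sl' l'tl]] := incr n.
  rewrite fl (_ : l - S n x = l')%R//.
  rewrite -(cvg_lim (@Rhausdorff R) Sl'); apply/esym/cvg_lim => //.
  by apply: cvgB; [rewrite (cvg_shiftn n (S^~ x))|exact: cvg_cst].
have mg n : measurable_fun setT ((fun x => f x - S n x)%R : T -> R).
  exact: measurable_funB.
have Ng n : N (fun x => f x - S n x)%R <= (c / 2 ^+ n)%:E.
  apply: le_trans (Ntl n); apply: (le_Lnorm_ae p0) => //.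
    exact/measurable_EFinP.
  apply: (@filterS _ _ (ae_filter_ringOfSetsType m) _ _ _ aetl) => x /(key x n).
  by move=> /le_trans; apply; exact: lee_abs.
have gL n : ((fun x => f x - S n x)%R : T -> R) \in Lfun m p%:E.
  apply/andP; split; rewrite !inE//=.
  by apply: le_lt_trans (Ng n) _; exact: ltry.
have FL n : (F n : T -> R) \in Lfun m p%:E.
  apply/andP; split; rewrite !inE//=.
  by apply: le_lt_trans (NF n) _; exact: ltry.
have Fi n := Lfun_loc_integrable bmu mu_ball p1 (FL n).
exists f => n.
have osc t x : (0 < t)%R -> mean_osc mu (fun x => f x - S n x)%R t x <=
    \sum_(0 <= k <oo) mean_osc mu (F (k + n)%N) t x.
  move=> t0; apply: mean_osc_series => //.
    exact: (Lfun_loc_integrable bmu mu_ball p1 (gL n)).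
  move=> e e0; have [j je] : exists j : nat, (c / 2 ^+ (n + j) <= e)%R.
    have c10 : (0 < c + 1)%R by rewrite ltr_wpDl.
    have [j je] := ex_natSinv_lt (divr_gt0 e0 c10); exists j.
    apply: (@le_trans _ _ ((c + 1) * j.+1%:R^-1)%R).
      apply: ler_pM; rewrite ?invr_ge0 ?exprn_ge0 ?lerDl//.
      rewrite lef_pV2 ?posrE ?exprn_gt0// -natrX ler_nat.
      by apply: leq_trans (ltn_expl j (ltnSn 1)) _; rewrite leq_exp2l// leq_addl.
    by rewrite mulrC -ler_pdivlMr// ltW.
  exists j; rewrite (_ : (fun y => _) = (fun x => f x - S (n + j)%N x)%R); last first.
    apply/funext => y; rewrite -addrA -opprD; congr (_ - _)%R.
    rewrite /S big_split_ord/=; congr (_ + _)%R; apply: eq_bigr => k _ /=.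
    by rewrite addnC.
  by apply: le_trans (Ng (n + j)%N) _; rewrite lee_fin.
suff sem : besov_seminorm mu s p (fun x => f x - S n x)%R <= (c / 2 ^+ n)%:E.
  split; first by split; [exact: gL|apply: le_lt_trans sem _; exact: ltry].
  rewrite /besov_norm mulr_natl mulr2n EFinD.
  by apply: leeD; [exact: Ng|exact: sem].
have /choice[b bP] := fun k => oF (k + n)%N.
apply: (@le_trans _ _ (\int[lebesgue_measure]_(t in `]0%R, 1%R[)
    \sum_(0 <= k <oo) b k t)).
  rewrite /besov_seminorm integral_mkcond [leRHS]integral_mkcond.
  apply: le_integral_lower => t; rewrite !patchE.
    case: ifPn => // /set_mem/=; rewrite in_itv/= => /andP[t0 _].
    by rewrite !mule_ge0 ?Lnorm_ge0 ?lee_fin ?powR_ge0// invr_ge0 ltW.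
  case: ifPn => // /set_mem/=; rewrite in_itv/= => t01; have /andP[t0 t1] := t01.
  (* The majorants in space are chosen separately at each [t]; measurability in [t] rests on [b]. *)
  have /choice[M MP] : forall k, exists M : X -> \bar R,
      [/\ measurable_fun setT (M : T -> \bar R), forall x, 0 <= M x,
          forall x, mean_osc mu (F (k + n)%N) t x <= M x &
          (t `^ (- s))%:E * 'N[m]_p%:E[M] * t^-1%:E <= b k t].
    by move=> k; have [_ _ /(_ t t01)] := bP k.
  apply: (@le_trans _ _ ((t `^ (- s))%:E * (\sum_(0 <= k <oo) 'N[m]_p%:E[M k]) * t^-1%:E)).
    apply: lee_wpmul2r; first by rewrite lee_fin invr_ge0 ltW.
    apply: lee_wpmul2l; first by rewrite lee_fin powR_ge0.
    apply: (@le_trans _ _ ('N[m]_p%:E[(fun x => \sum_(0 <= k <oo) M k x)])); last first.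
      by apply: (Lnorm_nneseries m p1) => [k|k x]; have [? + _ _] := MP k.
    apply: le_Lnorm => // x; rewrite gee0_abs; last exact: (mean_osc_ge0 mu_ball).
    apply: le_trans (lee_abs _); apply: le_trans (osc t x t0) _.
    apply: lee_nneseries => [k _ _|k _]; first exact: (mean_osc_ge0 mu_ball).
    by have [_ _ + _] := MP k; exact.
  rewrite -nneseriesZl => [|k _]; last exact: Lnorm_ge0.
  rewrite muleC -nneseriesZl => [|k _]; last by rewrite mule_ge0 ?Lnorm_ge0// lee_fin powR_ge0.
  apply: lee_nneseries => [k _ _|k _].
    by rewrite !mule_ge0 ?Lnorm_ge0// lee_fin ?powR_ge0// invr_ge0 ltW.
  by rewrite muleC; have [] := MP k.
have b0 k (t : R) : (0 < t < 1)%R -> 0 <= b k t.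
  move=> t01; have [_ _ /(_ t t01)[M [_ _ _]]] := bP k; apply: le_trans.
  by rewrite !mule_ge0 ?Lnorm_ge0// lee_fin ?powR_ge0// invr_ge0; case/andP: t01 => /ltW.
have mb k : measurable_fun (`]0%R, 1%R[%classic : set R) (b k) by have [] := bP k.
rewrite integral_nneseries//.
rewrite -tailsum; apply: lee_nneseries => [k _ _|k _].
  by apply: integral_ge0 => t; rewrite /= in_itv/=; exact: b0.
by rewrite addnS; have [] := bP k.
Qed.

End series.

(** * Linearity and uniqueness of traces *)

Section trace_algebra.
Context (R : realType) (X : completeMetricType R).
Variable mu : {outer_measure set X -> \bar R}.
Hypothesis bmu : <<s @open X >> `<=` mu.-caratheodory.
Hypothesis mu_ball : forall (x : X) (r : R), (0 < r)%R -> (0 < mu (ball x r) < +oo)%E.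
Variables (theta : R) (E : set X).
Local Open Scope ereal_scope.
Local Notation nu := (codim_hausdorff_on mu theta E).

Lemma ball_avg_distB (f g : X -> R) (a b : R) (x : X) (r : R) : (0 < r)%R ->
  (cara mu).-integrable (ball x r) (EFin \o f) ->
  (cara mu).-integrable (ball x r) (EFin \o g) ->
  ball_avg mu (fun y => `|f y - g y - (a - b)|%:E) x r <=
  ball_avg mu (fun y => `|f y - a|%:E) x r + ball_avg mu (fun y => `|g y - b|%:E) x r.
Proof.
move=> r0 fi gi; rewrite -ball_avgD//; last 2 first.
- exact/measurable_dist/measurable_int/fi.
- exact/measurable_dist/measurable_int/gi.
apply: (le_ball_avg mu_ball r0) => y _; rewrite lee_fin normr_ge0 -EFinD lee_fin.
have -> : (f y - g y - (a - b) = (f y - a) - (g y - b))%R by ring.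
exact: ler_normB.
Qed.

Lemma is_traceB (f g phi psi : X -> R) : is_trace mu theta E f phi ->
  is_trace mu theta E g psi ->
  is_trace mu theta E (fun x => f x - g x)%R (fun x => phi x - psi x)%R.
Proof.
move=> [fi mphi fphi] [gi mpsi gpsi]; split.
- move=> x r r0; rewrite (_ : EFin \o _ = (EFin \o f) \- (EFin \o g)); last first.
    exact/funext.
  by apply: integrableB; [exact: ball_measurable_cara|exact: fi|exact: gi].
- exact: measurable_funB.
apply: (@filterS2 _ _ (ae_filter_ringOfSetsType (cara nu)) _ _ _ _ fphi gpsi).
move=> x fx gx Ex; apply: near_le_cvge0.
  move=> r; rewrite /ball_avg mule_ge0 ?inve_ge0//.
  by apply: integral_ge0 => y _; rewrite lee_fin.
move=> e e0; have e20 : (0 < e / 2)%R by rewrite divr_gt0.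
near=> r; have r0 : (0 < r)%R by near: r; exact: nbhs_right_gt.
apply: le_trans (ball_avg_distB _ _ r0 (fi x r r0) (gi x r r0)) _.
rewrite [e]splitr EFinD; apply: leeD; apply: ltW; near: r.
  exact: (cvge0_near_lt (fx Ex) e20).
exact: (cvge0_near_lt (gx Ex) e20).
Unshelve. all: by end_near. Qed.

(** The distance of the two values is a constant, hence equal to its average over small balls, and
    this is at most the sum of two averages tending to 0. *)
Lemma trace_ae_unique (f phi psi : X -> R) : is_trace mu theta E f phi ->
  is_trace mu theta E f psi -> {ae cara nu, forall x, phi x = psi x}.
Proof.
move=> [fi mphi fphi] [_ mpsi fpsi].
apply: (@filterS3 _ _ (ae_filter_ringOfSetsType (cara nu)) _ _ _ _ _
  (nu_ae_mem mu theta E) fphi fpsi).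
move=> x Ex fx gx; apply/eqP; rewrite -subr_eq0 -normr_le0; apply/ler_addgt0Pl => e e0.
rewrite addr0; have e20 : (0 < e / 2)%R by rewrite divr_gt0.
have [r /= [[r0 rphi] rpsi]] : exists r : R,
    ((0 < r)%R /\ ball_avg mu (fun y => `|f y - phi x|%:E) x r < (e / 2)%:E) /\
    ball_avg mu (fun y => `|f y - psi x|%:E) x r < (e / 2)%:E.
  apply: (@filter_ex _ _ (at_right_proper_filter (0%R : R))).
  apply: filterI; last exact: (cvge0_near_lt (gx Ex) e20).
  by apply: filterI; [exact: nbhs_right_gt|exact: (cvge0_near_lt (fx Ex) e20)].
rewrite -lee_fin -(ball_avg_cst bmu mu_ball `|phi x - psi x|%:E x r0).
have := ball_avg_distB (phi x) (psi x) r0 (fi x r r0) (fi x r r0).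
have -> : (fun y => `|f y - f y - (phi x - psi x)|%:E) = fun=> `|phi x - psi x|%:E.
  by apply/funext => y; rewrite subrr sub0r normrN.
by move=> /le_trans; apply; rewrite [e]splitr EFinD; apply: leeD; exact: ltW.
Qed.

Lemma is_trace_ae (f phi psi : X -> R) : is_trace mu theta E f phi ->
  measurable_fun setT (psi : caratheodory_type nu -> R) ->
  {ae cara nu, forall x, phi x = psi x} -> is_trace mu theta E f psi.
Proof.
move=> [fi mphi fphi] mpsi pp; split; [exact: fi|exact: mpsi|].
apply: (@filterS2 _ _ (ae_filter_ringOfSetsType (cara nu)) _ _ _ _ fphi pp).
by move=> x fx <-.
Qed.

Lemma lip_is_trace (F G : X -> R) : lipschitz_fun F -> loc_integrable mu F ->
  measurable_fun setT (G : caratheodory_type nu -> R) ->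
  (forall x, E x -> F x = G x) -> is_trace mu theta E F G.
Proof.
move=> [L FL] Fi mG FG; split=> //; apply: aeW => x Ex.
apply: near_le_cvge0.
  move=> r; rewrite /ball_avg mule_ge0 ?inve_ge0//.
  by apply: integral_ge0 => y _; rewrite lee_fin.
move=> e e0; have L0 : (0 < `|L| + 1)%R by rewrite ltr_wpDl.
near=> r; have r0 : (0 < r)%R by near: r; exact: nbhs_right_gt.
rewrite -(ball_avg_cst bmu mu_ball e%:E x r0).
apply: (le_ball_avg mu_ball r0) => y /ballP xy; rewrite lee_fin normr_ge0/= lee_fin.
rewrite -FG// distrC; apply: le_trans (FL x y) _.
apply: (@le_trans _ _ ((`|L| + 1) * r)%R).
  apply: (@le_trans _ _ ((`|L| + 1) * mdist x y)%R).
    by rewrite ler_wpM2r ?mdist_ge0// (le_trans (ler_norm L))// lerDl.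
  by rewrite ler_wpM2l// ltW.
have : (r <= e / (`|L| + 1))%R.
  by near: r; apply: nbhs_right_le; rewrite divr_gt0.
by rewrite ler_pdivlMr// mulrC.
Unshelve. all: by end_near. Qed.

End trace_algebra.

(** * Extension of L_p functions on the regular set *)

Section besov_extension.
Context (R : realType) (X : completeMetricType R).
Variable mu : {outer_measure set X -> \bar R}.
Hypothesis bmu : <<s @open X >> `<=` mu.-caratheodory.
Hypothesis mu_ball : forall (x : X) (r : R), (0 < r)%R -> (0 < mu (ball x r) < +oo)%E.
Hypothesis sepX : separable X.
Variable C : R.
Hypothesis C0 : 0 < C.
Hypothesis dbl : forall (x : X) (r : R), (0 < r <= 8)%R ->
  (mu (ball x (2 * r)%R) <= C%:E * mu (ball x r))%E.
Variables (theta p : R) (E : set X).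
Hypothesis p1 : 1 <= p.
Hypothesis theta0 : 0 < theta.
Hypothesis thetap : theta < p.
Hypothesis closedE : closed E.
Local Open Scope ereal_scope.
Local Notation m := (cara mu).
Local Notation nu := (codim_hausdorff_on mu theta E).
Local Notation s := (theta / p)%R.
Variables c1 c2 : R.
Hypothesis c10 : (0 < c1)%R.
Hypothesis c20 : (0 < c2)%R.
Hypothesis nu_ge : forall (x : X) (r : R), E x -> (0 < r <= 1)%R ->
  c1%:E * (mu (ball x r) * (r `^ theta)^-1%:E) <= nu (ball x r).
Hypothesis nu_le : forall (x : X) (r : R), E x -> (0 < r <= 1)%R ->
  nu (ball x r) <= c2%:E * (mu (ball x r) * (r `^ theta)^-1%:E).

Let bnu : <<s @open X >> `<=` nu.-caratheodory.
Proof. exact: codim_hausdorff_on_borel. Qed.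

Let p0 : (0 < p)%R. Proof. exact: lt_le_trans p1. Qed.

Lemma besov_extension : exists K : R, (0 < K)%R /\ forall (phi : X -> R) (q : R),
  (phi : caratheodory_type nu -> R) \in Lfun (cara nu) p%:E ->
  'N[cara nu]_p%:E[EFin \o phi] < q%:E ->
  exists f : X -> R, [/\ besov mu s p f, is_trace mu theta E f phi &
    besov_norm mu s p f <= (K * q)%:E].
Proof.
pose x0 : X := point.
have [KE [KE0 ext]] := lip_extension bmu mu_ball sepX C0 dbl p1 theta0 thetap
  closedE c10 c20 nu_ge nu_le x0.
have [KT [KT0 tr]] := besov_trace bmu mu_ball sepX C0 dbl p1 theta0 c20 nu_le.
exists (8 * KE)%R; split; first by rewrite mulr_gt0.
move=> phi q phiL phiq; have := phiL => /andP[/[!inE]/= mphi _].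
have q0 : (0 < q)%R by rewrite -lte_fin; apply: le_lt_trans phiq; exact: Lnorm_ge0.
have q2 n : (0 < q / 2 ^+ n)%R by rewrite divr_gt0// exprn_gt0.
have nu_fin := codim_hausdorff_on_ball bmu mu_ball sepX C0 dbl closedE c20 nu_le x0.
(* Starting from [Psi 0 = 0] makes the first n differences sum to [Psi n]. *)
have /choice[Psi PsiP] : forall n : nat, exists G : X -> R, [/\ lip_bsupp x0 G,
    n = 0%N -> G = cst 0%R & 'N[cara nu]_p%:E[EFin \o (phi \- G)%R] <= (q / 2 ^+ n)%:E].
  case=> [|n].
    exists (cst 0%R); split=> //; first exact: lip_bsupp0.
    rewrite expr0 divr1 (_ : (phi \- cst 0)%R = phi); first exact: ltW.
    by apply/funext => x /=; rewrite subr0.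
  have [G lG phiG] := lip_bsupp_dense bnu p1 nu_fin
    (codim_hausdorff_on_regular mu theta E) phiL (q2 n.+1).
  by exists G; split.
have mPsi n : measurable_fun setT (Psi n : caratheodory_type nu -> R).
  by have [[lP _] _ _] := PsiP n; exact: lip_measurable_cara.
pose G n : X -> R := (Psi n.+1 \+ (fun x => -1 * Psi n x))%R.
(* [G n] has norm at most 3/2 times [q / 2 ^+ n], while [Q n] is twice that quantity: the margin
   gives the strict bound asked for by the extension. *)
pose Q n := (4 * q / (2 ^ n.+1)%:R)%R.
have GQ n : 'N[cara nu]_p%:E[EFin \o G n] < (Q n)%:E.
  have [_ _ Pn] := PsiP n; have [_ _ Pn1] := PsiP n.+1.
  have -> : G n = ((phi \- Psi n) \+ (Psi n.+1 \- phi))%R.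
    by apply/funext => x; rewrite /G /=; ring.
  apply: le_lt_trans (minkowski_EFin _ _ _ p1) _; try exact: measurable_funB.
  apply: (@le_lt_trans _ _ ((q / 2 ^+ n)%:E + (q / 2 ^+ n.+1)%:E)).
    apply: leeD => //; apply: le_trans Pn1; apply: le_Lnorm => // x.
    by rewrite /= distrC.
  rewrite -EFinD lte_fin /Q natrX exprS -subr_gt0.
  rewrite (_ : _ - _ = q / 2 ^+ n / 2)%R; first by rewrite divr_gt0.
  by field; rewrite expf_neq0.
have lG n : lip_bsupp x0 (G n).
  by have [l1 _ _] := PsiP n.+1; have [l0 _ _] := PsiP n; apply: lip_bsuppD => //; exact: lip_bsuppZ.
have /choice[F FP] := fun n => ext _ _ (lG n) (GQ n).
have mF n : measurable_fun setT (F n : caratheodory_type mu -> R).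
  by have [lF _ _ _] := FP n; exact: lip_measurable_cara.
pose c := (KE * (4 * q))%R.
have cE n : (KE * Q n = c / (2 ^ n.+1)%:R)%R by rewrite /Q /c mulrA.
have c0 : (0 <= c)%R by rewrite /c !mulr_ge0// ltW.
have NF n : 'N[m]_p%:E[EFin \o F n] <= (c / (2 ^ n.+1)%:R)%:E.
  by have [_ _ + _] := FP n; rewrite cE.
have oF n : osc_majorized mu theta p (F n) (c / (2 ^ n.+1)%:R).
  by have [_ _ _ +] := FP n; rewrite cE.
have [f fP] := besov_series bmu mu_ball p1 c0 mF NF oF.
have f0 : (fun x => f x - \sum_(k < 0) F k x)%R = f.
  by apply/funext => x; rewrite big_ord0 subr0.
have [] := fP 0%N; rewrite f0 => Bf Nf.
have [psi [fpsi _]] := tr f Bf.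
have mpsi : measurable_fun setT (psi : caratheodory_type nu -> R) by case: fpsi.
have FL n : (F n : caratheodory_type mu -> R) \in Lfun m p%:E.
  apply/andP; split; rewrite !inE//=.
  by apply: le_lt_trans (NF n) _; exact: ltry.
have mG n : measurable_fun setT (G n : caratheodory_type nu -> R).
  by have [lGn _] := lG n; exact: lip_measurable_cara.
have trn n : is_trace mu theta E (fun x => f x - \sum_(k < n) F k x)%R
    (fun x => psi x - Psi n x)%R.
  elim: n => [|n IH].
    rewrite f0 (_ : (fun x => _) = psi)//.
    by have [_ -> // _] := PsiP 0%N; apply/funext => x /=; rewrite subr0.
  have FG : is_trace mu theta E (F n) (G n).
    have [lF FGE _ _] := FP n; apply: lip_is_trace => //.
    exact: (Lfun_loc_integrable bmu mu_ball p1 (FL n)).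
  have := is_traceB bmu mu_ball IH FG.
  rewrite (_ : (fun x => f x - _ - F n x)%R = (fun x => f x - \sum_(k < n.+1) F k x)%R).
    rewrite (_ : (fun x => psi x - _ - G n x)%R = (fun x => psi x - Psi n.+1 x)%R)//.
    by apply/funext => x; rewrite /G /=; ring.
  by apply/funext => x; rewrite big_ord_recr/= opprD addrA.
(* The trace bound yields some trace of the n-th remainder with small norm; by uniqueness it agrees
   almost everywhere with [psi - Psi n]. *)
have Npsi n : 'N[cara nu]_p%:E[EFin \o (psi \- Psi n)%R] <= (KT * (2 * (c / 2 ^+ n)))%:E.
  have [Bn Nn] := fP n; have [chi [trchi Nchi]] := tr _ Bn.
  have mchi : measurable_fun setT (chi : caratheodory_type nu -> R) by case: trchi.
  have ae := trace_ae_unique bmu mu_ball trchi (trn n).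
  rewrite -(@eq_Lnorm_ae _ _ _ (cara nu) _ (EFin \o chi)).
  - by apply: le_trans Nchi _; rewrite EFinM lee_wpmul2l// lee_fin ltW.
  - exact/measurable_EFinP.
  - by apply/measurable_EFinP; exact: measurable_funB.
  - apply: (@filterS _ _ (ae_filter_ringOfSetsType (cara nu)) _ _ _ ae).
    by move=> x /= ->.
have N0 : 'N[cara nu]_p%:E[EFin \o (psi \- phi)%R] = 0.
  apply/eqP; rewrite eq_le Lnorm_ge0 andbT; apply/lee_addgt0Pr => e e0.
  pose D := (KT * 2 * c + q)%R.
  have D0 : (0 < D)%R by rewrite ltr_wpDl// !mulr_ge0// ltW.
  have [n ne] := ex_natSinv_lt (divr_gt0 e0 D0).
  rewrite add0e; apply: (@le_trans _ _ (D / 2 ^+ n)%:E).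
    have -> : (psi \- phi)%R = ((psi \- Psi n) \+ (Psi n \- phi))%R.
      by apply/funext => x /=; rewrite addrA subrK.
    apply: le_trans (minkowski_EFin _ _ _ p1) _; try exact: measurable_funB.
    rewrite (_ : (D / 2 ^+ n)%:E = (KT * (2 * (c / 2 ^+ n)))%:E + (q / 2 ^+ n)%:E).
      apply: leeD; first exact: Npsi.
      have [_ _ Pn] := PsiP n; apply: le_trans Pn; apply: le_Lnorm => // x.
      by rewrite /= distrC.
    by rewrite -EFinD /D; congr EFin; field; rewrite expf_neq0.
  rewrite lee_fin mulrC -ler_pdivlMr//; apply: le_trans (ltW ne).
  by rewrite lef_pV2 ?posrE ?exprn_gt0// -natrX ler_nat; exact: ltn_expl.
have mpp : measurable_fun setT ((EFin \o (psi \- phi)%R) : caratheodory_type nu -> \bar R).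
  by apply/measurable_EFinP; exact: measurable_funB.
have p0E : 0 < p%:E by rewrite lte_fin.
have ae0 := Lnorm_eq0_eq0 mpp p0E N0.
exists f; split; first exact: Bf.
- apply: (is_trace_ae fpsi mphi).
  apply: (@filterS _ _ (ae_filter_ringOfSetsType (cara nu)) _ _ _ ae0).
  by move=> x /(_ I) /= [] /eqP; rewrite subr_eq0 => /eqP.
- apply: le_trans Nf _; rewrite lee_fin expr0 divr1 /c.
  by rewrite (_ : 2 * (KE * (4 * q)) = 8 * KE * q)%R//; ring.
Qed.

End besov_extension.

(** The lower constant is the inverse of the trace constant, whose bound holds for every [f] with
    trace [phi]; the upper one is the extension constant. *)
Theorem corollary1p5 (R : realType) (X : completeMetricType R)
    (mu : {outer_measure set X -> \bar R}) (p theta : R) (E : set X)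
    (hX : metric_measure_space mu) (hp : 1 <= p) (hadm : admissible mu p)
    (htheta : 0 < theta < p) (hE : codim_regular mu theta E) :
  let nu := cara (codim_hausdorff_on mu theta E) in
  let B := besov mu (theta / p) p in
  [/\
      forall f, B f -> exists phi, is_trace mu theta E f phi,
      forall f phi psi, is_trace mu theta E f phi -> is_trace mu theta E f psi ->
        {ae nu, forall x, phi x = psi x},
      trace_space mu theta E B = [set` Lfun nu p%:E] &
      exists c C : R, [/\ 0 < c, 0 < C &
        forall phi, phi \in Lfun nu p%:E ->
          (c%:E * 'N[nu]_p%:E[EFin \o phi]
             <= trace_norm mu theta E B (besov_norm mu (theta / p) p) phi
             <= C%:E * 'N[nu]_p%:E[EFin \o phi])%E]].
Proof.
move=> nu B; have [sepX [bmu _] mu_ball] := hX.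
(* All balls compared by doubling have radius at most 16, so the doubling constant for radii up to 8
   serves throughout. *)
have [[C C0 dbl] _] := conj (hadm.1 8 ltac:(by rewrite ltr0n)) I.
have /andP[theta0 thetap] := htheta.
have [closedE [c1 [c2 [c10 c20 nuE]]]] := hE.
have nu_ge x r : E x -> 0 < r <= 1 ->
    (c1%:E * (mu (ball x r) * (r `^ theta)^-1%:E) <= codim_hausdorff_on mu theta E (ball x r))%E.
  by move=> Ex r01; have /andP[] := nuE x r Ex r01.
have nu_le x r : E x -> 0 < r <= 1 ->
    (codim_hausdorff_on mu theta E (ball x r) <= c2%:E * (mu (ball x r) * (r `^ theta)^-1%:E))%E.
  by move=> Ex r01; have /andP[] := nuE x r Ex r01.
have p0 : 0 < p by exact: lt_le_trans hp.
have [KT [KT0 tr]] := besov_trace bmu mu_ball sepX C0 dbl hp theta0 c20 nu_le.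
have [KE [KE0 ext]] := besov_extension bmu mu_ball sepX C0 dbl hp theta0 thetap
  closedE c10 c20 nu_ge nu_le.
have trace_le f phi : B f -> is_trace mu theta E f phi ->
    ('N[nu]_p%:E[EFin \o phi] <= KT%:E * besov_norm mu (theta / p) p f)%E.
  move=> Bf fphi; have [psi [fpsi psif]] := tr f Bf; apply: le_trans psif.
  have [_ mphi _] := fphi; have [_ mpsi _] := fpsi.
  rewrite le_eqVlt; apply/orP; left; apply/eqP; apply: eq_Lnorm_ae.
  - exact/measurable_EFinP.
  - exact/measurable_EFinP.
  - apply: (@filterS _ _ (ae_filter_ringOfSetsType nu) _ _ _
      (trace_ae_unique bmu mu_ball fphi fpsi)).
    by move=> x /= ->.
have norm_fin f : B f -> (besov_norm mu (theta / p) p f < +oo)%E.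
  move=> [/andP[_ /[!inE]/= fp] sf]; exact: lte_add_pinfty.
split.
- by move=> f Bf; have [phi [fphi _]] := tr f Bf; exists phi.
- by move=> f phi psi; exact: trace_ae_unique.
- apply/seteqP; split=> phi.
    move=> [f Bf fphi]; have [_ mphi _] := fphi.
    apply/andP; split; rewrite !inE//=.
    apply: le_lt_trans (trace_le f phi Bf fphi) _.
    by rewrite lte_mul_pinfty ?lee_fin ?ltW//; exact: norm_fin.
  move=> /= phiL; have /andP[_ /[!inE]/= phiy] := phiL.
  have phif : ('N[nu]_p%:E[EFin \o phi] \is a fin_num)%E.
    by rewrite ge0_fin_numE// Lnorm_ge0.
  have [|f [Bf fphi _]] := ext phi (fine ('N[nu]_p%:E[EFin \o phi])%E + 1) phiL.
    by rewrite EFinD fineK// lteDl ?lte_fin.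
  by exists f.
exists KT^-1, KE; split; rewrite ?invr_gt0// => phi phiL; apply/andP; split.
  apply: le_ereal_inf_tmp => _ [f [Bf fphi] <-].
  by rewrite lee_pdivrMl//; exact: trace_le.
have /andP[_ /[!inE]/= phiy] := phiL.
have phif : ('N[nu]_p%:E[EFin \o phi] \is a fin_num)%E.
  by rewrite ge0_fin_numE// Lnorm_ge0.
apply/lee_addgt0Pr => e e0; have eK : 0 < e / KE by rewrite divr_gt0.
(* The extension asks for a number strictly above the norm; the slack [e / KE] contributes [e] to
   the final bound. *)
have [|f [Bf fphi fle]] := ext phi (fine ('N[nu]_p%:E[EFin \o phi])%E + e / KE) phiL.
  by rewrite EFinD fineK// lteDl ?lte_fin.
apply: (@le_trans _ _ (besov_norm mu (theta / p) p f)).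
  by apply: ereal_inf_lbound; exists f.
apply: le_trans fle _; rewrite mulrDr EFinD EFinM fineK// leeD2l// lee_fin.
by rewrite mulrC divfK// gt_eqF.
Qed.
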